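(* Let $K=\mathbb{Q}(\sqrt{D})$ be an imaginary quadratic field of discriminant $D<0$ with ring of integers $\mathcal{O}$, and for $1/2<s<1$ define \[ m_{s,K}(x)=\sum_{0\neq\mathfrak{a}\subset\mathcal{O}}\frac{e^{-2\pi i x N(\mathfrak{a})}}{N(\mathfrak{a})^s},\qquad x\in[0,1], \] where $\mathfrak{a}$ ranges over the nonzero integral ideals of $\mathcal{O}$ and $N(\mathfrak{a})=\#(\mathcal{O}/\mathfrak{a})$ is the ideal norm. Then $m_{s,K}$ belongs to weak-type $L^{1/(1-s)}[0,1]$; that is, there is a constant $c$ with $|\{x\in[0,1]:|m_{s,K}(x)|>\alpha\}|\le c\,\alpha^{-1/(1-s)}$ for all $\alpha>0$.
   Context: For $s>1/2$ the series defining $m_{s,K}$ (grouped by the value of $N(\mathfrak{a})$) converges in $L^2[0,1]$. A function $g$ on $[0,1]$ is of weak-type $L^r[0,1]$ ($r>0$) if $|\{x\in[0,1]:|g(x)|>\alpha\}|\le c\,\alpha^{-r}$ for all $\alpha>0$, with $c$ independent of $\alpha$. *)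

(* Defs.v *)
From HB Require Import structures.
From mathcomp Require Import all_boot all_order all_algebra.
From mathcomp Require Import all_classical all_reals all_analysis.
Set Implicit Arguments. Unset Strict Implicit. Unset Printing Implicit Defensive.
Import Order.TTheory GRing.Theory Num.Theory.
Local Open Scope classical_set_scope.
Local Open Scope ring_scope.

Definition int_squarefree (m : int) : Prop :=
  forall k : nat, (k%:Z * k%:Z %| m)%Z -> k = 1%N.

Definition fundamental_disc (D : int) : Prop :=
  D <> 1 /\
  ((D %% 4 = 1 /\ int_squarefree D)%Z \/
   (exists m : int, D = 4 * m /\ ((m %% 4 = 2) \/ (m %% 4 = 3))%Z /\ int_squarefree m)).

(* ---------- The ring of integers O = Z[w], w = (D + sqrt D)/2 ----------
   An element (a, b) represents a + b w, and w^2 = D w - (D^2 - D)/4. *)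
Definition OK := (int * int)%type.

Definition Ozero : OK := (0, 0).
Definition Oadd (x y : OK) : OK := (x.1 + y.1, x.2 + y.2).
Definition Oopp (x : OK) : OK := (- x.1, - x.2).
Definition Omul (D : int) (x y : OK) : OK :=
  let q := ((D * D - D) %/ 4)%Z in
  (x.1 * y.1 - x.2 * y.2 * q, x.1 * y.2 + x.2 * y.1 + x.2 * y.2 * D).

Definition nz_ideal (D : int) (I : set OK) : Prop :=
  I Ozero /\
  (forall x y, I x -> I y -> I (Oadd x y)) /\
  (forall x, I x -> I (Oopp x)) /\
  (forall r x, I x -> I (Omul D r x)) /\
  I <> [set Ozero].

Definition ideal_norm_is (I : set OK) (n : nat) : Prop :=
  exists r : 'I_n -> OK, forall x : OK, exists! i : 'I_n, I (Oadd x (Oopp (r i))).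

Definition ideal_count_is (D : int) (n k : nat) : Prop :=
  exists f : 'I_k -> set OK, injective f /\
    forall I : set OK, (nz_ideal D I /\ ideal_norm_is I n) <-> exists i, f i = I.

Definition ideal_count (D : int) (n : nat) : nat :=
  xget 0%N [set k | ideal_count_is D n k].

(* real and imaginary parts of  sum_{N(a) <= N} e^{-2 pi i x N(a)} / N(a)^s *)
Definition mpartial_re (R : realType) (D : int) (s : R) (N : nat) (x : R) : R :=
  \sum_(1 <= n < N.+1)
     (ideal_count D n)%:R * (n%:R `^ (- s)) * cos (2 * pi * x * n%:R).
Definition mpartial_im (R : realType) (D : int) (s : R) (N : nat) (x : R) : R :=
  \sum_(1 <= n < N.+1)
     - ((ideal_count D n)%:R * (n%:R `^ (- s)) * sin (2 * pi * x * n%:R)).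

Definition is_L2_limit (R : realType) (D : int) (s : R) (mre mim : R -> R) : Prop :=
  measurable_fun (`[0%R, 1%R]%classic : set R) mre /\ measurable_fun (`[0%R, 1%R]%classic : set R) mim /\
  ((fun N : nat => (\int[@lebesgue_measure R]_(x in (`[0%R, 1%R]%classic : set R))
       (((mpartial_re D s N x - mre x) ^+ 2 + (mpartial_im D s N x - mim x) ^+ 2)%:E))%E)
     @ \oo --> 0%E).

(* Main.v *)
Require Import Defs.
From HB Require Import structures.
From mathcomp Require Import all_boot all_order all_algebra.
From mathcomp Require Import all_classical all_reals all_analysis.
From mathcomp Require Import complex measurable_realfun.
From mathcomp Require Import ring lra zify.
Set Implicit Arguments. Unset Strict Implicit. Unset Printing Implicit Defensive.
Import Order.TTheory GRing.Theory Num.Theory.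
Import numFieldNormedType.Exports.
Local Open Scope classical_set_scope.
Local Open Scope ring_scope.

(* By the finiteness of the ideal classes, the number of ideals of norm n is, up to a constant factor, the number of representations of n by finitely many positive definite binary forms Q, so m_{s,K} is a combination of sums of Q(v)^(-s) e(-x Q(v)) over the lattice. Split these into dyadic shells |v| ~ 2^j. Weyl differencing in both variables and Abel summation bound the shell by 4^(-js) T_j(x), where T_j(x) = sum_{|l| <= C 2^j} min(2^j, 1/||l x||). The sum T_j is at most a constant times 4^j U^(-kappa), for any fixed kappa < 1, unless ||q x|| <= U / 4^j for some q <= U: look at the first q with ||q x|| <= 1/(2N), N being the number of terms. Given alpha, put tau = alpha^(1/(1-s)) and fix 1 - s < rho < 1/2, which is possible as s > 1/2. Removing at each level 4^j > tau the arcs ||q x|| <= U_j / 4^j, q <= U_j = (4^j / tau)^rho, costs measure O(sum_j U_j^2 / 4^j) = O(1/tau), and off these arcs the truncated sum is O(alpha).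

Hence the truncations are uniformly of weak type 1/(1-s). As 1/(1-s) > 2 they are uniformly bounded in L^2, so by Parseval the coefficients are square summable; Riesz-Fischer gives the L^2 limit, and the weak type bound passes to it. *)

(** * The ring of integers *)

(** The two conditions on rho pull in opposite directions. A level 4^j > tau contributes at most a
    constant times tau^(1 - s) (4^j / tau)^(1 - s), which grows with j, and the saving U_j^(-kappa)
    has to outweigh this growth: rho kappa > 1 - s, with kappa < 1. The removed arcs have measure
    about U_j^2 / 4^j, which is summable with the right total only if 2 rho < 1. Both fit exactly
    when s > 1/2. A saving with kappa < 1 is used because the sum of the 1/||l x|| carries a
    logarithm, which a small power absorbs.

    The truncations run over lattice squares, because the region between a square and its double
    splits into rectangles, on which Weyl differencing and Abel summation work. They are not partial
    sums of the series in n; but their coefficients lie between 0 and those of the series and agree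
    with them up to any prescribed n once the square is large. The passage to the limit compares
    coefficients in this way.

    Fractional ideals are avoided: two ideals are in the same class when a I = b J for nonzero a, b
    in the ring, and quotients appear as cross multiplications. *)

(* [OK] equipped with the ring structure of Z[w]; on the bare product type [int * int] the library's product ring structure would be inferred. *)
Definition quad (D : int) : Type := (int * int)%type.

HB.instance Definition _ D := Choice.on (quad D).

Section QuadRing.
Variable D : int.
Local Notation q := ((D * D - D) %/ 4)%Z.

Definition quad1 : quad D := (1, 0).

Lemma quad_addA : associative (Oadd : quad D -> quad D -> quad D).
Proof. by move=> [a b] [c d] [e f]; rewrite /Oadd /= !addrA. Qed.
Lemma quad_addC : commutative (Oadd : quad D -> quad D -> quad D).
Proof. by move=> [a b] [c d]; rewrite /Oadd /= addrC (addrC b). Qed.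
Lemma quad_add0 : left_id (Ozero : quad D) Oadd.
Proof. by move=> [a b]; rewrite /Oadd /= !add0r. Qed.
Lemma quad_addN : left_inverse (Ozero : quad D) Oopp Oadd.
Proof. by move=> [a b]; rewrite /Oadd /= !addNr. Qed.
HB.instance Definition _ := GRing.isZmodule.Build (quad D) quad_addA quad_addC quad_add0 quad_addN.

Lemma quad_addE (x y : quad D) : x + y = (x.1 + y.1, x.2 + y.2).
Proof. by []. Qed.

Lemma quad_mulA : associative (Omul D : quad D -> quad D -> quad D).
Proof. by move=> [a b] [c d] [e f]; rewrite /Omul /=; congr pair; ring. Qed.
Lemma quad_mulC : commutative (Omul D : quad D -> quad D -> quad D).
Proof. by move=> [a b] [c d]; rewrite /Omul /=; congr pair; ring. Qed.
Lemma quad_mul1 : left_id quad1 (Omul D).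
Proof. by move=> [a b]; rewrite /Omul /=; congr pair; ring. Qed.
Lemma quad_mulDl : left_distributive (Omul D : quad D -> quad D -> quad D) +%R.
Proof.
by move=> [a b] [c d] [e f]; rewrite !quad_addE /Omul /=; congr pair; ring.
Qed.
Lemma quad_1neq0 : quad1 != 0.
Proof. by []. Qed.
HB.instance Definition _ := GRing.Zmodule_isComNzRing.Build (quad D)
  quad_mulA quad_mulC quad_mul1 quad_mulDl quad_1neq0.

(** The field norm of [x.1 + x.2 w], where [w] has trace [D] and norm [q]. *)
Definition qnorm (x : quad D) : int := x.1 ^+ 2 + D * x.1 * x.2 + q * x.2 ^+ 2.

Definition qconj (x : quad D) : quad D := (x.1 + D * x.2, - x.2).

Lemma quad_mulE (x y : quad D) :
  x * y = (x.1 * y.1 - x.2 * y.2 * q, x.1 * y.2 + x.2 * y.1 + x.2 * y.2 * D).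
Proof. by []. Qed.
Lemma quad_subE (x y : quad D) : x - y = (x.1 - y.1, x.2 - y.2).
Proof. by []. Qed.

Lemma quad_intr (k : int) : k%:~R = (k, 0) :> quad D.
Proof.
have H (n : nat) : n%:R = (n%:Z, 0) :> quad D.
  elim: n => [//|n IH]; by rewrite -addn1 natrD IH quad_addE /=; congr pair; rewrite PoszD.
by case: k => n; rewrite ?NegzE ?mulrNz -?pmulrn H.
Qed.

Lemma quad_scale (k : int) (x : quad D) : k%:~R * x = (k * x.1, k * x.2).
Proof. by rewrite quad_intr quad_mulE /=; congr pair; ring. Qed.

Lemma qnormM (x y : quad D) : qnorm (x * y) = qnorm x * qnorm y.
Proof. rewrite quad_mulE /qnorm /=; ring. Qed.

Lemma qnorm_conj (x : quad D) : qconj x * x = (qnorm x)%:~R.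
Proof.
rewrite quad_intr quad_mulE /qnorm /qconj /=; congr pair; ring.
Qed.

Lemma qnorm_int (k : int) : qnorm k%:~R = k ^+ 2.
Proof. by rewrite quad_intr /qnorm /=; ring. Qed.

Hypothesis D_lt0 : D < 0.
Hypothesis D_mod4 : 4 * q = D * D - D.

Lemma qnorm_gt0 (x : quad D) : x != 0 -> 0 < qnorm x.
Proof.
case: x => a b ab0; rewrite -(@pmulr_rgt0 _ 4)//.
have -> : 4 * qnorm (a, b) = (2 * a + D * b) ^+ 2 + (- D) * b ^+ 2.
  rewrite (_ : - D = 4 * q - D * D); last by rewrite D_mod4; ring.
  rewrite /qnorm /=; ring.
have [b0|b0] := eqVneq b 0.
  rewrite b0 mulr0 addr0 expr0n mulr0 addr0 exprn_even_gt0 //=.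
  rewrite mulf_neq0//; apply: contraNneq ab0 => ->; by rewrite b0.
rewrite ltr_wpDl ?sqr_ge0// mulr_gt0 ?oppr_gt0// exprn_even_gt0//.
Qed.

Lemma qnorm_eq0 (x : quad D) : (qnorm x == 0) = (x == 0).
Proof.
have [->|x0] := eqVneq x 0; first by rewrite /qnorm /=; apply/eqP; ring.
by rewrite gt_eqF// qnorm_gt0.
Qed.

Lemma quad_mul_eq0 (x y : quad D) : x * y = 0 -> (x == 0) || (y == 0).
Proof.
by move=> xy; rewrite -!qnorm_eq0 -mulf_eq0 -qnormM xy qnorm_eq0.
Qed.

Lemma quad_mulfI (x : quad D) : x != 0 -> injective ( *%R x).
Proof.
move=> x0 y z /eqP; rewrite -subr_eq0 -mulrBr => /eqP /quad_mul_eq0.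
by rewrite (negbTE x0) /= subr_eq0 => /eqP.
Qed.

Lemma quad_int_neq0 (k : int) : k != 0 -> k%:~R != 0 :> quad D.
Proof. by move=> k0; rewrite quad_intr; apply: contraNneq k0 => -[->]. Qed.

End QuadRing.

(** * Ideals of given norm *)

Section Ideals.
Variable D : int.
Hypothesis D_lt0 : D < 0.
Hypothesis D_mod4 : 4 * ((D * D - D) %/ 4)%Z = D * D - D.
Implicit Types (I J : set (quad D)) (x y : quad D) (u v k : int).

Definition ideal I := nz_ideal D I.

Lemma ideal0 I : ideal I -> I 0.
Proof. by case. Qed.
Lemma idealD I x y : ideal I -> I x -> I y -> I (x + y).
Proof. by case=> _ [H _]; exact: H. Qed.
Lemma idealM I x y : ideal I -> I y -> I (x * y).
Proof. by case=> _ [_ [_ [H _]]]; exact: H. Qed.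
Lemma idealB I x y : ideal I -> I x -> I y -> I (x - y).
Proof. by move=> [_ [H [N _]]] Ix Iy; apply: H => //; exact: N. Qed.
Lemma ideal_neq0 I : ideal I -> exists2 x, x != 0 & I x.
Proof.
move=> [I0 [_ [_ [_ H]]]]; apply: contrapT => NE; apply: H.
apply/seteqP; split=> [x Ix|x ->//]; apply: contrapT => /eqP x0.
by apply: NE; exists x.
Qed.

Lemma idealP I :
  I 0 -> (forall x y, I x -> I y -> I (x + y)) -> (forall x y, I y -> I (x * y)) ->
  (exists2 x, x != 0 & I x) -> ideal I.
Proof.
move=> I0 ID IM [x x0 Ix]; split; first exact: I0.
split; first exact: ID.
split; first by move=> y Iy; have := IM (- 1) y Iy; rewrite mulN1r.
split; first exact: IM.
by move=> E; move: Ix; rewrite E => /= xE; rewrite xE eqxx in x0.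
Qed.

(** Hermite normal form: [p] is the least positive rational integer in [I] and [k] the least
    positive second coordinate of an element of [I]. A nonzero remainder on division by [k] or [p]
    would contradict minimality. *)
Lemma ideal_hnf I : ideal I ->
  exists p k : nat, exists t : int, [/\ (0 < p)%N, (0 < k)%N &
    forall x, I x <-> exists u v : int, x = (u * p%:Z + v * t, v * k%:Z)].
Proof.
move=> idI; have [x0 x0_neq0 Ix0] := ideal_neq0 idI.
have N0 := qnorm_gt0 D_lt0 D_mod4 x0_neq0.
(* The norm of [x0], and this norm times [w], lie in [I]; hence both minima are taken over nonempty
   sets. *)
have IN : I ((qnorm x0, 0) : quad D).
  by rewrite -quad_intr -qnorm_conj; exact: idealM.
have IZ v x : I x -> I ((v * x.1, v * x.2) : quad D).
  by move=> Ix; rewrite -quad_scale; exact: idealM.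
pose P n := `[< (0 < n)%N /\ I ((n%:Z, 0) : quad D) >].
pose K n := `[< (0 < n)%N /\ exists t : int, I ((t, n%:Z) : quad D) >].
have exP : exists n, P n.
  exists `|qnorm x0|%N; apply/asboolP; split; first by rewrite absz_gt0 gt_eqF.
  by rewrite gez0_abs ?ltW.
have exK : exists n, K n.
  exists `|qnorm x0|%N; apply/asboolP; split; first by rewrite absz_gt0 gt_eqF.
  exists 0; rewrite gez0_abs ?ltW//.
  have := idealM ((0, 1) : quad D) idI IN.
  by rewrite (_ : _ * _ = (0, qnorm x0) :> quad D)// quad_mulE /=; congr pair; ring.
case: (ex_minnP exP) => p /asboolP[p0 Ip] pmin.
case: (ex_minnP exK) => k /asboolP[k0 [t It]] kmin.
exists p, k, t; split=> // x; split; last first.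
  move=> [u [v ->]].
  have := idealD idI (IZ u _ Ip) (IZ v _ It).
  by rewrite quad_addE /= mulr0 add0r.
move=> Ix.
have kz : k%:Z != 0 by lia.
have pz : p%:Z != 0 by lia.
exists ((x.1 - (x.2 %/ k)%Z * t) %/ p)%Z, (x.2 %/ k)%Z.
have x2 : (x.2 %% k)%Z = 0.
  have Ir : I ((x.1 - (x.2 %/ k)%Z * t, (x.2 %% k)%Z) : quad D).
    have := idealB idI Ix (IZ (x.2 %/ k)%Z _ It).
    by rewrite quad_subE /= (_ : x.2 - _ = (x.2 %% k)%Z)//; have := divz_eq x.2 k; lia.
  have := modz_ge0 x.2 kz; have := ltz_mod x.2 kz.
  case: (x.2 %% k)%Z Ir => // n Ir; rewrite ltz_nat => nk _.
  case: n Ir nk => // n Ir nk.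
  have Kn : K n.+1 by apply/asboolP; split=> //; exists (x.1 - (x.2 %/ k)%Z * t).
  by move: (kmin _ Kn) nk; lia.
have Iy : I ((x.1 - (x.2 %/ k)%Z * t, 0) : quad D).
  have := idealB idI Ix (IZ (x.2 %/ k)%Z _ It).
  by rewrite quad_subE /= (_ : x.2 - _ = 0)//; have := divz_eq x.2 k; lia.
set y := x.1 - _ in Iy *.
have y2 : (y %% p)%Z = 0.
  have Ir : I (((y %% p)%Z, 0) : quad D).
    have := idealB idI Iy (IZ (y %/ p)%Z _ Ip).
    by rewrite quad_subE /= mulr0 subr0 (_ : y - _ = (y %% p)%Z)//; have := divz_eq y p; lia.
  have := modz_ge0 y pz; have := ltz_mod y pz.
  case: (y %% p)%Z Ir => // n Ir; rewrite ltz_nat => np _.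
  case: n Ir np => // n Ir np.
  have Pn : P n.+1 by apply/asboolP.
  by move: (pmin _ Pn) np; lia.
rewrite [LHS]surjective_pairing; congr pair.
  by have := divz_eq y p; rewrite y2 addr0 => <-; rewrite /y subrK.
by rewrite {1}(divz_eq x.2 k) x2 addr0.
Qed.

Lemma ideal_norm_uniq I n m : ideal I ->
  ideal_norm_is I n -> ideal_norm_is I m -> n = m.
Proof.
move=> idI.
have le a b : ideal_norm_is I a -> ideal_norm_is I b -> (a <= b)%N.
  move=> [r rP] [s sP].
  have /choice[f fP] : forall i, exists j, I (r i - s j).
    by move=> i; have [j [? _]] := sP (r i); exists j.
  have finj : injective f.
    move=> i j fij.
    have [l [_ lU]] := rP (r i).
    rewrite -(lU i) ?[Oadd _ _]subrr; last first.
      by rewrite -[Oadd _ _]/(r i - r i) subrr; exact: ideal0.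
    apply: lU; have := idealB idI (fP i) (fP j).
    by rewrite fij opprB addrA subrK.
  by have := leq_card f finj; rewrite !card_ord.
by move=> hn hm; apply/eqP; rewrite eqn_leq !le.
Qed.

Lemma hnf_norm I (p k : nat) (t : int) : (0 < p)%N -> (0 < k)%N ->
  (forall x, I x <-> exists u v : int, x = (u * p%:Z + v * t, v * k%:Z)) ->
  ideal_norm_is I (p * k).
Proof.
clear D_lt0 D_mod4 => p0 k0 IE.
(* The residues are the points of the rectangle [0, p) x [0, k), numbered row by row. *)
exists (fun i : 'I_(p * k) => ((i %% p)%N%:Z, (i %/ p)%N%:Z)) => x.
have kz : k%:Z != 0 by lia.
have pz : p%:Z != 0 by lia.
set v := (x.2 %/ k)%Z; set j := (x.2 %% k)%Z.
set y := x.1 - v * t; set i := (y %% p)%Z.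
have j0 : 0 <= j := modz_ge0 _ kz.
have jk : j < k%:Z by have := ltz_mod x.2 kz; rewrite -/j; lia.
have i0 : 0 <= i := modz_ge0 _ pz.
have ip : i < p%:Z by have := ltz_mod y pz; rewrite -/i; lia.
have iE : i = `|i|%N%:Z by rewrite gez0_abs.
have jE : j = `|j|%N%:Z by rewrite gez0_abs.
have ip' : (`|i| < p)%N by rewrite -ltz_nat -iE.
have jk' : (`|j| < k)%N by rewrite -ltz_nat -jE.
have lt : (`|j| * p + `|i| < p * k)%N.
  apply: (@leq_trans (`|j|.+1 * p)); first by rewrite mulSn addnC ltn_add2r.
  by rewrite mulnC leq_mul2l jk' orbT.
have e1 : x.2 = v * k%:Z + j := divz_eq _ _.
have e2 : y = (y %/ p)%Z * p%:Z + i := divz_eq _ _.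
exists (Ordinal lt); split.
  apply/IE; exists (y %/ p)%Z, v; rewrite /Oadd /Oopp /=; congr pair.
    rewrite modnMDl modn_small// -iE; move: e2; rewrite /y; lia.
  rewrite divnMDl// divn_small// addn0 -jE; lia.
move=> l /IE [u [w]]; rewrite /Oadd /Oopp /= => -[E1 E2].
apply/val_inj => /=; rewrite (divn_eq l p).
have lp : ((l %% p)%N < p)%N by rewrite ltn_mod.
have lk : ((l %/ p)%N < k)%N by have := ltn_ord l; rewrite ltn_divLR// (mulnC k).
have vw : v = w.
  have : (v - w) * k%:Z = (l %/ p)%N%:Z - j by move: E2; rewrite e1; lia.
  set a := (l %/ p)%N in lk *.
  have -> : v = v - w + w by rewrite subrK.
  move: (v - w) => d Hd.
  have -> : d = 0 by nia.
  by rewrite add0r.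
have jl : j = (l %/ p)%N%:Z by move: E2; rewrite e1 vw; lia.
have il : i = (l %% p)%N%:Z.
  have : ((y %/ p)%Z - u) * p%:Z = (l %% p)%N%:Z - i.
    move: E1 e2; rewrite /y -vw; lia.
  set a := (l %% p)%N in lp *.
  move: (_ - u) => d Hd.
  have d0 : d = 0 by nia.
  by move: Hd; rewrite d0; lia.
by rewrite il jl.
Qed.

Lemma ideal_normE I : ideal I -> exists n, ideal_norm_is I n.
Proof.
by move=> /ideal_hnf[p [k [t [p0 k0 IE]]]]; exists (p * k)%N; exact: hnf_norm IE.
Qed.

(** The norm is [p * k] in the notation of [ideal_hnf], a multiple of the element [p]. *)
Lemma ideal_norm_mem I n : ideal I -> ideal_norm_is I n -> (0 < n)%N /\ I n%:~R.
Proof.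
move=> idI In; have [p [k [t [p0 k0 IE]]]] := ideal_hnf idI.
rewrite (ideal_norm_uniq idI In (hnf_norm p0 k0 IE)) muln_gt0 p0 k0; split=> //.
apply/IE; exists k%:Z, 0; rewrite quad_intr; congr pair; lia.
Qed.
End Ideals.

(** * Ideal classes *)

Section IdealClasses.
Variable D : int.
Hypothesis D_lt0 : D < 0.
Hypothesis D_mod4 : 4 * ((D * D - D) %/ 4)%Z = D * D - D.
Implicit Types (I J : set (quad D)) (x y a b : quad D) (u v k : int).
Let quadI := quad_mulfI D_lt0 D_mod4.

(* [a I = b J] *)
Definition same_scale a I b J :=
  [/\ a != 0, b != 0, forall x, I x -> exists2 y, J y & a * x = b * y &
      forall y, J y -> exists2 x, I x & a * x = b * y].

Lemma same_scale_sym a I b J : same_scale a I b J -> same_scale b J a I.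
Proof.
move=> [a0 b0 H1 H2]; split=> // [x /H2[y]|x /H1[y]]; by exists y.
Qed.

Lemma same_scale_trans a I b J c d L :
  same_scale a I b J -> same_scale c J d L -> same_scale (a * c) I (b * d) L.
Proof.
have mul0 x y : x != 0 -> y != 0 -> x * y != 0.
  move=> x0 y0; apply/eqP => /(quad_mul_eq0 D_lt0 D_mod4).
  by rewrite (negbTE x0) (negbTE y0).
move=> [a0 b0 H1 H2] [c0 d0 K1 K2]; split; rewrite ?mul0//.
- move=> x /H1[y /K1[z Lz E2] E1]; exists z => //.
  by rewrite mulrAC E1 -[LHS]mulrA (mulrC y) E2 mulrA.
- move=> z /K2[y /H2[x Ix E1] E2]; exists x => //.
  by rewrite mulrAC E1 -[LHS]mulrA (mulrC y) E2 mulrA.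
Qed.

Let det x y := x.1 * y.2 - x.2 * y.1.

Let detM a x y : det (a * x) (a * y) = qnorm a * det x y.
Proof. rewrite !quad_mulE /det /qnorm /=; ring. Qed.

Let det_comb (f g : quad D) (u1 v1 u2 v2 : int) :
  det (u1%:~R * f + v1%:~R * g) (u2%:~R * f + v2%:~R * g)
    = (u1 * v2 - v1 * u2) * det f g.
Proof. rewrite !quad_scale !quad_addE /det /=; ring. Qed.

Let hnf_basis J n : ideal J -> ideal_norm_is J n ->
  exists f g : quad D, [/\ det f g = n%:Z, J f, J g &
    forall y, J y <-> exists u v : int, y = u%:~R * f + v%:~R * g].
Proof.
move=> idJ Jn; have [p [k [t [p0 k0 JE]]]] := ideal_hnf D_lt0 D_mod4 idJ.
have Jn' := hnf_norm p0 k0 JE.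
have E y : J y <-> exists u v : int,
    y = u%:~R * ((p%:Z, 0) : quad D) + v%:~R * ((t, k%:Z) : quad D).
  rewrite JE; split=> -[u [v ->]]; exists u, v;
    rewrite !quad_scale !quad_addE /=; congr pair; ring.
exists (p%:Z, 0), (t, k%:Z); split=> //.
- by rewrite (ideal_norm_uniq idJ Jn Jn') /det /= mul0r subr0 PoszM.
- by apply/E; exists 1, 0; rewrite mul1r mul0r addr0.
- by apply/E; exists 0, 1; rewrite mul1r mul0r add0r.
Qed.

(* Each of the two lattices [a I] and [b J] has a basis expressed through the other one with integral determinant; both determinants are positive. *)
Lemma same_scale_norm a I b J n m : ideal I -> ideal J ->
  ideal_norm_is I n -> ideal_norm_is J m ->
  same_scale a I b J -> qnorm a * n%:Z = qnorm b * m%:Z.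
Proof.
move=> idI idJ In Jm [a0 b0 H1 H2].
have [n0 _] := ideal_norm_mem D_lt0 D_mod4 idI In.
have [m0 _] := ideal_norm_mem D_lt0 D_mod4 idJ Jm.
have [e1 [e2 [de Ie1 Ie2 IE]]] := hnf_basis idI In.
have [f1 [f2 [df Jf1 Jf2 JE]]] := hnf_basis idJ Jm.
have Na := qnorm_gt0 D_lt0 D_mod4 a0; have Nb := qnorm_gt0 D_lt0 D_mod4 b0.
have [y1 /JE[u1 [v1 ->]] E1] := H1 _ Ie1.
have [y2 /JE[u2 [v2 ->]] E2] := H1 _ Ie2.
have [x1 /IE[w1 [z1 ->]] F1] := H2 _ Jf1.
have [x2 /IE[w2 [z2 ->]] F2] := H2 _ Jf2.
have P1 : qnorm a * n%:Z = qnorm b * ((u1 * v2 - v1 * u2) * m%:Z).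
  by rewrite -de -df -det_comb -!detM E1 E2.
have P2 : qnorm b * m%:Z = qnorm a * ((w1 * z2 - z1 * w2) * n%:Z).
  by rewrite -de -df -det_comb -!detM F1 F2.
move: P1 P2; move: (_ - v1 * u2) (_ - z1 * w2) => c d P1 P2.
have X0 : 0 < qnorm a * n%:Z by rewrite mulr_gt0.
have Y0 : 0 < qnorm b * m%:Z by rewrite mulr_gt0.
rewrite mulrCA in P1; rewrite mulrCA in P2.
move: (qnorm a * _) (qnorm b * _) X0 Y0 P1 P2 => X Y X0 Y0 P1 P2.
have c1 : 1 <= c by rewrite -gtz0_ge1 -(pmulr_lgt0 _ Y0) -P1.
have d1 : 1 <= d by rewrite -gtz0_ge1 -(pmulr_lgt0 _ X0) -P2.
apply/le_anti/andP; split.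
  by rewrite P2 ler_peMl // ltW.
by rewrite P1 ler_peMl // ltW.
Qed.

(** Chosen so that [qnorm x] is at most [C] times the square of the larger coordinate of [x] in
    absolute value. *)
Let C : nat := `|1 + `|D| + `|((D * D - D) %/ 4)%Z| |.

(** Pigeonhole: with [s] the integral square root of [n], the square [0, s] x [0, s] has more than
    [n] points, so two of them agree modulo [J]. The coordinates of their difference are at most
    [s]. *)
Lemma ideal_small_element J n : ideal J -> ideal_norm_is J n ->
  exists a, [/\ a != 0, J a & qnorm a <= (C * n)%:Z].
Proof.
move=> idJ Jn; have [n0 _] := ideal_norm_mem D_lt0 D_mod4 idJ Jn.
have exs : exists s, (s ^ 2 <= n)%N by exists 0%N.
have ubs s : (s ^ 2 <= n)%N -> (s <= n)%N by nia.
case: (ex_maxnP exs ubs) => s sn smax.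
have ns : (n < s.+1 ^ 2)%N.
  by rewrite ltnNge; apply/negP => /smax; rewrite ltnn.
case: Jn => r rP.
pose e (i : 'I_s.+1 * 'I_s.+1) : quad D := ((i.1 : nat)%:Z, (i.2 : nat)%:Z).
have /choice[f fP] : forall i, exists j, J (e i - r j).
  by move=> i; have [j [? _]] := rP (e i); exists j.
have /injectivePn[i [j ij fij]] : ~~ injectiveb f.
  apply/negP => /injectiveP/leq_card; rewrite card_prod !card_ord leqNgt.
  by rewrite mulnn ns.
exists (e i - e j); split.
- rewrite subr_eq0; apply: contra ij => /eqP[E1 E2]; apply/eqP.
  by rewrite (surjective_pairing i) (surjective_pairing j) (ord_inj E1) (ord_inj E2).
- have := idealB idJ (fP i) (fP j).
  by rewrite fij opprB addrA subrK.
have [li1 li2 lj1 lj2] := And4 (ltn_ord i.1) (ltn_ord i.2) (ltn_ord j.1) (ltn_ord j.2).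
rewrite quad_subE /qnorm /= /C.
set q := (_ %/ 4)%Z.
set A := (i.1 : nat) in li1 *; set B := (i.2 : nat) in li2 *.
set A' := (j.1 : nat) in lj1 *; set B' := (j.2 : nat) in lj2 *.
have bA : `|A%:Z - A'%:Z| <= s%:Z by lia.
have bB : `|B%:Z - B'%:Z| <= s%:Z by lia.
move: (A%:Z - A'%:Z) (B%:Z - B'%:Z) bA bB => X Y bX bY.
have b1 : X ^+ 2 <= s%:Z ^+ 2 by rewrite -real_normK ?num_real// lerXn2r ?nnegrE.
have b2 : D * X * Y <= `|D| * s%:Z ^+ 2.
  rewrite (le_trans (ler_norm _))// !normrM -mulrA ler_wpM2l// expr2.
  by rewrite ler_pM.
have b3 : q * Y ^+ 2 <= `|q| * s%:Z ^+ 2.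
  rewrite (le_trans (ler_norm _))// normrM ler_wpM2l// normrX.
  by rewrite lerXn2r ?nnegrE.
have s2 : s%:Z ^+ 2 <= n%:Z by lia.
have -> : (`|(1 + `|D| + `|q|)%R|%N * n)%:Z = (1 + `|D| + `|q|) * n%:Z by lia.
apply: (@le_trans _ _ ((1 + `|D| + `|q|) * s%:Z ^+ 2)).
  by rewrite !mulrDl mul1r !lerD.
by rewrite ler_wpM2l.
Qed.

(** For a small element [a] of [J] the index of [(a)] in [J] is at most [C], hence divides [C!]. So
    [C!] times [J] lies in [(a)], and its quotient by [a] is an integral ideal in the class of [J];
    it contains [C!] because [a] is in [J]. *)
Lemma ideal_class_finite : exists2 k0 : nat, (0 < k0)%N &
  forall J, ideal J -> exists a J', [/\ ideal J', J' k0%:Z%:~R &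
    same_scale a J' k0%:Z%:~R J].
Proof.
exists C`!; first exact: fact_gt0.
move=> J idJ; have [n Jn] := ideal_normE D_lt0 D_mod4 idJ.
have [n0 _] := ideal_norm_mem D_lt0 D_mod4 idJ Jn.
have [a [a0 Ja aC]] := ideal_small_element idJ Jn.
have [f [g [dfg Jf Jg JE]]] := hnf_basis idJ Jn.
have Na := qnorm_gt0 D_lt0 D_mod4 a0.
have /JE[u1 [v1 E1]] := Ja.
have /JE[u2 [v2 E2]] : J (a * ((0, 1) : quad D)) by rewrite mulrC; exact: idealM.
set w : quad D := (0, 1) in E2.
(* The determinant [d] of [a] and [a w] in the basis [f], [g] is the index of [(a)] in [J]. *)
have dM : qnorm a = (u1 * v2 - v1 * u2) * n%:Z.
  rewrite -dfg -det_comb -E1 -E2 -[X in det X _]mulr1 detM.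
  by rewrite (_ : det 1 w = 1) ?mulr1.
move: dM; set d := _ - _ => dM.
have d0 : 0 < d by nia.
have dC : d <= C%:Z by nia.
have dvd : (`|d| %| C`!)%N by apply: dvdn_fact; apply/andP; split; lia.
have [e eE] : exists e : int, (C`!)%:Z = e * d.
  case/dvdnP: dvd => e ->; exists e%:Z; lia.
set k0 : quad D := (C`!)%:Z%:~R.
have k00 : k0 != 0 by apply: quad_int_neq0; have := fact_gt0 C; lia.
(* Cramer's rule: d f = (v2 - v1 w) a and d g = (u1 w - u2) a. *)
have sub y : J y -> exists b, a * b = k0 * y.
  move=> /JE[s [t ->]].
  exists ((e * (s * v2 - t * u2))%:~R + (e * (t * u1 - s * v1))%:~R * w).
  rewrite mulrDr mulrCA E2 (mulrC a) E1 /k0 eE /d.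
  rewrite !intrM !intrB !intrM; ring.
exists a, [set b | exists2 y, J y & a * b = k0 * y]; split.
- apply: idealP.
  + by exists 0; [exact: ideal0|rewrite !mulr0].
  + move=> x y [x' Jx' Ex] [y' Jy' Ey]; exists (x' + y'); first exact: idealD.
    by rewrite !mulrDr Ex Ey.
  + move=> x y [y' Jy' Ey]; exists (x * y'); first exact: idealM.
    by rewrite mulrCA Ey mulrCA.
  + by exists k0 => //; exists a => //; rewrite mulrC.
- by exists a => //; rewrite mulrC.
- split=> // y Jy; have [b E] := sub _ Jy.
  by exists b => //; exists y.
Qed.
End IdealClasses.

(** * Positive definite binary quadratic forms *)

Lemma uniq_enumeration (T : choiceType) (P : T -> Prop) (s0 : seq T) :
  (forall x, P x -> x \in s0) -> exists2 s, uniq s & forall x, x \in s <-> P x.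
Proof.
move=> H; exists (undup [seq x <- s0 | `[< P x >]]); first exact: undup_uniq.
move=> x; rewrite mem_undup mem_filter; split; first by case/andP => /asboolP.
by move=> Px; rewrite H// andbT; apply/asboolP.
Qed.

Lemma size_partition (T U : eqType) (s : seq T) (su : seq U) (f : T -> U) :
  uniq su -> (forall x, x \in s -> f x \in su) ->
  size s = (\sum_(y <- su) count (fun x => f x == y) s)%N.
Proof.
move=> us H; under eq_bigr do rewrite -sum1_count.
rewrite (exchange_big_dep predT)//= -sum1_size big_seq [RHS]big_seq.
apply: eq_bigr => x xs; rewrite sum1_count.
by rewrite (eq_count (a2 := pred1 (f x))) ?count_uniq_mem ?H// => y; rewrite /= eq_sym.
Qed.

(** Stated for a relation because the correspondence between fibres is given by the equation d d0 =
    k d', not by a function. *)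
Lemma leq_size_rel (T U : choiceType) (y0 : U) (s : seq T) (s' : seq U) (R : T -> U -> Prop) :
  uniq s -> (forall x, x \in s -> exists2 y, y \in s' & R x y) ->
  (forall x x' y, R x y -> R x' y -> x = x') -> (size s <= size s')%N.
Proof.
move=> us H inj.
have /choice[f fP] : forall x, exists y, x \in s -> y \in s' /\ R x y.
  move=> x; have [xs|xs] := boolP (x \in s); last by exists y0.
  by have [y ? ?] := H _ xs; exists y.
rewrite -(size_map f); apply: uniq_leq_size.
  rewrite map_inj_in_uniq// => x x' xs xs' E.
  by apply: (inj _ _ (f x)); [have [] := fP x xs|rewrite E; have [] := fP x' xs'].
by move=> _ /mapP[x xs ->]; have [] := fP x xs.
Qed.

Definition bqf (Q : int * int * int) (v : int * int) : int :=
  Q.1.1 * v.1 ^+ 2 + Q.1.2 * v.1 * v.2 + Q.2 * v.2 ^+ 2.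

Definition posdef (Q : int * int * int) : bool :=
  (0 < Q.1.1) && (0 < 4 * Q.1.1 * Q.2 - Q.1.2 ^+ 2).

(** Multiplying the form by 4a or by 4c completes a square; what remains is the positive integer 4ac
    - b^2 times y^2 or x^2. *)
Lemma posdef_lower (Q : int * int * int) (v : int * int) : posdef Q ->
  0 < Q.2 /\
  v.1 ^+ 2 + v.2 ^+ 2 <= 4 * (Q.1.1 + Q.2) * bqf Q v.
Proof.
case: Q v => [[a b] c] [x y] /andP[/= a0 d0].
have c0 : 0 < c by nia.
split=> //; rewrite /bqf /=.
have E1 : 4 * a * (a * x ^+ 2 + b * x * y + c * y ^+ 2) =
  (2 * a * x + b * y) ^+ 2 + (4 * a * c - b ^+ 2) * y ^+ 2 by ring.
have E2 : 4 * c * (a * x ^+ 2 + b * x * y + c * y ^+ 2) =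
  (2 * c * y + b * x) ^+ 2 + (4 * a * c - b ^+ 2) * x ^+ 2 by ring.
rewrite (mulrDr 4) mulrDl E1 E2 (addrC (x ^+ 2)).
by apply: lerD; rewrite ler_wpDl ?sqr_ge0// ler_peMl ?sqr_ge0// -gtz0_ge1.
Qed.

Lemma bqf_gt0 (Q : int * int * int) (v : int * int) : posdef Q -> v != 0 -> 0 < bqf Q v.
Proof.
move=> pQ v0; have [c0 L] := posdef_lower v pQ; have /andP[a0 _] := pQ.
have V0 : 0 < v.1 ^+ 2 + v.2 ^+ 2.
  rewrite lt_neqAle addr_ge0 ?sqr_ge0// andbT eq_sym paddr_eq0 ?sqr_ge0//.
  by rewrite !sqrf_eq0; apply: contra v0 => /andP[]; case: (v) => x y /= /eqP-> /eqP->.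
have := lt_le_trans V0 L; rewrite pmulr_rgt0//; nia.
Qed.

(** The half-open square [-M, M) x [-M, M), so that doubling [M] adds an exact union of
    rectangles. *)
Definition zbox (M : nat) : seq (int * int) :=
  [seq ((i%:Z - M%:Z), (j%:Z - M%:Z)) | i <- iota 0 (M + M), j <- iota 0 (M + M)].

Lemma mem_zbox M (v : int * int) :
  (v \in zbox M) = (- M%:Z <= v.1 < M%:Z) && (- M%:Z <= v.2 < M%:Z).
Proof.
apply/allpairsP/idP => [[[i j]] /= [Hi Hj ->] /=|H].
  rewrite !mem_iota in Hi Hj; lia.
exists (absz (v.1 + M%:Z), absz (v.2 + M%:Z)) => /=; rewrite !mem_iota; split; [lia|lia|].
by rewrite [LHS]surjective_pairing; congr pair; lia.
Qed.

Lemma zbox_uniq M : uniq (zbox M).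
Proof.
apply: allpairs_uniq; rewrite ?iota_uniq// => -[i j] [i' j'] _ _ /= [E1 E2].
by congr pair; lia.
Qed.

Lemma posdef_in_zbox (Q : int * int * int) (v : int * int) n M : posdef Q ->
  bqf Q v = n%:Z -> 4 * (Q.1.1 + Q.2) * n%:Z < M%:Z -> v \in zbox M.
Proof.
move=> pQ En HM; have [c0 L] := posdef_lower v pQ; rewrite En in L.
rewrite mem_zbox; nia.
Qed.

Lemma posdef_enum (Q : int * int * int) n : posdef Q ->
  exists2 s, uniq s & forall v, v \in s <-> bqf Q v = n%:Z.
Proof.
move=> pQ; apply: (@uniq_enumeration _ _ (zbox `|4 * (Q.1.1 + Q.2) * n%:Z + 1|)) => v E.
by apply: (posdef_in_zbox pQ E); have [c0 _] := posdef_lower v pQ; case/andP: pQ => a0 _; nia.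
Qed.

(** * Ideals in a class and represented integers *)

Section IdealCount.
Variable D : int.
Hypothesis D_lt0 : D < 0.
Hypothesis D_mod4 : 4 * ((D * D - D) %/ 4)%Z = D * D - D.
Implicit Types (I J : set (quad D)) (x y d : quad D).
Let quadI := quad_mulfI D_lt0 D_mod4.

(** An ideal containing [n] is a union of residue classes modulo [n], so it is determined by a
    subset of the n^2 residues. *)
Lemma ideals_containing_finite (n : nat) : (0 < n)%N ->
  exists2 s : seq (set (quad D)), uniq s & forall I, I \in s <-> ideal I /\ I n%:Z%:~R.
Proof.
move=> n0; pose e (i : 'I_n * 'I_n) : quad D := ((i.1 : nat)%:Z, (i.2 : nat)%:Z).
pose dec (A : {set 'I_n * 'I_n}) : set (quad D) :=
  [set x | exists2 i, i \in A & exists y, x = e i + n%:Z%:~R * y].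
apply: (@uniq_enumeration _ _ (map dec (enum {set 'I_n * 'I_n}))) => I [idI In].
apply/mapP; exists [set i | `[< I (e i) >]]%SET; first by rewrite mem_enum.
apply/seteqP; split => x; rewrite /dec /=; last first.
  move=> [i ]; rewrite inE => /asboolP Ie [y ->].
  by apply: idealD => //; rewrite mulrC; exact: idealM.
move=> Ix.
have nz : n%:Z != 0 by lia.
have r1 : (`|(x.1 %% n)%Z| < n)%N.
  by have := modz_ge0 x.1 nz; have := ltz_mod x.1 nz; lia.
have r2 : (`|(x.2 %% n)%Z| < n)%N.
  by have := modz_ge0 x.2 nz; have := ltz_mod x.2 nz; lia.
have xE : x = e (Ordinal r1, Ordinal r2) + n%:Z%:~R * (((x.1 %/ n)%Z, (x.2 %/ n)%Z) : quad D).
  rewrite quad_scale quad_addE /= [LHS]surjective_pairing.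
  have := modz_ge0 x.1 nz; have := modz_ge0 x.2 nz.
  by have := divz_eq x.1 n; have := divz_eq x.2 n => *; congr pair; lia.
exists (Ordinal r1, Ordinal r2); last by eexists; exact: xE.
rewrite inE; apply/asboolP.
have -> : e (Ordinal r1, Ordinal r2) = x - (((x.1 %/ n)%Z, (x.2 %/ n)%Z) : quad D) * n%:Z%:~R.
  by apply/eqP; rewrite eq_sym subr_eq mulrC; apply/eqP.
by apply: idealB => //; exact: idealM.
Qed.

Lemma ideals_of_norm_enum (n : nat) : (0 < n)%N ->
  exists2 s : seq (set (quad D)), uniq s &
    forall I, I \in s <-> ideal I /\ ideal_norm_is I n.
Proof.
move=> n0; have [s0 _ s0P] := ideals_containing_finite n0.
apply: (@uniq_enumeration _ _ s0) => I [idI In]; apply/s0P; split=> //.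
by have [] := ideal_norm_mem D_lt0 D_mod4 idI In.
Qed.

(** Any two enumerations of these ideals are permutations of each other, so the value selected by
    [xget] is the size of [s]. *)
Lemma ideal_countE (n : nat) (s : seq (set (quad D))) : uniq s ->
  (forall I, I \in s <-> ideal I /\ ideal_norm_is I n) -> ideal_count D n = size s.
Proof.
move=> us sP.
have Hs : ideal_count_is D n (size s).
  exists (fun i : 'I_(size s) => nth set0 s i); split.
    by move=> i j /eqP; rewrite nth_uniq// => /eqP/ord_inj.
  move=> I; split=> [/sP Is|[i <-]]; last by apply/sP; exact: mem_nth.
  have lt : (index I s < size s)%N by rewrite index_mem.
  by exists (Ordinal lt); rewrite /= nth_index.
rewrite /ideal_count; case: xgetP => [k -> [f [finj fP]]|/(_ (size s))//].
have : perm_eq (codom f) s.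
  apply: uniq_perm => //; first by rewrite map_inj_uniq ?enum_uniq.
  move=> I; apply/codomP/idP => [[i ->]|/sP/fP[i <-]]; last by exists i.
  by apply/sP/fP; exists i.
by move/perm_size; rewrite size_codom card_ord.
Qed.

Definition sim I J := exists a b, same_scale a I b J.

Section ClassForm.
Variables (B : set (quad D)) (k0 : nat) (m : nat).
Hypotheses (idB : ideal B) (k0_gt0 : (0 < k0)%N) (Bk : B k0%:Z%:~R).
Hypothesis Bm : ideal_norm_is B m.
Let k : quad D := k0%:Z%:~R.

Let k_neq0 : k != 0.
Proof. by apply: quad_int_neq0; lia. Qed.

(** [L] is k B^(-1), and [quot d] is the ideal (d / k) B. Every integral ideal in the class of [B]
    has this form for some nonzero [d] in [L], unique up to units. *)
Let L : set (quad D) := [set d | forall x, B x -> exists y, d * x = k * y].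
Let quot d : set (quad D) := [set y | exists2 x, B x & d * x = k * y].

Let idL : ideal L.
Proof.
apply: idealP.
- by move=> x _; exists 0; rewrite mul0r mulr0.
- move=> d e Ld Le x Bx; have [y Ey] := Ld x Bx; have [z Ez] := Le x Bx.
  by exists (y + z); rewrite mulrDl mulrDr Ey Ez.
- move=> e d Ld x Bx; have [y Ey] := Ld x Bx.
  by exists (e * y); rewrite -mulrA Ey mulrCA.
- by exists k => // x _; exists x.
Qed.

Let quot_ideal d : L d -> d != 0 -> ideal (quot d).
Proof.
move=> Ld d0; apply: idealP.
- by exists 0; [exact: ideal0|rewrite !mulr0].
- move=> y z [x Bx Ex] [x' Bx' Ex']; exists (x + x'); first exact: idealD.
  by rewrite !mulrDr Ex Ex'.
- move=> z y [x Bx Ex]; exists (z * x); first exact: idealM.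
  by rewrite mulrCA Ex mulrCA.
- exists d => //; exists k => //; exact: mulrC.
Qed.

Let quot_scale d : L d -> d != 0 -> same_scale k (quot d) d B.
Proof.
move=> Ld d0; split=> // [y [x Bx E]|x Bx]; first by exists x.
by have [y E] := Ld x Bx; exists y => //; exists x.
Qed.

Let quot_norm d n : L d -> d != 0 ->
  ideal_norm_is (quot d) n <-> qnorm d * m%:Z = k0%:Z ^+ 2 * n%:Z.
Proof.
move=> Ld d0; have idq := quot_ideal Ld d0; split=> [qn|E].
  have := same_scale_norm D_lt0 D_mod4 idq idB qn Bm (quot_scale Ld d0).
  by rewrite qnorm_int.
have [n' qn'] := ideal_normE D_lt0 D_mod4 idq.
have := same_scale_norm D_lt0 D_mod4 idq idB qn' Bm (quot_scale Ld d0).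
rewrite qnorm_int E => E'.
suff -> : n = n' by [].
have : k0%:Z ^+ 2 != 0 by rewrite expf_neq0//; lia.
by move=> /mulfI/(_ _ _ E')[].
Qed.

Let quot_surj I : ideal I -> sim I B -> exists d, [/\ L d, d != 0 & quot d = I].
Proof.
move=> idI [a [b [a0 b0 H1 H2]]].
(* As a I = b B, the element [k] of [B] has a partner [d] in [I] with a d = b k, that is, d / k = b
   / a. *)
have [d Id E] := H2 _ Bk; exists d; split.
- move=> x Bx; have [y Iy Ey] := H2 _ Bx; exists y; apply: (quadI a0).
  by rewrite mulrA E mulrAC -Ey mulrC mulrCA.
- apply: contra_neq k_neq0 => d0; apply: (quadI b0).
  by rewrite mulr0 -E d0 mulr0.
have key x y : B x -> I y -> a * y = b * x -> d * x = k * y.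
  move=> Bx Iy Ey; apply: (quadI a0).
  by rewrite mulrA E mulrAC -Ey mulrC mulrCA.
apply/seteqP; split=> [y [x Bx Ex]|y Iy].
  have [z Iz Ez] := H2 _ Bx.
  suff -> : y = z by [].
  by apply: (quadI k_neq0); rewrite -Ex; exact: key.
by have [x Bx Ex] := H1 _ Iy; exists x => //; exact: key.
Qed.

(* [d |-> d * d0 / k] is a bijection between the two sides; in particular all fibres of [quot] have the same size. *)
Let fibre_bij d0 : L d0 -> d0 != 0 ->
  (forall d, L d /\ d != 0 /\ quot d = B ->
     exists2 d', L d' /\ d' != 0 /\ quot d' = quot d0 & d * d0 = k * d') /\
  (forall d', L d' /\ d' != 0 /\ quot d' = quot d0 ->
     exists2 d, L d /\ d != 0 /\ quot d = B & d * d0 = k * d').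
Proof.
move=> Ld0 d00; split=> [d [Ld [dn0 dB]]|d' [Ld' [dn0 qd']]].
  have Bd : B d.
    have [y Ey] := Ld _ Bk.
    have qy : quot d y by exists k.
    suff -> : d = y by rewrite -dB.
    by apply: (quadI k_neq0); rewrite -Ey mulrC.
  have [d' E] := Ld0 _ Bd; rewrite mulrC in E; exists d' => //.
  have d'0 : d' != 0.
    apply/eqP => d'0; move: E; rewrite d'0 mulr0 => /(quad_mul_eq0 D_lt0 D_mod4).
    by rewrite (negbTE dn0) (negbTE d00).
  have mov x y : d * x = k * y -> d' * x = d0 * y.
    by move=> Exy; apply: (quadI k_neq0); rewrite mulrA -E mulrAC Exy mulrC mulrCA.
  have Ld' : L d'.
    move=> x Bx; have [y Ey] := Ld x Bx.
    have By : B y by rewrite -dB; exists x.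
    by have [z Ez] := Ld0 y By; exists z; rewrite (mov _ _ Ey).
  split=> //; split=> //; apply/seteqP; split=> [y [x Bx Ex]|y [x Bx Ex]].
    have [z Ez] := Ld x Bx; exists z; first by rewrite -dB; exists x.
    by rewrite -(mov _ _ Ez).
  have : quot d x by rewrite dB.
  by move=> [z Bz Ez]; exists z => //; rewrite (mov _ _ Ez).
have [y Ey] := Ld' _ Bk.
have : quot d0 y by rewrite -qd'; exists k.
move=> [d Bd Ed]; have E : d * d0 = k * d' by rewrite mulrC Ed -Ey mulrC.
have dn : d != 0.
  apply/eqP => dE; move: E; rewrite dE mul0r => /esym/(quad_mul_eq0 D_lt0 D_mod4).
  by rewrite (negbTE dn0) (negbTE k_neq0).
have mov x z : d' * x = d0 * z -> d * x = k * z.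
  by move=> Exz; apply: (quadI d00); rewrite mulrA (mulrC d0) E -mulrA Exz mulrCA.
have ex x : B x -> exists2 z, B z & d' * x = d0 * z.
  move=> Bx; have [w Ew] := Ld' x Bx.
  have : quot d0 w by rewrite -qd'; exists x.
  by move=> [z Bz Ez]; exists z; rewrite // Ew Ez.
have Ld : L d by move=> x /ex[z Bz /mov]; exists z.
exists d => //; split=> //; split=> //; apply/seteqP; split=> [y' [x Bx Ex]|z Bz].
  have [z Bz Ez] := ex _ Bx; suff -> : y' = z by [].
  by apply: (quadI k_neq0); rewrite -Ex; exact: mov.
have [w Ew] := Ld0 _ Bz.
have : quot d' w by rewrite qd'; exists z.
by move=> [x Bx Ex]; exists x => //; apply: mov; rewrite Ex Ew.
Qed.

(** The form is N(d) m / k0^2 written in a basis of [L], which is the norm of [quot d].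
    Representations of [n] are therefore the [d] whose quotient has norm [n], and each ideal is hit
    equally often; [w] is the size of the fibre over [B] itself. *)
Lemma class_form : exists (w : nat) (Q : int * int * int), [/\ (0 < w)%N, posdef Q &
  forall n (sn : seq (set (quad D))) sv, (0 < n)%N -> uniq sn -> uniq sv ->
   (forall I, I \in sn <-> ideal I /\ ideal_norm_is I n /\ sim I B) ->
   (forall v, v \in sv <-> bqf Q v = n%:Z) -> (w * size sn)%N = size sv].
Proof.
have [p [l [t [p0 l0 LE]]]] := ideal_hnf D_lt0 D_mod4 idL.
have [m0 _] := ideal_norm_mem D_lt0 D_mod4 idB Bm.
pose del (v : int * int) : quad D := (v.1 * p%:Z + v.2 * t, v.2 * l%:Z).
have delL v : L (del v) by apply/LE; exists v.1, v.2.
have del_inj : injective del.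
  move=> [a b] [c e] [/= E1 E2].
  have be : b = e by nia.
  by rewrite be; rewrite be in E1; congr pair; nia.
have del0 v : v != 0 -> del v != 0.
  by apply: contra_neq => E; apply: del_inj; rewrite E /del /= !mul0r.
have int_norm v : v != 0 -> exists n : nat, qnorm (del v) * m%:Z = k0%:Z ^+ 2 * n%:Z.
  move=> v0; have [n qn] := ideal_normE D_lt0 D_mod4 (quot_ideal (delL v) (del0 _ v0)).
  by exists n; apply/quot_norm => //; exact: del0.
have [na Ea] := int_norm (1, 0) isT.
have [nc Ec] := int_norm (0, 1) isT.
have [nb Eb] := int_norm (1, 1) isT.
(* The coefficients come from the values at (1, 0), (0, 1) and (1, 1), which are integers because
   they are norms of ideals. *)
pose Q : int * int * int := (na%:Z, nb%:Z - na%:Z - nc%:Z, nc%:Z).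
have QE v : k0%:Z ^+ 2 * bqf Q v = qnorm (del v) * m%:Z.
  have -> : k0%:Z ^+ 2 * bqf Q v = k0%:Z ^+ 2 * na%:Z * (v.1 ^+ 2 - v.1 * v.2) +
     k0%:Z ^+ 2 * nb%:Z * (v.1 * v.2) + k0%:Z ^+ 2 * nc%:Z * (v.2 ^+ 2 - v.1 * v.2).
    by rewrite /bqf /Q /=; ring.
  by rewrite -Ea -Eb -Ec /qnorm /del /=; ring.
have kk : k0%:Z ^+ 2 != 0 by rewrite expf_neq0//; lia.
have kk0 : 0 < k0%:Z ^+ 2 by rewrite exprn_gt0//; lia.
have pQ : posdef Q.
  apply/andP; split.
    rewrite -(pmulr_rgt0 _ kk0) -Ea mulr_gt0// ?qnorm_gt0//.
    exact: del0.
  rewrite -(pmulr_rgt0 _ kk0) -(pmulr_rgt0 _ kk0).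
  set q := ((D * D - D) %/ 4)%Z.
  (* The discriminant is multiplied by the square of the determinant of [del]; for the norm form, 4q
     - D^2 = -D is positive. *)
  have -> : k0%:Z ^+ 2 * (k0%:Z ^+ 2 * (4 * Q.1.1 * Q.2 - Q.1.2 ^+ 2)) =
     (m%:Z * p%:Z * l%:Z) ^+ 2 * (4 * q - D * D).
    have -> : k0%:Z ^+ 2 * (k0%:Z ^+ 2 * (4 * Q.1.1 * Q.2 - Q.1.2 ^+ 2)) =
      4 * (k0%:Z ^+ 2 * na%:Z) * (k0%:Z ^+ 2 * nc%:Z) -
      (k0%:Z ^+ 2 * nb%:Z - k0%:Z ^+ 2 * na%:Z - k0%:Z ^+ 2 * nc%:Z) ^+ 2.
      by rewrite /Q /=; ring.
    rewrite -Ea -Eb -Ec /qnorm /del /= -/q; ring.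
  rewrite mulr_gt0//; first by rewrite exprn_gt0// !mulr_gt0//; lia.
  by rewrite D_mod4; lia.
have Pn d : 1 * d.1 ^+ 2 + D * d.1 * d.2 + ((D * D - D) %/ 4)%Z * d.2 ^+ 2 = qnorm d.
  by rewrite mul1r.
(* Elements of the fibre over [B] have norm k0^2, so positivity of the norm form makes this fibre
   finite. *)
have pN : posdef (1, D, ((D * D - D) %/ 4)%Z).
  by rewrite /posdef /= mulr1 D_mod4 expr2; lia.
have [sU0 _ sU0P] := posdef_enum (k0 ^ 2) pN.
have [sU uU sUP] : exists2 sU : seq (quad D), uniq sU &
    forall d, d \in sU <-> L d /\ d != 0 /\ quot d = B.
  apply: (@uniq_enumeration _ _ sU0) => d [Ld [d0 dB]]; apply/sU0P.
  rewrite /bqf /= Pn.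
  have /(quot_norm _ Ld d0) : ideal_norm_is (quot d) m by rewrite dB.
  have : m%:Z != 0 by lia.
  by move=> /mulIf H /H ->; lia.
exists (size sU), Q; split=> //.
  have : k \in sU.
    apply/sUP; split; first by move=> x Bx; exists x.
    split=> //; apply/seteqP; split=> [y [x Bx /(quadI k_neq0)<-]//|y By].
    by exists y.
  by case: (sU).
move=> n sn sv n0 usn usv snP svP.
have sdP d : d \in map del sv <-> [/\ L d, d != 0 & ideal_norm_is (quot d) n].
  split.
    move=> /mapP[v /svP Qv ->].
    have v0 : v != 0.
      by apply/eqP => vE; move: Qv; rewrite vE /bqf /=; lia.
    split; [exact: delL|exact: del0|].
    by apply/quot_norm; [exact: delL|exact: del0|rewrite -QE Qv].
  move=> [Ld d0 /(quot_norm _ Ld d0) E].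
  have /LE[u [v dE]] := Ld; apply/mapP; exists (u, v) => //.
  by apply/svP/(mulfI kk); rewrite QE /del /= -dE.
rewrite -(size_map del sv) (@size_partition _ _ (map del sv) sn quot)//; last first.
  move=> d /sdP[Ld d0 qn]; apply/snP; split; first exact: quot_ideal.
  by split=> //; exists k, d; exact: quot_scale.
have udv : uniq (map del sv) by rewrite map_inj_uniq.
rewrite (@eq_big_seq _ _ _ _ sn _ (fun=> size sU)).
  by rewrite big_const_seq count_predT iter_addn_0.
move=> I /snP[idI [In simI]].
have [d0 [Ld0 d00 qI]] := quot_surj idI simI.
have [F1 F2] := fibre_bij Ld0 d00.
have fibP d' : d' \in [seq d <- map del sv | quot d == I] <->
     L d' /\ d' != 0 /\ quot d' = quot d0.
  rewrite mem_filter; split.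
    by move=> /andP[/eqP qd /sdP[Ld d'0 _]]; rewrite qd qI.
  move=> [Ld' [d'0 qd']]; rewrite qd' qI eqxx /=; apply/sdP; split=> //.
  by rewrite qd' qI.
rewrite -size_filter; apply/eqP; rewrite eqn_leq; apply/andP; split.
  apply: (@leq_size_rel _ _ 0 _ _ (fun d' d => d * d0 = k * d')).
  - exact: filter_uniq.
  - by move=> d' /fibP/F2[d /sUP dU E]; exists d.
  - by move=> d1 d2 d E1 E2; apply: (quadI k_neq0); rewrite -E1 -E2.
apply: (@leq_size_rel _ _ 0 _ _ (fun d d' => d * d0 = k * d')) => //.
- by move=> d /sUP/F1[d' /fibP dU E]; exists d'.
- by move=> d1 d2 d E1 E2; apply: (quadI d00); rewrite mulrC E1 -E2 mulrC.
Qed.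
End ClassForm.

End IdealCount.

(** * Ideal counts as weighted representation numbers *)

Section IdealCountForms.
Variable D : int.
Hypothesis D_lt0 : D < 0.
Hypothesis D_mod4 : 4 * ((D * D - D) %/ 4)%Z = D * D - D.
Implicit Types I J B : set (quad D).

Lemma sim_sym I J : sim I J -> sim J I.
Proof. by move=> [a [b /same_scale_sym ?]]; exists b, a. Qed.

Lemma sim_trans I J L : sim I J -> sim J L -> sim I L.
Proof.
move=> [a [b H1]] [c [d H2]]; exists (a * c), (b * d).
exact: (same_scale_trans D_lt0 D_mod4 H1 H2).
Qed.

(** Several ideals containing [k0] may lie in one class. [rep] picks the first listed one, and its
    fixed points represent each class once. *)
Lemma ideal_representatives : exists (k0 : nat) (rep : set (quad D) -> set (quad D))
    (s : seq (set (quad D))), [/\ (0 < k0)%N, uniq s,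
    forall B, B \in s -> [/\ ideal B, B k0%:Z%:~R & rep B = B],
    forall I, ideal I -> rep I \in s &
    forall I B, ideal I -> B \in s -> rep I = B <-> sim I B].
Proof.
have [k0 k0_gt0 Hk0] := ideal_class_finite D_lt0 D_mod4.
have [s0 us0 s0P] := ideals_containing_finite D_lt0 D_mod4 k0_gt0.
pose rep I := nth set0 [seq J <- s0 | `[< sim J I >]] 0.
have repP I : ideal I -> rep I \in s0 /\ sim (rep I) I.
  move=> idI; have [a [J [idJ Jk Jsim]]] := Hk0 _ idI.
  have : rep I \in [seq J <- s0 | `[< sim J I >]].
    apply: mem_nth; rewrite size_filter -has_count; apply/hasP; exists J.
      exact/s0P.
    by apply/asboolP; exists a, k0%:Z%:~R.
  by rewrite mem_filter => /andP[/asboolP].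
have repE I J : sim I J -> rep I = rep J.
  move=> IJ; rewrite /rep; congr nth; apply: eq_filter => L.
  apply/asboolP/asboolP => H; first exact: sim_trans H IJ.
  exact: sim_trans H (sim_sym IJ).
have repK I : ideal I -> rep (rep I) = rep I by move=> /repP[_ /repE].
exists k0, rep, [seq B <- s0 | rep B == B]; split=> //.
- exact: filter_uniq.
- by move=> B; rewrite mem_filter => /andP[/eqP rB /s0P[idB Bk]].
- by move=> I idI; rewrite mem_filter repK// eqxx; have [] := repP _ idI.
- move=> I B idI; rewrite mem_filter => /andP[/eqP rB /s0P[idB Bk]]; split.
    by move=> <-; apply: sim_sym; have [] := repP _ idI.
  by move=> /repE ->.
Qed.

Lemma ideal_count_forms : exists (W : nat) (T : seq (int * int * int)), [/\ (0 < W)%N,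
    (forall Q, Q \in T -> posdef Q) &
    forall n sv, (0 < n)%N ->
      (forall Q, Q \in T -> uniq (sv Q) /\ forall v, v \in sv Q <-> bqf Q v = n%:Z) ->
      (W * ideal_count D n)%N = (\sum_(Q <- T) size (sv Q))%N].
Proof.
have [k0 [rep [s [k0_gt0 us sP rep_s repP]]]] := ideal_representatives.
have /choice[f fP] : forall B, exists wQ : nat * (int * int * int), (0 < wQ.1)%N /\
  (ideal B -> B k0%:Z%:~R -> posdef wQ.2 /\
  forall n (sn : seq (set (quad D))) sv, (0 < n)%N -> uniq sn -> uniq sv ->
   (forall I, I \in sn <-> ideal I /\ ideal_norm_is I n /\ sim I B) ->
   (forall v, v \in sv <-> bqf wQ.2 v = n%:Z) -> (wQ.1 * size sn)%N = size sv).
  move=> B; have [[idB Bk]|NB] := EM (ideal B /\ B k0%:Z%:~R); last first.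
    by exists (1%N, (1, 0, 1)); split=> // idB Bk; case: NB.
  have [m Bm] := ideal_normE D_lt0 D_mod4 idB.
  have [w [Q [w0 pQ H]]] := class_form D_lt0 D_mod4 idB k0_gt0 Bk Bm.
  by exists (w, Q).
(* The classes come with individual weights; repeating each form W / w times gives them the common
   weight [W]. *)
pose W := (\prod_(B <- s) (f B).1)%N.
have W0 : (0 < W)%N by rewrite /W big_seq prodn_cond_gt0// => B _; have [] := fP B.
exists W, (flatten [seq nseq (W %/ (f B).1) (f B).2 | B <- s]); split=> //.
  move=> Q /flatten_mapP[B Bs]; rewrite mem_nseq => /andP[_ /eqP->].
  have [idB Bk _] := sP _ Bs; have [_ H] := fP B; by have [] := H idB Bk.
move=> n sv n0 svP.
have [sn usn snP] := ideals_of_norm_enum D_lt0 D_mod4 n0.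
rewrite (ideal_countE usn snP) (@size_partition _ _ sn s rep us); last first.
  by move=> I /snP[idI _]; exact: rep_s.
rewrite big_flatten /= big_map big_distrr /= big_seq [RHS]big_seq.
apply: eq_bigr => B Bs.
have [idB Bk _] := sP _ Bs; have [w0 H] := fP B; have {H}[pQ H] := H idB Bk.
have dW : ((f B).1 %| W)%N by rewrite /W (big_rem B Bs) /= dvdn_mulr.
have wW : (0 < W %/ (f B).1)%N by rewrite divn_gt0// dvdn_leq.
rewrite big_nseq iter_addn_0.
have [usv svQ] : uniq (sv (f B).2) /\ forall v, v \in sv (f B).2 <-> bqf (f B).2 v = n%:Z.
  by apply: svP; apply/flatten_mapP; exists B; rewrite // mem_nseq wW eqxx.
rewrite -(H n [seq I <- sn | rep I == B] _ n0 _ usv _ svQ); last 2 first.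
- exact: filter_uniq.
- move=> I; rewrite mem_filter; split.
    move=> /andP[/eqP rI /snP[idI In]]; split=> //; split=> //.
    exact/repP.
  move=> [idI [In /(repP _ _ idI Bs)->]]; rewrite eqxx /=; exact/snP.
by rewrite size_filter mulnAC (mulnC (f B).1) divnK.
Qed.
End IdealCountForms.

Lemma fundamental_disc_mod4 (D : int) : fundamental_disc D ->
  4 * ((D * D - D) %/ 4)%Z = D * D - D.
Proof.
move=> [_ [[D1 _]|[m [-> _]]]].
  have : (D * D - D)%R = (D %/ 4)%Z * D * 4 by have := divz_eq D 4; rewrite D1; nia.
  by move=> ->; rewrite mulzK//; ring.
have -> : 4 * m * (4 * m) - 4 * m = (4 * m * m - m) * 4 by ring.
by rewrite mulzK//; ring.
Qed.

(** A square can only miss representations, and it misses none once it contains the ellipse on which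
    the form equals [n]. *)
Lemma ideal_count_zbox (D : int) : D < 0 -> fundamental_disc D ->
  exists (W : nat) (T : seq (int * int * int)), [/\ (0 < W)%N,
    (forall Q, Q \in T -> posdef Q) &
    forall n, (0 < n)%N ->
      (forall M, (\sum_(Q <- T) count (fun v => bqf Q v == n%:Z) (zbox M)
          <= W * ideal_count D n)%N) /\
      (forall M, (forall Q, Q \in T -> 4 * (Q.1.1 + Q.2) * n%:Z < M%:Z) ->
        (\sum_(Q <- T) count (fun v => bqf Q v == n%:Z) (zbox M)
          = W * ideal_count D n)%N)].
Proof.
move=> D0 /fundamental_disc_mod4 D4.
have [W [T [W0 pT HT]]] := ideal_count_forms D0 D4.
exists W, T; split=> // n n0.
pose B (Q : int * int * int) := absz (4 * (Q.1.1 + Q.2) * n%:Z + 1).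
pose sv M Q := [seq v <- zbox (maxn M (B Q)) | bqf Q v == n%:Z].
have E M : (W * ideal_count D n)%N = (\sum_(Q <- T) size (sv M Q))%N.
  apply: (HT n (sv M) n0) => Q QT; split; first by rewrite filter_uniq// zbox_uniq.
  move=> v; rewrite mem_filter; split; first by case/andP => /eqP.
  move=> Qv; rewrite Qv eqxx /=; apply: (posdef_in_zbox (pT _ QT) Qv).
  rewrite /B; lia.
split=> M => [|HM]; rewrite (E M) big_seq [in X in _ X]big_seq.
  apply: leq_sum => Q QT; rewrite -size_filter; apply: uniq_leq_size.
    by rewrite filter_uniq// zbox_uniq.
  move=> v; rewrite !mem_filter => /andP[-> /=]; rewrite !mem_zbox; lia.
apply: eq_bigr => Q QT; rewrite -size_filter /sv; apply: perm_size; apply: uniq_perm.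
- by rewrite filter_uniq// zbox_uniq.
- by rewrite filter_uniq// zbox_uniq.
move=> v; rewrite !mem_filter; case: eqP => //= Qv.
rewrite (posdef_in_zbox (pT _ QT) Qv (HM _ QT)); apply/esym.
by apply: (posdef_in_zbox (pT _ QT) Qv); rewrite /B; lia.
Qed.

(** * Exponential sums *)

Section Exponential.
Variable R : realType.
Implicit Types (t x y : R) (z w : R[i]).

(** The modulus as an element of [R], where the order is total; the norm of [R[i]] takes its values
    in [R[i]]. *)
Definition cabs z : R := complex.Re `|z|.

Lemma cabsE z : (cabs z)%:C%C = `|z|.
Proof. by rewrite /cabs normc_def. Qed.

Lemma cabs_sqrt z : cabs z = Num.sqrt (complex.Re z ^+ 2 + complex.Im z ^+ 2).
Proof. by rewrite /cabs normc_def. Qed.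

Lemma cabs_ge0 z : 0 <= cabs z.
Proof. by rewrite /cabs normc_def /= sqrtr_ge0. Qed.

Lemma cabs0 : cabs 0 = 0.
Proof. by rewrite /cabs normr0. Qed.

Lemma cabsM z w : cabs (z * w) = cabs z * cabs w.
Proof.
apply: (@complexI R); rewrite rmorphM /= !cabsE; exact: normrM.
Qed.

Lemma cabsD z w : cabs (z + w) <= cabs z + cabs w.
Proof. by rewrite -lecR rmorphD /= !cabsE; exact: ler_normD. Qed.

Lemma cabsN z : cabs (- z) = cabs z.
Proof. by rewrite /cabs normrN. Qed.

Lemma cabs_real x : cabs x%:C%C = `|x|.
Proof. by rewrite cabs_sqrt /= expr0n addr0 sqrtr_sqr. Qed.

Lemma cabs_sum I (r : seq I) (P : pred I) (F : I -> R[i]) :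
  cabs (\sum_(i <- r | P i) F i) <= \sum_(i <- r | P i) cabs (F i).
Proof.
elim/big_rec2 : _ => [|i a b _ H]; first by rewrite cabs0.
by apply: le_trans (cabsD _ _) _; rewrite lerD2l.
Qed.

Definition expi t : R[i] := (cos (2 * pi * t) +i* sin (2 * pi * t))%C.

Lemma expiD t x : expi (t + x) = expi t * expi x.
Proof.
rewrite /expi mulrDr cosD sinD; apply/eqP; rewrite eq_complex /=.
by rewrite eqxx /= addrC (mulrC (sin _)) eqxx.
Qed.

Lemma expi0 : expi 0 = 1.
Proof. by rewrite /expi mulr0 cos0 sin0. Qed.

Lemma cabs_expi t : cabs (expi t) = 1.
Proof. by rewrite cabs_sqrt /= cos2Dsin2 sqrtr1. Qed.

Lemma expi_nat (n : nat) : expi n%:R = 1.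
Proof.
elim: n => [|n IH]; first exact: expi0.
rewrite -natr1 expiD IH mul1r /expi mulr1 mulr_natl cos2pi sin2pi //.
Qed.

Lemma expiN t : expi t * expi (- t) = 1.
Proof. by rewrite -expiD subrr expi0. Qed.

Lemma expi_int (k : int) : expi k%:~R = 1.
Proof.
case: k => n; first exact: expi_nat.
have := expiN (n.+1%:R); rewrite expi_nat mul1r => <-.
by rewrite NegzE mulrNz.
Qed.

Lemma expiX t (n : nat) : expi (n%:R * t) = expi t ^+ n.
Proof.
elim: n => [|n IH]; first by rewrite mul0r expi0.
by rewrite -natr1 mulrDl mul1r expiD IH exprSr.
Qed.

Lemma expi_conj t : (expi t)^*%C = expi (- t).
Proof. by rewrite /expi mulrN cosN sinN. Qed.

(** By the mean value theorem sin(t/2) = (t/2) cos c, so sin t = t cos c cos(t/2), and both cosines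
    are at least cos(pi/4). *)
Lemma sin_ge_half t : 0 <= t <= pi / 2 -> t / 2 <= sin t.
Proof.
move=> /andP[t0 tpi].
have [c /[!in_itv]/= /andP[c0 c1]] : exists2 c, c \in `[0, t / 2]%R &
    sin (t / 2) - sin 0 = cos c * (t / 2 - 0).
  apply: (@MVT_segment _ sin cos); first by rewrite divr_ge0.
  - by apply: continuous_subspaceT => y; exact: continuous_sin.
rewrite sin0 !subr0 => E.
have cs : cos (t / 2) <= cos c.
  have p2 := @pi_ge2 R.
  have [->//|ct] := eqVneq c (t / 2).
  by apply/ltW; rewrite ltr_cos ?in_itv /=; [lra|lra|lra].
have cp : cos (pi / 4) <= cos (t / 2).
  have p2 := @pi_ge2 R.
  have [->//|ct] := eqVneq (t / 2) (pi / 4).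
  by apply/ltW; rewrite ltr_cos ?in_itv /=; [lra|lra|lra].
have c4 : cos (pi / 4) ^+ 2 = 2^-1 :> R.
  have := cos_mulr2n (pi / 4 : R).
  have -> : (pi / 4 : R) *+ 2 = pi / 2 by rewrite mulr2n; lra.
  by rewrite cos_pihalf => /esym/eqP; rewrite mulr2n => /eqP ?; lra.
have c40 : 0 <= cos (pi / 4) :> R.
  by apply: cos_ge0_pihalf; have := @pi_ge2 R; lra.
have -> : t = (t / 2) *+ 2 by rewrite mulr2n; lra.
rewrite sin_mulr2n E mulr2n.
have : 2^-1 <= cos (t / 2) * cos c.
  by rewrite -[X in X <= _]c4 expr2 ler_pM ?(le_trans cp cs).
nra.
Qed.

Lemma cabs_expiB1 t : `|t| <= 2^-1 -> 2 * `|t| <= cabs (expi t - 1).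
Proof.
move=> ht.
rewrite cabs_sqrt /= oppr0 addr0.
have -> : (cos (2 * pi * t) - 1) ^+ 2 + sin (2 * pi * t) ^+ 2 = (2 * sin (pi * t)) ^+ 2.
  have -> : 2 * pi * t = (pi * t) *+ 2 by rewrite mulr2n; lra.
  have := cos2Dsin2 (pi * t).
  rewrite sin_mulr2n cos_mulr2n !mulr2n; set a := cos _; set b := sin _ => E.
  have -> : a ^+ 2 + a ^+ 2 - 1 - 1 = - (b ^+ 2 + b ^+ 2) by lra.
  have -> : (- (b ^+ 2 + b ^+ 2)) ^+ 2 + (a * b + a * b) ^+ 2 = 4 * b ^+ 2 * (a ^+ 2 + b ^+ 2) by ring.
  by rewrite E; ring.
rewrite sqrtr_sqr normrM ger0_norm// ler_pM2l//.
have p2 := @pi_ge2 R.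
have [t0|t0] := leP 0 t.
  rewrite (ger0_norm t0) in ht *.
  by apply: le_trans (le_trans _ (sin_ge_half _)) (ler_norm _); nra.
rewrite (ltr0_norm t0) in ht *; rewrite -[X in _ <= X]normrN -sinN -mulrN.
by apply: le_trans (le_trans _ (sin_ge_half _)) (ler_norm _); nra.
Qed.

(* The signed distance to the nearest integer. *)
Definition fr y : R := y - (Num.floor (y + 2^-1))%:~R.

Lemma fr_itv y : - 2^-1 <= fr y < 2^-1.
Proof.
have := floor_le (y + 2^-1); have := floorD1_gt (y + 2^-1).
rewrite /fr; set n := Num.floor _; rewrite intrD => ? ?; lra.
Qed.

Lemma fr_norm y : `|fr y| <= 2^-1.
Proof. by have := fr_itv y; rewrite ler_norml => /andP[-> /ltW ->]. Qed.

Lemma fr_le (k : int) y : `|fr y| <= `|y - k%:~R|.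
Proof.
have [->|nk] := eqVneq k (Num.floor (y + 2^-1)); first by [].
apply: (@le_trans _ _ 2^-1); first exact: fr_norm.
have h := fr_itv y; rewrite /fr in h; set n := Num.floor _ in nk h.
have -> : y - k%:~R = y - n%:~R + (n - k)%:~R by rewrite intrB; lra.
have [d|d|/eqP] := ltgtP (n - k) 0; last by rewrite subr_eq0 eq_sym (negbTE nk).
  have : (n - k)%:~R <= -1 :> R by rewrite (_ : -1 = (-1)%:~R)// ler_int; lia.
  by move=> d1; rewrite ler0_norm; lra.
have : 1 <= (n - k)%:~R :> R by rewrite (_ : 1 = 1%:~R)// ler_int; lia.
by move=> d1; rewrite ger0_norm; lra.
Qed.

Lemma expi_fr y : expi y = expi (fr y).
Proof.
have {1}-> : y = fr y + (Num.floor (y + 2^-1))%:~R by rewrite /fr subrK.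
by rewrite expiD expi_int mulr1.
Qed.

(* [min (M, 1/|fr y|)], written without a division by zero at integers. *)
Definition kern (M : nat) y : R := M%:R / Num.max 1 (M%:R * `|fr y|).

Lemma kern_ge0 M y : 0 <= kern M y.
Proof. by rewrite /kern divr_ge0// le_max ler01. Qed.

(** The numerator of the geometric sum is at most 2 and by [cabs_expiB1] its denominator is at least
    2|fr y|, so the factors 2 cancel. *)
Lemma geometric_kern (M n : nat) (c y : R) : (n <= M)%N ->
  cabs (\sum_(j < n) expi (c + j%:R * y)) <= kern M y.
Proof.
move=> nM; under eq_bigr do rewrite expiD expiX.
rewrite -big_distrr /= cabsM cabs_expi mul1r expi_fr.
have triv : cabs (\sum_(i < n) expi (fr y) ^+ i) <= M%:R.
  apply: le_trans (cabs_sum _ _ _) _.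
  rewrite (eq_bigr (fun=> 1)); last by move=> i _; rewrite -expiX cabs_expi.
  by rewrite sumr_const card_ord ler_nat.
rewrite /kern; have [h|h] := leP (M%:R * `|fr y|) 1; first by rewrite divr1.
have M0 : 0 < M%:R :> R by rewrite ltr0n; case: (M) h => //; rewrite mul0r ltr10.
have f0 : 0 < `|fr y| by rewrite -(pmulr_rgt0 _ M0) (lt_trans _ h).
rewrite invfM mulrA divff ?gt_eqF// mul1r -(ler_pM2l f0) divff ?gt_eqF//.
have E := subrX1 (expi (fr y)) n.
have lo := cabs_expiB1 (fr_norm y).
have up : cabs (expi (fr y) ^+ n - 1) <= 2.
  apply: le_trans (cabsD _ _) _; rewrite -expiX cabs_expi cabsN.
  by rewrite -expi0 cabs_expi; lra.
rewrite E cabsM in up.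
have := cabs_ge0 (\sum_(i < n) expi (fr y) ^+ i).
nra.
Qed.
End Exponential.

(** * Weyl differencing for forms *)

Lemma ler_sum_sub (R : numDomainType) (T : eqType) (s1 s2 : seq T) (F : T -> R) :
  uniq s1 -> uniq s2 -> {subset s1 <= s2} -> (forall x, 0 <= F x) ->
  \sum_(x <- s1) F x <= \sum_(x <- s2) F x.
Proof.
move=> u1 u2 sub F0; rewrite [leRHS](bigID (mem s1)) /= -[in leRHS]big_filter.
rewrite (perm_big [seq x <- s2 | x \in s1]) /=; last first.
  apply: uniq_perm => //; first exact: filter_uniq.
  by move=> x; rewrite mem_filter; case: (boolP (x \in s1)) => // /sub ->.
by rewrite lerDl sumr_ge0.
Qed.

(** Groups the pairs by their difference i - j = m - n; for fixed [m] the second index runs through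
    an interval. The condition [n <= a m + m] keeps the natural subtraction in the first index from
    truncating. *)
Lemma sum_by_difference (V : nmodType) (n : nat) : exists a len : nat -> nat,
  (forall m, (len m <= n)%N /\ (n <= a m + m)%N) /\
  forall F : nat -> nat -> V,
  \sum_(i <- iota 0 n) \sum_(j <- iota 0 n) F i j =
  \sum_(m <- iota 0 (n + n)) \sum_(j <- iota 0 (len m)) F (a m + m + j - n)%N (a m + j)%N.
Proof.
exists (fun m => n - m)%N, (fun m => minn n (n + n - m) - (n - m))%N; split.
  by move=> m; split; lia.
move=> F.
transitivity (\sum_(p <- [seq (i, j) | i <- iota 0 n, j <- iota 0 n]) F p.1 p.2).
  by rewrite big_allpairs_dep.
transitivity (\sum_(p <- [seq (n - m + m + j - n, n - m + j)%N | m <- iota 0 (n + n),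
    j <- iota 0 (minn n (n + n - m) - (n - m))]) F p.1 p.2); last first.
  by rewrite big_allpairs_dep.
apply/perm_big/uniq_perm.
- by apply: allpairs_uniq_dep => [||[? ?] [? ?] _ _ [-> ->]//]; rewrite ?iota_uniq// => *; rewrite iota_uniq.
- apply: allpairs_uniq_dep => [|m _|]; rewrite ?iota_uniq//.
  move=> [m j] [m' j'] /allpairsPdep[x [y [+ + [-> ->]]]] /allpairsPdep[x' [y' [+ + [-> ->]]]] /=.
  rewrite !mem_iota => H1 H2 H3 H4 [E1 E2].
  have E : x = x' by lia.
  by rewrite E; congr existT; lia.
move=> [i j]; apply/allpairsPdep/allpairsPdep => -[x [y [+ + [-> ->]]]]; rewrite !mem_iota => H1 H2.
  by exists (n + x - y)%N, (y - (n - (n + x - y)))%N; rewrite !mem_iota; split; [lia|lia|congr pair; lia].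
by eexists _, _; rewrite !mem_iota; split; last reflexivity; lia.
Qed.

Section BoxSum.
Variable R : realType.
Implicit Types x : R.

Definition box_sum (V : nmodType) (A B : int) (n1 n2 : nat) (F : int -> int -> V) : V :=
  \sum_(i <- iota 0 n1) \sum_(j <- iota 0 n2) F (A + i%:Z) (B + j%:Z).

Definition Tsum (M L : nat) x : R :=
  \sum_(l <- iota 0 (L + L)) kern M ((l%:Z - L%:Z)%:~R * x).

Lemma Tsum_ge0 M L x : 0 <= Tsum M L x.
Proof. by apply: sumr_ge0 => l _; exact: kern_ge0. Qed.

Lemma Tsum_sqr M L x :
  Tsum M L x ^+ 2 = \sum_(v <- zbox L) kern M (v.1%:~R * x) * kern M (v.2%:~R * x).
Proof.
rewrite expr2 /Tsum /zbox big_allpairs_dep /= big_distrl /=.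
by apply: eq_bigr => i _; rewrite big_distrr.
Qed.

Lemma geometric_kern_iota (M n : nat) (c y : R) : (n <= M)%N ->
  cabs (\sum_(j <- iota 0 n) expi (c + j%:R * y)) <= kern M y.
Proof.
move=> nM; have := geometric_kern c y nM.
by rewrite -(big_mkord xpredT (fun j => expi (c + j%:R * y))) /index_iota subn0.
Qed.

(* Weyl differencing in both variables. *)
Lemma box_sum_kern (Q : int * int * int) (A B : int) (n1 n2 M L : nat) x :
  posdef Q -> (n1 <= M)%N -> (n2 <= M)%N ->
  (2 * `|Q.1.1| + `|Q.1.2| + 2 * `|Q.2|) * M%:Z < L%:Z ->
  cabs (box_sum A B n1 n2 (fun u v => expi ((bqf Q (u, v))%:~R * x))) <= Tsum M L x.
Proof.
case: Q => [[a b] c] /= pQ n1M n2M ML.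
rewrite -(@ler_pXn2r _ 2)// ?nnegrE ?cabs_ge0 ?Tsum_ge0//.
(* (l1 h, l2 h) is the gradient of the form at [h]. A shift by [h] changes the form by a function
   affine in (u, v) with these slopes, so the inner double sum factors into two geometric sums. *)
pose l1 (h : int * int) := 2 * a * h.1 + b * h.2.
pose l2 (h : int * int) := b * h.1 + 2 * c * h.2.
set Q := (a, b, c).
have key (h : int * int) (u v : int) : bqf Q (u + h.1, v + h.2) - bqf Q (u, v) =
    bqf Q h + u * l1 h + v * l2 h by rewrite /bqf /l1 /l2 /=; ring.
have [a1 [len1 [H1 D1]]] := sum_by_difference R[i] n1.
have [a2 [len2 [H2 D2]]] := sum_by_difference R[i] n2.
set S := box_sum _ _ _ _ _.
have -> : cabs S ^+ 2 = cabs (S * S^*%C).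
  by rewrite expr2 cabsM; congr (_ * _); rewrite /cabs normcJ.
pose f (i k : nat) := (bqf Q (A + i%:Z, B + k%:Z))%:~R * x.
have -> : S * S^*%C = \sum_(m1 <- iota 0 (n1 + n1)) \sum_(m2 <- iota 0 (n2 + n2))
   \sum_(j <- iota 0 (len1 m1)) \sum_(l <- iota 0 (len2 m2))
     expi (f (a1 m1 + m1 + j - n1)%N (a2 m2 + m2 + l - n2)%N - f (a1 m1 + j)%N (a2 m2 + l)%N).
  have -> : S * S^*%C = \sum_(i <- iota 0 n1) \sum_(j <- iota 0 n1)
      \sum_(k <- iota 0 n2) \sum_(l <- iota 0 n2) expi (f i k - f j l).
    rewrite /S /box_sum rmorph_sum big_distrl /=; apply: eq_bigr => i _.
    rewrite big_distrr /=; apply: eq_bigr => j _.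
    rewrite rmorph_sum big_distrl /=; apply: eq_bigr => k _.
    rewrite big_distrr /=; apply: eq_bigr => l _.
    by rewrite expiD -[in RHS]expi_conj.
  rewrite D1; apply: eq_bigr => m1 _.
  under eq_bigr do rewrite D2.
  by rewrite exchange_big.
pose hh (m : nat * nat) : int * int := (m.1%:Z - n1%:Z, m.2%:Z - n2%:Z).
pose s := [seq (m1, m2) | m1 <- iota 0 (n1 + n1), m2 <- iota 0 (n2 + n2)].
apply: (@le_trans _ _ (\sum_(m <- s) kern M ((l1 (hh m))%:~R * x) * kern M ((l2 (hh m))%:~R * x))).
  rewrite /s big_allpairs_dep /=.
  apply: le_trans (cabs_sum _ _ _) _; apply: ler_sum => m1 _.
  apply: le_trans (cabs_sum _ _ _) _; apply: ler_sum => m2 _.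
  set h := hh (m1, m2).
  have [hl1 ha1] := H1 m1; have [hl2 ha2] := H2 m2.
  pose c0 := (bqf Q h + (A + (a1 m1)%:Z) * l1 h + (B + (a2 m2)%:Z) * l2 h)%:~R * x.
  rewrite (eq_bigr (fun j => \sum_(l <- iota 0 (len2 m2))
     (expi (c0 + j%:R * ((l1 h)%:~R * x)) * expi (0 + l%:R * ((l2 h)%:~R * x))))); last first.
    move=> j _; apply: eq_bigr => l _; rewrite -expiD; congr expi.
    rewrite /f -mulrBl -intrB.
    have -> : A + (a1 m1 + m1 + j - n1)%N%:Z = A + (a1 m1 + j)%N%:Z + h.1 by rewrite /h /hh /=; lia.
    have -> : B + (a2 m2 + m2 + l - n2)%N%:Z = B + (a2 m2 + l)%N%:Z + h.2 by rewrite /h /hh /=; lia.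
    rewrite key /c0 add0r !mulrA -!mulrDl; congr (_ * x).
    rewrite !PoszD !(intrD, intrM) -!pmulrn; ring.
  under eq_bigr do rewrite -big_distrr /=.
  rewrite -big_distrl /= cabsM.
  by apply: ler_pM; rewrite ?cabs_ge0// geometric_kern_iota//; lia.
rewrite Tsum_sqr.
have -> : \sum_(m <- s) kern M ((l1 (hh m))%:~R * x) * kern M ((l2 (hh m))%:~R * x) =
  \sum_(v <- [seq (l1 (hh m), l2 (hh m)) | m <- s]) kern M (v.1%:~R * x) * kern M (v.2%:~R * x).
  by rewrite big_map.
(* The linear map from [h] to (l1 h, l2 h) has determinant 4ac - b^2, hence is injective. So the sum
   over [h] is at most the sum over all pairs of frequencies in the box, and that is the square of
   [Tsum]. *)
have d0 : 0 < 4 * a * c - b ^+ 2 by case/andP: pQ.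
apply: ler_sum_sub.
- rewrite map_inj_uniq; first by apply: allpairs_uniq; rewrite ?iota_uniq// => -[? ?] [? ?].
  move=> [m1 m2] [m1' m2']; rewrite /l1 /l2 /hh /= => -[E1 E2].
  have F1 : (4 * a * c - b ^+ 2) * (m1%:Z - m1'%:Z) = 0.
    rewrite (_ : _ * _ = 2 * c * ((2 * a * (m1%:Z - n1%:Z) + b * (m2%:Z - n2%:Z)) - (2 * a * (m1'%:Z - n1%:Z) + b * (m2'%:Z - n2%:Z)))
       - b * ((b * (m1%:Z - n1%:Z) + 2 * c * (m2%:Z - n2%:Z)) - (b * (m1'%:Z - n1%:Z) + 2 * c * (m2'%:Z - n2%:Z)))); last by ring.
    by rewrite E1 E2 !subrr !mulr0 subrr.
  have F2 : (4 * a * c - b ^+ 2) * (m2%:Z - m2'%:Z) = 0.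
    rewrite (_ : _ * _ = 2 * a * ((b * (m1%:Z - n1%:Z) + 2 * c * (m2%:Z - n2%:Z)) - (b * (m1'%:Z - n1%:Z) + 2 * c * (m2'%:Z - n2%:Z)))
       - b * ((2 * a * (m1%:Z - n1%:Z) + b * (m2%:Z - n2%:Z)) - (2 * a * (m1'%:Z - n1%:Z) + b * (m2'%:Z - n2%:Z)))); last by ring.
    by rewrite E1 E2 !subrr !mulr0 subrr.
  have G1 : m1%:Z = m1'%:Z by apply/eqP; move/eqP: F1; rewrite mulf_eq0 gt_eqF//= subr_eq0.
  have G2 : m2%:Z = m2'%:Z by apply/eqP; move/eqP: F2; rewrite mulf_eq0 gt_eqF//= subr_eq0.
  by congr pair; lia.
- exact: zbox_uniq.
- move=> v /mapP[m /allpairsP[[m1 m2] /= [I1 I2 ->]] ->].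
  rewrite !mem_iota in I1 I2; rewrite mem_zbox /l1 /l2 /hh /=.
  have u1 : `|m1%:Z - n1%:Z| <= M%:Z by lia.
  have u2 : `|m2%:Z - n2%:Z| <= M%:Z by lia.
  have bd (e w : int) : `|w| <= M%:Z -> `|e * w| <= `|e| * M%:Z.
    by move=> hw; rewrite normrM ler_wpM2l.
  have [B1 B2 B3 B4] := And4 (bd a _ u1) (bd b _ u1) (bd b _ u2) (bd c _ u2).
  rewrite !mulrDl -!mulrA in ML *.
  move: B1 B2 B3 B4 ML; move: (a * _) (b * _) (b * _) (c * _) (`|a| * _) (`|b| * _) (`|c| * _); lia.
- by move=> v; rewrite mulr_ge0// kern_ge0.
Qed.
End BoxSum.

(** * Abel summation *)

Section AbelSummation.
Variable R : realType.
Implicit Types (T : R) (g : nat -> R).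

Lemma iotaSr m n : iota m n.+1 = rcons (iota m n) (m + n).
Proof. by rewrite -addn1 iotaD cats1. Qed.

Lemma sum_iotaSr (V : nmodType) n (F : nat -> V) :
  \sum_(i <- iota 0 n.+1) F i = \sum_(i <- iota 0 n) F i + F n.
Proof. by rewrite iotaSr -cats1 big_cat big_seq1. Qed.

Lemma abel_sum (n : nat) g (w : nat -> R[i]) :
  \sum_(i <- iota 0 n.+1) (g i)%:C%C * w i =
  (g n)%:C%C * \sum_(i <- iota 0 n.+1) w i -
  \sum_(i <- iota 0 n) (g i.+1 - g i)%:C%C * \sum_(k <- iota 0 i.+1) w k.
Proof.
elim: n => [|n IH]; first by rewrite !big_seq1 big_nil subr0.
rewrite sum_iotaSr IH [in RHS]sum_iotaSr [in X in _ = _ - X]sum_iotaSr rmorphB /=.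
ring.
Qed.

Lemma abel_bound (n : nat) g (w : nat -> R[i]) (T F0 F1 : R) :
  0 <= T -> (forall p, (p <= n.+1)%N -> cabs (\sum_(i <- iota 0 p) w i) <= T) ->
  `|g n| <= F0 -> (forall i, (i < n)%N -> `|g i.+1 - g i| <= F1) ->
  cabs (\sum_(i <- iota 0 n.+1) (g i)%:C%C * w i) <= T * (F0 + n%:R * F1).
Proof.
move=> T0 hT h0 h1; rewrite abel_sum; apply: le_trans (cabsD _ _) _.
rewrite cabsN mulrDr; apply: lerD.
  by rewrite cabsM cabs_real mulrC ler_pM ?cabs_ge0// hT.
apply: le_trans (cabs_sum _ _ _) _.
have -> : T * (n%:R * F1) = \sum_(i <- iota 0 n) T * F1.
  by rewrite big_const_seq count_predT size_iota iter_addr_0 -[in RHS]mulr_natl; ring.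
rewrite big_seq [leRHS]big_seq; apply: ler_sum => i; rewrite mem_iota add0n => /= hi.
rewrite cabsM cabs_real mulrC.
by apply: ler_pM; [exact: cabs_ge0| |exact: (hT i.+1 (ltnW hi))|exact: h1].
Qed.

(** Abel summation in [j], and then in [i] for each of the two coefficient families produced: the
    last values and the differences in [j]. *)
Lemma abel_bound2 (n1 n2 : nat) (f : nat -> nat -> R) (z : nat -> nat -> R[i])
    (T F0 F1 F2 F12 : R) :
  0 <= T -> 0 <= F0 -> 0 <= F1 -> 0 <= F2 -> 0 <= F12 ->
  (forall p q, (p <= n1)%N -> (q <= n2)%N ->
     cabs (\sum_(i <- iota 0 p) \sum_(j <- iota 0 q) z i j) <= T) ->
  (forall i j, (i < n1)%N -> (j < n2)%N -> `|f i j| <= F0) ->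
  (forall i j, (i.+1 < n1)%N -> (j < n2)%N -> `|f i.+1 j - f i j| <= F1) ->
  (forall i j, (i < n1)%N -> (j.+1 < n2)%N -> `|f i j.+1 - f i j| <= F2) ->
  (forall i j, (i.+1 < n1)%N -> (j.+1 < n2)%N ->
     `|f i.+1 j.+1 - f i.+1 j - (f i j.+1 - f i j)| <= F12) ->
  cabs (\sum_(i <- iota 0 n1) \sum_(j <- iota 0 n2) (f i j)%:C%C * z i j)
    <= T * (F0 + n1%:R * F1 + n2%:R * (F2 + n1%:R * F12)).
Proof.
move=> T0 p0 p1 p2 p12 hT h0 h1 h2 h12.
have B0 : 0 <= T * (F0 + n1%:R * F1 + n2%:R * (F2 + n1%:R * F12)).
  by rewrite mulr_ge0// !addr_ge0// ?mulr_ge0// ?addr_ge0// mulr_ge0.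
case: n1 n2 hT h0 h1 h2 h12 B0 => [|n1] [|n2] hT h0 h1 h2 h12 B0;
  try by rewrite ?big_nil ?cabs0// big1 ?cabs0// => i _; rewrite big_nil.
under eq_bigr do rewrite abel_sum.
rewrite big_split /= sumrN; apply: le_trans (cabsD _ _) _; rewrite cabsN mulrDr.
apply: lerD.
  apply: le_trans (abel_bound T0 (F0 := F0) (F1 := F1) _ _ _) _.
  - by move=> p hp; exact: (hT p n2.+1 hp (leqnn _)).
  - exact: h0.
  - by move=> i hi; exact: h1.
  by rewrite ler_wpM2l// lerD2l ler_wpM2r// ler_nat.
rewrite exchange_big /=; apply: le_trans (cabs_sum _ _ _) _.
apply: (@le_trans _ _ (\sum_(j <- iota 0 n2) T * (F2 + n1%:R * F12))).
  rewrite big_seq [leRHS]big_seq; apply: ler_sum => j; rewrite mem_iota add0n => /= hj.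
  apply: abel_bound => //.
  - by move=> p hp; apply: (hT p j.+1 hp); lia.
  - by apply: h2.
  - by move=> i hi; apply: h12; lia.
rewrite big_const_seq count_predT size_iota iter_addr_0 -[X in X <= _]mulr_natl [X in X <= _]mulrCA.
rewrite ler_wpM2l//.
apply: ler_pM; rewrite ?ler_nat// ?addr_ge0// ?mulr_ge0//.
by rewrite lerD2l ler_wpM2r// ler_nat.
Qed.
End AbelSummation.

(** * Differences of negative powers *)

Section PowerDifferences.
Variable R : realType.
Implicit Types (p m x y al be : R).

Lemma MVT_closed (f df : R -> R) (a b : R) : a <= b ->
  (forall t, t \in `[a, b]%R -> is_derive t 1 f (df t)) ->
  exists2 c, c \in `[a, b]%R & f b - f a = df c * (b - a).
Proof.
move=> ab dfP.
have d1 t : t \in `]a, b[%R -> is_derive t 1 f (df t).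
  by move=> ht; apply: dfP; move: ht; rewrite !in_itv /= => /andP[/ltW-> /ltW->].
have c1 : {within `[a, b], continuous f}.
  by apply: derivable_within_continuous => t /dfP dft; exact: (@ex_derive _ _ _ _ _ _ _ dft).
exact: (MVT_segment ab d1 c1).
Qed.

Lemma powRN_le p m x : 0 <= p -> 0 < m -> m <= x -> x `^ (- p) <= m `^ (- p).
Proof.
move=> p0 m0 mx; have x0 := lt_le_trans m0 mx.
by rewrite !powRN lef_pV2 ?posrE ?powR_gt0// ge0_ler_powR ?nnegrE// ltW.
Qed.

Lemma powRN_lip p m x y : 0 <= p -> 0 < m -> m <= x -> m <= y ->
  `|x `^ (- p) - y `^ (- p)| <= p * m `^ (- p - 1) * `|x - y|.
Proof.
move=> p0 m0; wlog xy : x y / y <= x.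
  move=> H mx my; case/orP: (le_total y x) => h; first exact: H.
  by rewrite distrC (distrC x); exact: H.
move=> mx my; have y0 := lt_le_trans m0 my.
have dg t : t \in `[y, x]%R -> is_derive t 1 (fun t => t `^ (- p)) (- p * t `^ (- p - 1)).
  by rewrite in_itv /= => /andP[yt _]; apply: is_derive1_powR; lra.
have [c] := MVT_closed xy dg.
rewrite in_itv /= => /andP[yc cx] ->.
rewrite !normrM normrN (ger0_norm p0) (ger0_norm (powR_ge0 _ _)) ler_wpM2r// ler_wpM2l//.
by rewrite -opprD; apply: powRN_le => //; lra.
Qed.

(** Mean value theorem for the difference (t + be)^(-p) - t^(-p) as a function of t; its derivative
    is bounded by [powRN_lip] with exponent p + 1. Exchanging x and x + al only changes the sign, so
    al may be taken nonnegative. *)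
Lemma powRN_diff2 p m x al be : 0 <= p -> 0 < m ->
  m <= x -> m <= x + al -> m <= x + be -> m <= x + al + be ->
  `|(x + al + be) `^ (- p) - (x + al) `^ (- p) - ((x + be) `^ (- p) - x `^ (- p))|
    <= p * (p + 1) * m `^ (- p - 2) * (`|al| * `|be|).
Proof.
move=> p0 m0; wlog al0 : x al / 0 <= al.
  move=> H h1 h2 h3 h4; case/orP: (le_total 0 al) => h; first exact: H.
  have e1 : x + al + - al = x by lra.
  have := H (x + al) (- al); rewrite oppr_ge0 normrN e1 => /(_ h h2 h1 h4 h3).
  by rewrite distrC.
move=> h1 h2 h3 h4.
pose h t := (t + be) `^ (- p) - t `^ (- p).
pose dh t := - p * (t + be) `^ (- p - 1) - (- p * t `^ (- p - 1)).
have dhP t : t \in `[x, x + al]%R -> is_derive t 1 h (dh t).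
  rewrite in_itv /= => /andP[xt tx].
  apply: is_deriveB; last by apply: is_derive1_powR; lra.
  rewrite -[X in is_derive _ _ _ X]mulr1.
  apply: (@is_derive1_comp _ (fun t => t `^ (- p)) (fun t => t + be)).
    by apply: is_derive1_powR; lra.
  by rewrite -[X in is_derive _ _ _ X]addr0; apply: is_deriveD.
have xal : x <= x + al by lra.
have [c] := MVT_closed xal dhP.
rewrite in_itv /= /h => /andP[xc cx] ->.
rewrite addrAC subrr add0r normrM (mulrC `|al|) mulrA ler_wpM2r//.
rewrite /dh -mulrBr normrM normrN (ger0_norm p0) -!mulrA ler_wpM2l//.
rewrite -!opprD.
have := @powRN_lip (p + 1) m (c + be) c.
rewrite (addrAC c) subrr add0r -[- (p + 1) - 1]opprD -addrA mulrA; apply; lra.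
Qed.
End PowerDifferences.

(** * Dyadic shells *)

Section ShellBound.
Variable R : realType.
Implicit Types (s x : R) (Q : int * int * int).

Definition qpow Q s (u v : int) : R := (bqf Q (u, v))%:~R `^ (- s).

(** [be] measures how far the four arguments are from q10 + q01 = q00 + q11. If it exceeds [m], the
    trivial bound suffices. Otherwise [q11] is moved by [be] and [powRN_diff2] applies; the factor 2
    in the lower bounds keeps the moved point above [m]. *)
Lemma powRN_mixed_diff s (m q00 q10 q01 q11 be A : R) :
  0 < s <= 1 -> 0 < m -> 2 * m <= q00 -> 2 * m <= q10 -> 2 * m <= q01 -> 2 * m <= q11 ->
  q11 = q10 + q01 - q00 + be -> `|q10 - q00| <= A -> `|q01 - q00| <= A ->
  `|q11 `^ (- s) - q10 `^ (- s) - (q01 `^ (- s) - q00 `^ (- s))| <=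
    m `^ (- s) * (4 * `|be| / m + 2 * (A / m) ^+ 2).
Proof.
move=> /andP[s0 s1] m0 h00 h10 h01 h11 E hA1 hA2.
have P0 : 0 <= m `^ (- s) := powR_ge0 _ _.
have A0 : 0 <= A := le_trans (normr_ge0 _) hA1.
have [hb|hb] := leP `|be| m; last first.
  have le q : 2 * m <= q -> 0 <= q `^ (- s) <= m `^ (- s).
    by move=> hq; rewrite powR_ge0 powRN_le//; [exact: ltW|lra].
  have b1 : 1 <= `|be| / m by rewrite ler_pdivlMr// mul1r ltW.
  have sq : 0 <= (A / m) ^+ 2 := sqr_ge0 _.
  have := le _ h00; have := le _ h10; have := le _ h01; have := le _ h11.
  set X := q11 `^ _; set Y := q10 `^ _; set Z := q01 `^ _; set W := q00 `^ _.
  move=> /andP[? ?] /andP[? ?] /andP[? ?] /andP[? ?].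
  rewrite -(mulrA 4); apply: (@le_trans _ _ (m `^ (- s) * 4)); last by rewrite ler_wpM2l//; lra.
  by rewrite ler_norml; apply/andP; split; lra.
have lo : m <= q00 + (q10 - q00) + (q01 - q00).
  have -> : q00 + (q10 - q00) + (q01 - q00) = q11 - be by rewrite E; ring.
  by have := ler_norm be; lra.
have mn0 : m != 0 by rewrite gt_eqF.
have L1 := @powRN_lip R s m q11 (q00 + (q10 - q00) + (q01 - q00)) (ltW s0) m0 _ lo.
have {}L1 := L1 (le_trans _ h11).
have d2 := @powRN_diff2 R s m q00 (q10 - q00) (q01 - q00) (ltW s0) m0.
have m1 : m `^ (- s - 1) = m `^ (- s) / m.
  by rewrite powRB ?mn0 ?implybT// powRr1// ltW.
have m2 : m `^ (- s - 2) = m `^ (- s) / m ^+ 2.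
  by rewrite powRB ?mn0 ?implybT// -(powR_mulrn _ (ltW m0)).
rewrite m1 in L1; rewrite m2 in d2.
have e10 : q00 + (q10 - q00) = q10 by ring.
have e01 : q00 + (q01 - q00) = q01 by ring.
have {}L1 : `|q11 `^ (- s) - (q00 + (q10 - q00) + (q01 - q00)) `^ (- s)| <=
   m `^ (- s) * (`|be| / m).
  apply: le_trans (L1 _) _; first lra.
  have -> : q11 - (q00 + (q10 - q00) + (q01 - q00)) = be by rewrite E; ring.
  rewrite (_ : s * _ * _ = s * (m `^ (- s) * (`|be| / m))); last by ring.
  by rewrite ler_piMl// mulr_ge0// divr_ge0// ltW.
have {}d2 : `|(q00 + (q10 - q00) + (q01 - q00)) `^ (- s) - q10 `^ (- s) - (q01 `^ (- s) - q00 `^ (- s))| <=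
   m `^ (- s) * (2 * (A / m) ^+ 2).
  rewrite e10 e01 in d2 *; rewrite e10 in lo.
  apply: le_trans (d2 _ _ _ lo) _; try lra.
  have hh : `|q10 - q00| * `|q01 - q00| <= A ^+ 2 by rewrite expr2 ler_pM.
  have -> : m `^ (- s) * (2 * (A / m) ^+ 2) = 2 * (m `^ (- s) / m ^+ 2) * A ^+ 2.
    by rewrite expr_div_n; field; rewrite gt_eqF.
  have c0 : 0 <= m `^ (- s) / m ^+ 2 by rewrite divr_ge0// exprn_ge0// ltW.
  apply: ler_pM => //.
    by rewrite mulr_ge0// mulr_ge0 ?ltW//; lra.
  by rewrite ler_wpM2r//; nra.
have -> : q11 `^ (- s) - q10 `^ (- s) - (q01 `^ (- s) - q00 `^ (- s)) =
  (q11 `^ (- s) - (q00 + (q10 - q00) + (q01 - q00)) `^ (- s)) +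
  ((q00 + (q10 - q00) + (q01 - q00)) `^ (- s) - q10 `^ (- s) - (q01 `^ (- s) - q00 `^ (- s))).
  ring.
apply: le_trans (ler_normD _ _) _; rewrite mulrDr; apply: lerD => //.
apply: le_trans L1 _; rewrite ler_wpM2l// -mulrA ler_peMl//; last lra.
by rewrite divr_ge0// ltW.
Qed.

Definition shell_box (H : nat) (A B : int) (n1 n2 : nat) : Prop :=
  [/\ (n1 <= 4 * H)%N, (n2 <= 4 * H)%N &
  forall i j, (i < n1)%N -> (j < n2)%N ->
    [/\ `|A + i%:Z| <= (2 * H)%:Z, `|B + j%:Z| <= (2 * H)%:Z &
        H%:Z ^+ 2 <= (A + i%:Z) ^+ 2 + (B + j%:Z) ^+ 2]].

Lemma bqf_step1 Q (u v : int) :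
  bqf Q (u + 1, v) - bqf Q (u, v) = Q.1.1 * (u + (u + 1)) + Q.1.2 * v.
Proof. by rewrite /bqf /=; ring. Qed.

Lemma bqf_step1_le Q (u v H : int) : 0 <= Q.1.1 -> 0 <= Q.2 ->
  `|u| <= 2 * H -> `|u + 1| <= 2 * H -> `|v| <= 2 * H ->
  `|bqf Q (u + 1, v) - bqf Q (u, v)| <= (4 * Q.1.1 + 4 * Q.2 + 2 * `|Q.1.2|) * H.
Proof.
rewrite bqf_step1; move: Q.1.1 Q.1.2 Q.2 => a b c a0 c0 u1 u2 v1.
apply: le_trans (ler_normD _ _) _; rewrite !normrM (ger0_norm a0).
have b2 : `|b| * `|v| <= `|b| * (2 * H) by rewrite ler_wpM2l.
have b3 : a * `|u + (u + 1)| <= a * (4 * H) by rewrite ler_wpM2l//; lia.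
have b4 : 0 <= c * H by rewrite mulr_ge0//; lia.
have -> : (4 * a + 4 * c + 2 * `|b|) * H = a * (4 * H) + 4 * (c * H) + `|b| * (2 * H) by ring.
by move: b2 b3 b4; move: (`|b| * _) (a * _) (c * H) (`|b| * _) (a * _); lia.
Qed.

Lemma bqf_step2_le Q (u v H : int) : 0 <= Q.1.1 -> 0 <= Q.2 ->
  `|u| <= 2 * H -> `|v| <= 2 * H -> `|v + 1| <= 2 * H ->
  `|bqf Q (u, v + 1) - bqf Q (u, v)| <= (4 * Q.1.1 + 4 * Q.2 + 2 * `|Q.1.2|) * H.
Proof.
have E w z : bqf Q (w, z) = bqf (Q.2, Q.1.2, Q.1.1) (z, w) by rewrite /bqf /=; ring.
move=> a0 c0 u1 v1 v2; rewrite !E (addrC (4 * Q.1.1)).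
exact: (bqf_step1_le (Q := (Q.2, Q.1.2, Q.1.1))).
Qed.

Lemma bqf_step12 Q (u v : int) :
  bqf Q (u + 1, v + 1) = bqf Q (u + 1, v) + bqf Q (u, v + 1) - bqf Q (u, v) + Q.1.2.
Proof. by rewrite /bqf /=; ring. Qed.

(** On the shell the form is at least a constant times H^2, its steps are O(H) and its mixed
    difference is the constant [Q.1.2]. So the weight, H times its first differences and H^2 times
    its mixed difference are all O(H^(-2s)). *)
Lemma shell_box_bound Q s : posdef Q -> 0 < s <= 1 -> exists2 K : R, 0 <= K &
  forall (H L : nat) A B n1 n2 x, (0 < H)%N -> shell_box H A B n1 n2 ->
  (2 * `|Q.1.1| + `|Q.1.2| + 2 * `|Q.2|) * (4 * H)%:Z < L%:Z ->
  cabs (box_sum A B n1 n2 (fun u v => (qpow Q s u v)%:C%C * expi ((bqf Q (u, v))%:~R * x)))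
   <= K * (H%:R ^+ 2) `^ (- s) * Tsum (4 * H) L x.
Proof.
move=> pQ s01.
have [c0 _] := posdef_lower (0, 0) pQ; have /andP[a0 _] := pQ.
have [ka kaE] : exists ka : R, ka = (8 * (Q.1.1 + Q.2))%:~R by eexists.
pose K1z : int := 4 * Q.1.1 + 4 * Q.2 + 2 * `|Q.1.2|.
have [K1 K1E] : exists K1 : R, K1 = K1z%:~R by eexists.
have [b1 b1E] : exists b1 : R, b1 = (Q.1.2)%:~R by eexists.
have ka0 : 0 < ka by rewrite kaE ltr0z; lia.
have K10 : 0 <= K1 by rewrite K1E /K1z ler0z; lia.
(* Collects the four terms of [abel_bound2] for sides 4H, in units of m^(-s), where m = H^2 / ka. *)
pose C := 1 + 8 * K1 * ka + 64 * `|b1| * ka + 32 * K1 ^+ 2 * ka ^+ 2.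
have C0 : 0 <= C by rewrite /C !addr_ge0 ?mulr_ge0 ?ler0n ?exprn_ge0// ltW.
exists (C * ka `^ s); first by rewrite mulr_ge0// powR_ge0.
move=> H L A B n1 n2 x H0 [n1H n2H box] LH.
have h0 : 0 < H%:R :> R by rewrite ltr0n.
have [m mE] : exists m : R, m = H%:R ^+ 2 / ka by eexists.
have m0 : 0 < m by rewrite mE divr_gt0// exprn_gt0.
have [P PE0] : exists P : R, P = m `^ (- s) by eexists.
have P0 : 0 <= P by rewrite PE0 powR_ge0.
pose q (i j : nat) : R := (bqf Q (A + i%:Z, B + j%:Z))%:~R.
have qm i j : (i < n1)%N -> (j < n2)%N -> 2 * m <= q i j.
  move=> hi hj; have [_ _ h] := box i j hi hj.
  have [_ /= lo] := posdef_lower (A + i%:Z, B + j%:Z) pQ.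
  have lo' := le_trans h lo.
  have -> : 2 * m = H%:R ^+ 2 * 2 / ka by rewrite mE; field; rewrite gt_eqF.
  rewrite ler_pdivrMr// /q kaE -intrM.
  have -> : H%:R ^+ 2 * 2 = (H%:Z ^+ 2 * 2)%:~R :> R by rewrite intrM rmorphXn.
  rewrite ler_int [leRHS](_ : _ = 4 * (Q.1.1 + Q.2) * bqf Q (A + i%:Z, B + j%:Z) * 2).
    by rewrite ler_pM2r.
  by ring.
have m2 : 0 < 2 * m by lra.
have s0 : 0 <= s by case/andP: s01 => /ltW.
have s1 : s <= 1 by case/andP: s01.
have step1 i j : (i.+1 < n1)%N -> (j < n2)%N -> `|q i.+1 j - q i j| <= K1 * H%:R.
  move=> hi hj; have [u1 v1 _] := box i j (ltnW hi) hj; have [u2 _ _] := box i.+1 j hi hj.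
  have e : A + i.+1%:Z = A + i%:Z + 1 by rewrite -addrA -PoszD addn1.
  rewrite /q e -intrB -intr_norm K1E (_ : H%:R = H%:Z%:~R)// -intrM ler_int.
  by rewrite e in u2; apply: bqf_step1_le => //; exact: ltW.
have step2 i j : (i < n1)%N -> (j.+1 < n2)%N -> `|q i j.+1 - q i j| <= K1 * H%:R.
  move=> hi hj; have [u1 v1 _] := box i j hi (ltnW hj); have [_ v2 _] := box i j.+1 hi hj.
  have e : B + j.+1%:Z = B + j%:Z + 1 by rewrite -addrA -PoszD addn1.
  rewrite /q e -intrB -intr_norm K1E (_ : H%:R = H%:Z%:~R)// -intrM ler_int.
  by rewrite e in v2; apply: bqf_step2_le => //; exact: ltW.
have lip i j i' j' : (i < n1)%N -> (j < n2)%N -> (i' < n1)%N -> (j' < n2)%N ->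
    `|q i' j' - q i j| <= K1 * H%:R ->
    `|q i' j' `^ (- s) - q i j `^ (- s)| <= P * (K1 * H%:R / m).
  move=> h1 h2 h3 h4 h5.
  have le z : 2 * m <= z -> m <= z by move=> ?; lra.
  apply: le_trans (powRN_lip s0 m0 (le _ (qm _ _ h3 h4)) (le _ (qm _ _ h1 h2))) _.
  have -> : m `^ (- s - 1) = P / m.
    by rewrite PE0 powRB ?(gt_eqF m0) ?implybT// powRr1// ltW.
  have Pm : 0 <= P / m by rewrite divr_ge0// ltW.
  rewrite [X in _ <= X](_ : _ = 1 * (P / m) * (K1 * H%:R)); last by field; rewrite gt_eqF.
  by apply: ler_pM; [exact: mulr_ge0|exact: normr_ge0|exact: ler_wpM2r|].
pose F1 := P * (K1 * H%:R / m).
pose F12 := P * (4 * `|b1| / m + 2 * (K1 * H%:R / m) ^+ 2).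
have F1_ge0 : 0 <= F1 by rewrite /F1 mulr_ge0// divr_ge0 ?mulr_ge0// ltW.
have F12_ge0 : 0 <= F12.
  apply: mulr_ge0 => //; apply: addr_ge0; last by rewrite mulr_ge0// sqr_ge0.
  by apply: divr_ge0; [exact: mulr_ge0|exact: ltW].
have T0 := Tsum_ge0 (4 * H) L x.
apply: le_trans (@abel_bound2 R n1 n2 (fun i j => q i j `^ (- s))
   (fun i j => expi (q i j * x)) (Tsum (4 * H) L x) P F1 F1 F12 _ _ _ _ _ _ _ _ _ _) _ => //.
- by move=> p r hp hr; exact: (box_sum_kern A B x pQ (leq_trans hp n1H) (leq_trans hr n2H) LH).
- move=> i j hi hj; rewrite ger0_norm ?powR_ge0// PE0; apply: powRN_le => //.
  by have := qm i j hi hj; lra.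
- by move=> i j hi hj; apply: lip => //; [exact: ltnW|exact: step1].
- by move=> i j hi hj; apply: lip => //; [exact: ltnW|exact: step2].
- move=> i j hi hj; have hi' := ltnW hi; have hj' := ltnW hj.
  rewrite /F12 PE0 b1E; apply: powRN_mixed_diff => //; try exact: qm.
  + have e1 : A + i.+1%:Z = A + i%:Z + 1 by rewrite -addrA -PoszD addn1.
    have e2 : B + j.+1%:Z = B + j%:Z + 1 by rewrite -addrA -PoszD addn1.
    by rewrite /q e1 e2 bqf_step12 intrD intrB intrD.
  + exact: step1.
  + exact: step2.
have PE : P = (H%:R ^+ 2) `^ (- s) * ka `^ s.
  rewrite PE0 mE powRM ?invr_ge0 ?exprn_ge0 ?ltW//; congr (_ * _).
  rewrite -powR_inv1; last exact: ltW.
  by rewrite -powRrM; congr powR; ring.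
rewrite mulrC ler_wpM2r//.
rewrite (_ : C * _ * _ = P * C); last by rewrite PE; ring.
have n1r : n1%:R <= 4 * H%:R :> R by rewrite -natrM ler_nat.
have n2r : n2%:R <= 4 * H%:R :> R by rewrite -natrM ler_nat.
have -> : P * C = P + 4 * H%:R * F1 + 4 * H%:R * (F1 + 4 * H%:R * F12).
  rewrite /F1 /F12 /C mE; field.
  by rewrite !gt_eqF.
apply: lerD; first by rewrite lerD2l ler_wpM2r.
apply: ler_pM => //; first by rewrite addr_ge0// mulr_ge0.
by rewrite lerD2l ler_wpM2r.
Qed.
End ShellBound.

(** * Telescoping over dyadic squares *)

Section DyadicSum.
Variable R : realType.
Implicit Types (s x : R) (Q : int * int * int).

Lemma box_sum_split1 (V : nmodType) A B (n m k : nat) (F : int -> int -> V) :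
  box_sum A B (n + m) k F = box_sum A B n k F + box_sum (A + n%:Z) B m k F.
Proof.
rewrite /box_sum iotaD big_cat /= add0n -{2}(addn0 n) iotaDl big_map; congr (_ + _).
by apply: eq_bigr => i _; apply: eq_bigr => j _; rewrite PoszD addrA.
Qed.

Lemma box_sum_split2 (V : nmodType) A B (n m k : nat) (F : int -> int -> V) :
  box_sum A B k (n + m) F = box_sum A B k n F + box_sum A (B + n%:Z) k m F.
Proof.
rewrite /box_sum -big_split /=; apply: eq_bigr => i _.
rewrite iotaD big_cat /= add0n -{2}(addn0 n) iotaDl big_map; congr (_ + _).
by apply: eq_bigr => j _; rewrite PoszD addrA.
Qed.

Definition square_sum (V : nmodType) (H : nat) (F : int -> int -> V) : V :=
  box_sum (- H%:Z) (- H%:Z) (H + H) (H + H) F.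

Lemma square_sum_zbox (V : nmodType) (H : nat) (F : int -> int -> V) :
  square_sum H F = \sum_(v <- zbox H) F v.1 v.2.
Proof.
rewrite /zbox big_allpairs_dep; apply: eq_bigr => i _; apply: eq_bigr => j _.
by rewrite /= addrC (addrC (- _)).
Qed.

Lemma square_sum_double (V : zmodType) (H : nat) (F : int -> int -> V) :
  square_sum (2 * H) F - square_sum H F =
  box_sum (- (2 * H)%:Z) (- (2 * H)%:Z) H (4 * H) F +
  box_sum H%:Z (- (2 * H)%:Z) H (4 * H) F +
  box_sum (- H%:Z) (- (2 * H)%:Z) (2 * H) H F +
  box_sum (- H%:Z) H%:Z (2 * H) H F.
Proof.
have e : (2 * H + 2 * H = H + (2 * H + H))%N by lia.
have e4 : (4 * H = H + (2 * H + H))%N by lia.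
rewrite /square_sum e e4 box_sum_split1 (box_sum_split1 _ _ (2 * H)).
have -> : - (2 * H)%:Z + H%:Z = - H%:Z by lia.
have -> : - H%:Z + (2 * H)%:Z = H%:Z by lia.
rewrite (box_sum_split2 (- H%:Z) _ H) (box_sum_split2 (- H%:Z) _ (2 * H) H).
have -> : - (2 * H)%:Z + H%:Z = - H%:Z by lia.
have -> : - H%:Z + (2 * H)%:Z = H%:Z by lia.
have -> : (H + H = 2 * H)%N by lia.
have E (p q m r w : V) : p + (q + (m + r) + w) - m = p + w + q + r.
  rewrite !addrA (addrAC _ w (- m)) (addrAC _ r (- m)) addrK.
  by rewrite (addrAC _ r w) (addrAC p q w).
exact: E.
Qed.

Definition form_term Q s x (u v : int) : R[i] :=
  (qpow Q s u v)%:C%C * expi ((bqf Q (u, v))%:~R * x).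

Lemma form_shell_bound Q s : posdef Q -> 0 < s <= 1 -> exists2 K : R, 0 <= K &
  forall (H L : nat) x, (0 < H)%N ->
  (2 * `|Q.1.1| + `|Q.1.2| + 2 * `|Q.2|) * (4 * H)%:Z < L%:Z ->
  cabs (square_sum (2 * H) (form_term Q s x) - square_sum H (form_term Q s x))
   <= K * (H%:R ^+ 2) `^ (- s) * Tsum (4 * H) L x.
Proof.
move=> pQ s01; have [K K0 HK] := shell_box_bound pQ s01.
exists (4 * K); first by rewrite mulr_ge0.
move=> H L x H0 LH; rewrite square_sum_double.
have sq (u : int) : H%:Z <= `|u| -> H%:Z ^+ 2 <= u ^+ 2.
  by move=> hu; rewrite -[leRHS]real_normK ?num_real// lerXn2r ?nnegrE.
have b1 : shell_box H (- (2 * H)%:Z) (- (2 * H)%:Z) H (4 * H).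
  split=> [||i j hi hj]; [lia|lia|split; [lia|lia|]].
  by apply: ler_wpDr; rewrite ?sqr_ge0// sq//; lia.
have b2 : shell_box H H%:Z (- (2 * H)%:Z) H (4 * H).
  split=> [||i j hi hj]; [lia|lia|split; [lia|lia|]].
  by apply: ler_wpDr; rewrite ?sqr_ge0// sq//; lia.
have b3 : shell_box H (- H%:Z) (- (2 * H)%:Z) (2 * H) H.
  split=> [||i j hi hj]; [lia|lia|split; [lia|lia|]].
  by apply: ler_wpDl; rewrite ?sqr_ge0// sq//; lia.
have b4 : shell_box H (- H%:Z) H%:Z (2 * H) H.
  split=> [||i j hi hj]; [lia|lia|split; [lia|lia|]].
  by apply: ler_wpDl; rewrite ?sqr_ge0// sq//; lia.
have h A B n1 n2 (bx : shell_box H A B n1 n2) :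
    cabs (box_sum A B n1 n2 (form_term Q s x)) <= K * (H%:R ^+ 2) `^ (- s) * Tsum (4 * H) L x.
  exact: HK.
have h1 := h _ _ _ _ b1; have h2 := h _ _ _ _ b2; have h3 := h _ _ _ _ b3; have h4 := h _ _ _ _ b4.
have tri (z1 z2 z3 z4 : R[i]) : cabs (z1 + z2 + z3 + z4) <= cabs z1 + cabs z2 + cabs z3 + cabs z4.
  by do 2! [apply: le_trans (cabsD _ _) _; rewrite lerD2r]; exact: cabsD.
apply: le_trans (tri _ _ _ _) _.
rewrite -!mulrA in h1 h2 h3 h4 *; lra.
Qed.

Lemma form_unit_square Q s x : posdef Q -> 0 < s -> cabs (square_sum 1 (form_term Q s x)) <= 4.
Proof.
move=> pQ s0.
have le1 u v : cabs (form_term Q s x u v) <= 1.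
  rewrite /form_term cabsM cabs_expi mulr1 cabs_real ger0_norm ?powR_ge0// /qpow.
  (* At the origin the weight is a negative power of 0, which [powR] evaluates to 0; elsewhere the
     form is at least 1. *)
  have [->|v0] := eqVneq (u, v) (0, 0).
    by rewrite /bqf /= (_ : _ + _ + _ = 0) ?powR0 ?oppr_eq0 ?gt_eqF//; ring.
  have q1 : 1 <= (bqf Q (u, v))%:~R :> R.
    by rewrite (_ : 1 = 1%:~R)// ler_int -gtz0_ge1 bqf_gt0.
  by rewrite -[leRHS](powRr0 (bqf Q (u, v))%:~R) ler_powR// oppr_le0 ltW.
rewrite square_sum_zbox; apply: le_trans (cabs_sum _ _ _) _.
apply: (@le_trans _ _ (\sum_(v <- zbox 1) 1)); first by apply: ler_sum => v _; exact: le1.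
by rewrite big_const_seq count_predT size_allpairs !size_iota iter_addr_0.
Qed.

(** The first argument bounds the sides of the rectangles in the shell of level [j], the second the
    frequencies produced by differencing, for a [C] depending on the forms. *)
Definition dyadic_T (C j : nat) x : R := Tsum (4 * 2 ^ j) (C * 2 ^ j) x.

Lemma forms_square_bound (T : seq (int * int * int)) s :
  (forall Q, Q \in T -> posdef Q) -> 0 < s <= 1 ->
  exists (K : R) (C : nat), [/\ 0 <= K, (0 < C)%N & forall (J : nat) x,
   cabs (\sum_(Q <- T) square_sum (2 ^ J) (form_term Q s x)) <=
   K * (1 + \sum_(j <- iota 0 J) ((4 ^ j)%:R `^ (- s)) * dyadic_T C j x)].
Proof.
move=> pT s01.
have /choice[k kP] : forall Q, exists K : R, Q \in T -> 0 <= K /\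
  forall (H L : nat) x, (0 < H)%N ->
  (2 * `|Q.1.1| + `|Q.1.2| + 2 * `|Q.2|) * (4 * H)%:Z < L%:Z ->
  cabs (square_sum (2 * H) (form_term Q s x) - square_sum H (form_term Q s x))
   <= K * (H%:R ^+ 2) `^ (- s) * Tsum (4 * H) L x.
  move=> Q; have [QT|] := boolP (Q \in T); last by exists 0.
  by have [K K0 HK] := form_shell_bound (pT _ QT) s01; exists K.
(* [w Q] is what the shell bound demands for [Q]; the sum plus one exceeds it for every form of [T]
   at once. *)
pose w Q : nat := absz (4 * (2 * `|Q.1.1| + `|Q.1.2| + 2 * `|Q.2|)).
pose C : nat := (\sum_(Q <- T) w Q).+1.
pose K : R := \sum_(Q <- T) (`|k Q| + 4).
have K0 : 0 <= K by apply: sumr_ge0 => Q _; rewrite addr_ge0.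
exists K, C; split=> // J x.
apply: le_trans (cabs_sum _ _ _) _.
rewrite /K big_distrl /= big_seq [leRHS]big_seq; apply: ler_sum => Q QT.
have [kQ0 HQ] := kP Q QT.
have term0 j : 0 <= ((4 ^ j)%:R `^ (- s)) * dyadic_T C j x.
  by rewrite mulr_ge0 ?powR_ge0// Tsum_ge0.
have S0 n : 0 <= \sum_(j <- iota 0 n) ((4 ^ j)%:R `^ (- s)) * dyadic_T C j x.
  by apply: sumr_ge0.
rewrite (ger0_norm kQ0).
elim: J => [|J IH].
  rewrite expn0 big_nil addr0 mulr1.
  apply: le_trans (form_unit_square x (pT _ QT) _) _; [by case/andP: s01|lra].
rewrite sum_iotaSr (addrA 1) (mulrDr (k Q + 4)) expnS.
rewrite -[square_sum _ _](subrK (square_sum (2 ^ J) (form_term Q s x))).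
apply: le_trans (cabsD _ _) _; rewrite [leRHS]addrC; apply: lerD => //.
apply: le_trans (HQ _ (C * 2 ^ J)%N _ _ _) _.
- by rewrite expn_gt0.
- have : (w Q <= \sum_(Q <- T) w Q)%N.
    by rewrite (big_rem Q QT) /= leq_addr.
  rewrite /C; set S := (\sum_(_ <- _) _)%N => wS.
  have -> : (2 * `|Q.1.1| + `|Q.1.2| + 2 * `|Q.2|) * (4 * 2 ^ J)%:Z = (w Q * 2 ^ J)%N%:Z.
    have wE : (w Q)%:Z = 4 * (2 * `|Q.1.1| + `|Q.1.2| + 2 * `|Q.2|).
      by apply: gez0_abs; rewrite mulr_ge0// !addr_ge0// mulr_ge0.
    by rewrite (PoszM (w Q)) wE PoszM; ring.
  by rewrite ltz_nat ltn_mul2r expn_gt0 /= ltnS.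
have -> : (2 ^ J)%:R ^+ 2 = (4 ^ J)%:R :> R by rewrite -natrX -expnM mulnC expnM.
by rewrite -[leLHS]mulrA; apply: ler_wpM2r; [exact: term0|lra].
Qed.
End DyadicSum.

(** * Major arcs *)

Section SpacedSums.
Variable R : realType.
Implicit Types (x y eta th : R).

(** Among n + 1 distinct naturals one is at least n; removing it gives the induction step. *)
Lemma sum_decreasing (h : nat -> R) (s : seq nat) n :
  (forall k, 0 <= h k) -> {homo h : i j / (i <= j)%N >-> j <= i} ->
  uniq s -> (size s <= n)%N -> \sum_(k <- s) h k <= \sum_(k <- iota 0 n) h k.
Proof.
move=> h0 hh us sn; apply: (@le_trans _ _ (\sum_(k <- iota 0 (size s)) h k)); last first.
  apply: ler_sum_sub; rewrite ?iota_uniq// => k; rewrite !mem_iota !add0n /=.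
  by move=> /leq_trans; apply.
clear n sn; have [n sn] : exists n, size s = n by eexists.
rewrite sn; elim: n s us sn => [|n IH] s us sn; first by rewrite (size0nil sn) big_nil.
have [m ms mmax] : exists2 m, m \in s & (n <= m)%N.
  apply: contrapT => H.
  have sub : {subset s <= iota 0 n}.
    move=> k ks; rewrite mem_iota add0n /= ltnNge; apply/negP => nk.
    by apply: H; exists k.
  by have := uniq_leq_size us sub; rewrite sn size_iota ltnn.
rewrite sum_iotaSr (big_rem m ms) /= addrC; apply: lerD; last exact: hh.
by apply: IH; [exact: rem_uniq|rewrite size_rem// sn].
Qed.

Lemma fr_sub (d : R) y z : `|fr (y - z)| <= `|fr y - fr z|.
Proof.
pose k := Num.floor (y + 2^-1) - Num.floor (z + 2^-1).
apply: le_trans (fr_le k (y - z)) _; rewrite /fr /k intrB.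
by rewrite [leRHS](_ : _ = `|y - z - ((Num.floor (y + 2^-1))%:~R - (Num.floor (z + 2^-1))%:~R)|)//; congr `|_|; ring.
Qed.

Lemma floor_eq_dist (a b : R) : Num.floor a = Num.floor b -> `|a - b| < 1.
Proof.
move=> E; have := floor_itv a; have := floor_itv b; rewrite E intrD.
move=> /andP[? ?] /andP[? ?]; rewrite ltr_norml; apply/andP; split; lra.
Qed.

(* By separation each cell [[k eta, (k+1) eta)] contains at most one of the points modulo [1]. *)
Lemma spaced_kern_sum (M n : nat) (A : int) x eta : 0 < eta ->
  (forall d : nat, (0 < d < n)%N -> eta <= `|fr (d%:R * x)|) ->
  \sum_(i <- iota 0 n) kern M ((A + i%:Z)%:~R * x) <=
  2 * \sum_(k <- iota 0 n) (M%:R / Num.max 1 (M%:R * (k%:R * eta))).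
Proof.
move=> eta0 sep.
pose h (k : nat) : R := M%:R / Num.max 1 (M%:R * (k%:R * eta)).
have max0 z : 0 < Num.max 1 z :> R by rewrite lt_max ltr01.
have h0 k : 0 <= h k by rewrite divr_ge0// ltW.
have hmono : {homo h : i j / (i <= j)%N >-> j <= i}.
  move=> i j ij; rewrite /h ler_wpM2l// lef_pV2 ?posrE// ge_max le_max lexx /=.
  by rewrite le_max; apply/orP; right; rewrite ler_wpM2l// ler_wpM2r ?ler_nat// ltW.
pose f (i : nat) := fr ((A + i%:Z)%:~R * x).
pose b (i : nat) := Num.floor (f i / eta).
have bwlog i j : (j < i)%N -> (i < n)%N -> b i != b j.
  move=> ji i_n; apply/eqP => /floor_eq_dist.
  rewrite -mulrBl normrM (gtr0_norm (x := eta^-1)) ?invr_gt0//.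
  rewrite ltr_pdivrMr// mul1r ltNge => /negP; apply.
  apply: le_trans (sep (i - j)%N _) _; first by rewrite subn_gt0 ji (leq_ltn_trans (leq_subr _ _)).
  have -> : (i - j)%:R * x = (A + i%:Z)%:~R * x - (A + j%:Z)%:~R * x.
    by rewrite natrB 1?ltnW// !intrD -!pmulrn; ring.
  exact: fr_sub.
have binj : {in iota 0 n &, injective b}.
  move=> i j; rewrite !mem_iota !add0n /= => i_n j_n E.
  by case: (ltngtP i j) => // ij; [have := bwlog _ _ ij j_n|have := bwlog _ _ ij i_n]; rewrite E eqxx.
(* Numbers the cells outwards from 0 on either side, so that the points of cell number k are at
   distance at least k eta from 0. The two signs account for the factor 2. *)
pose mag (z : int) : nat := match z with Posz k => k | Negz k => k end.
have kh i : kern M ((A + i%:Z)%:~R * x) <= h (mag (b i)).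
  rewrite /kern -/(f i) /h ler_wpM2l// lef_pV2 ?posrE// ge_max le_max lexx /=.
  rewrite le_max; apply/orP; right; rewrite ler_wpM2l//.
  have /andP[lo up] := floor_itv (f i / eta).
  rewrite ler_pdivlMr// in lo; rewrite ltr_pdivrMr// in up.
  move: lo up; rewrite -/(b i); case: (b i) => k /= lo up.
    by apply: le_trans (ler_norm _); rewrite pmulrn.
  rewrite -normrN; apply: le_trans (ler_norm _).
  have e : Negz k + 1 = - k%:Z by rewrite NegzE -addn1 PoszD opprD addrNK.
  by move: up; rewrite e mulrNz -pmulrn mulNr; lra.
apply: (@le_trans _ _ (\sum_(i <- iota 0 n) h (mag (b i)))); first by apply: ler_sum.
rewrite (bigID (fun i => 0 <= b i)) /= mulr_natl mulr2n; apply: lerD.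
  rewrite -big_filter -(big_map (fun i => mag (b i)) xpredT).
  apply: sum_decreasing => //.
    rewrite map_inj_in_uniq ?filter_uniq ?iota_uniq// => i j.
    rewrite !mem_filter => /andP[bi ii] /andP[bj ij] E; apply: binj => //.
    by move: bi bj E; case: (b i) => ?; case: (b j) => ? //= _ _ ->.
  by rewrite size_map size_filter (leq_trans (count_size _ _))// size_iota.
rewrite -big_filter -(big_map (fun i => mag (b i)) xpredT).
apply: sum_decreasing => //.
  rewrite map_inj_in_uniq ?filter_uniq ?iota_uniq// => i j.
  rewrite !mem_filter => /andP[bi ii] /andP[bj ij] E; apply: binj => //.
  by move: bi bj E; case: (b i) => ?; case: (b j) => ? //= _ _ ->.
by rewrite size_map size_filter (leq_trans (count_size _ _))// size_iota.
Qed.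

Lemma powR_step th (k : nat) : 0 < th < 1 -> (0 < k)%N ->
  k%:R `^ (th - 1) <= (k%:R `^ th - k.-1%:R `^ th) / th.
Proof.
move=> /andP[th0 th1]; rewrite ler_pdivlMr//; case: k => // -[|k] _ /=.
  by rewrite powR0 ?gt_eqF// subr0 !powR1 mul1r ltW.
have k0 : 0 < k.+1%:R :> R by rewrite ltr0n.
have kk : k.+1%:R <= k.+2%:R :> R by rewrite ler_nat.
have [|c] := @MVT_closed R (fun t => t `^ th) (fun t => th * t `^ (th - 1)) _ _ kk.
  by move=> t; rewrite in_itv /= => /andP[kt _]; apply: is_derive1_powR; exact: lt_le_trans kt.
rewrite in_itv /= => /andP[c1 c2] ->.
have -> : k.+2%:R - k.+1%:R = 1 :> R by rewrite -(natr1 k.+1); lra.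
rewrite mulr1 mulrC; apply: ler_wpM2l; first exact: ltW.
have -> : th - 1 = - (1 - th) by lra.
by apply: powRN_le => //; [lra|exact: lt_le_trans c1].
Qed.

Lemma sum_powR_le th (n : nat) : 0 < th < 1 ->
  \sum_(k <- iota 0 n) (if k == 0%N then 0 else k%:R `^ (th - 1)) <= n%:R `^ th / th.
Proof.
move=> hth; have /andP[th0 th1] := hth.
suff H m : \sum_(k <- iota 0 m.+1) (if k == 0%N then 0 else k%:R `^ (th - 1)) <= m%:R `^ th / th.
  case: n => [|n]; first by rewrite big_nil divr_ge0 ?powR_ge0// ltW.
  by apply: le_trans (H n) _; apply: ler_wpM2r; [rewrite invr_ge0 ltW|rewrite ge0_ler_powR ?nnegrE ?ler_nat// ltW].
elim: m => [|m IH]; first by rewrite big_seq1 eqxx divr_ge0 ?powR_ge0// ltW.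
rewrite (sum_iotaSr m.+1) /=; apply: le_trans (lerD IH (powR_step hth (ltn0Sn m))) _.
by rewrite /= -mulrDl addrC subrK.
Qed.

(** Interpolation: 1 / max(1, y) <= y^(th - 1) for y > 0. This replaces the logarithm of a harmonic
    sum by a power; the term k = 0 gives the separate [M]. *)
Lemma sum_min_le (M n : nat) eta th : 0 < th < 1 -> 0 < eta -> (0 < M)%N ->
  \sum_(k <- iota 0 n) (M%:R / Num.max 1 (M%:R * (k%:R * eta))) <=
  M%:R + M%:R `^ th * eta `^ (th - 1) * (n%:R `^ th / th).
Proof.
move=> hth eta0 M0; have /andP[th0 th1] := hth.
have Mr : 0 < M%:R :> R by rewrite ltr0n.
have c0 : 0 <= M%:R `^ th * eta `^ (th - 1) :> R by rewrite mulr_ge0// powR_ge0.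
apply: (@le_trans _ _ (\sum_(k <- iota 0 n) ((if k == 0%N then M%:R else 0) +
    M%:R `^ th * eta `^ (th - 1) * (if k == 0%N then 0 else k%:R `^ (th - 1))))).
  apply: ler_sum => -[|k] _ /=.
    by rewrite mul0r mulr0 max_l// divr1 mulr0 addr0.
  rewrite add0r.
  set y := M%:R * (k.+1%:R * eta).
  have y0 : 0 < y by rewrite !mulr_gt0.
  have -> : M%:R `^ th * eta `^ (th - 1) * k.+1%:R `^ (th - 1) = M%:R * y `^ (th - 1).
    rewrite /y !powRM ?mulr_ge0 ?(ltW eta0)// mulrA mulr_powRB1//.
    by rewrite -!mulrA; congr (_ * _); rewrite mulrC.
  rewrite ler_wpM2l//; have [y1|y1] := leP y 1.
    rewrite invr1 -[leLHS](powRr0 y); apply: ger_powR; [by rewrite y0|lra].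
  by rewrite -powR_inv1 ?(ltW y0)//; apply: ler_powR; [exact: ltW|lra].
rewrite big_split /= -big_distrr /=; apply: lerD; last by rewrite ler_wpM2l// sum_powR_le.
rewrite -big_mkcond /=; case: n => [|n]; first by rewrite big_nil.
rewrite /= big_cons eqxx /= big_seq_cond big1 ?addr0// => i.
by rewrite mem_iota => /andP[/andP[i0 _]]; rewrite gtn_eqF.
Qed.

Lemma dirichlet (K : nat) x : (0 < K)%N ->
  exists2 q : nat, (0 < q <= K)%N & `|fr (q%:R * x)| <= K%:R^-1.
Proof.
move=> K0; have Kr : 0 < K%:R :> R by rewrite ltr0n.
pose b (i : nat) := Num.floor ((fr (i%:R * x) + 2^-1) * K%:R).
have bK i : 0 <= b i < K%:Z.
  have /andP[lo up] := fr_itv (i%:R * x).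
  rewrite /b floor_ge_int floor_lt_int; apply/andP; split.
    by rewrite mulr_ge0//; lra.
  by rewrite -pmulrn -[ltRHS]mul1r ltr_pM2r//; lra.
have blt (i : 'I_K.+1) : (absz (b i) < K)%N by have := bK i; lia.
have /injectivePn[i [j ij fij]] : ~~ injectiveb (fun i => Ordinal (blt i)).
  by apply/negP => /injectiveP/leq_card; rewrite !card_ord ltnn.
have bij : b i = b j.
  by move: fij => /(congr1 val) /=; have := bK i; have := bK j; lia.
have close : `|fr (i%:R * x) - fr (j%:R * x)| <= K%:R^-1.
  have := floor_eq_dist bij; rewrite -mulrBl normrM (gtr0_norm Kr) => h.
  rewrite -(ler_pM2r Kr) mulVf ?gt_eqF// ltW//.
  by move: h; congr (`|_| * _ < _); ring.
have key (u v : nat) : (u < v)%N -> (v <= K)%N -> `|fr (v%:R * x) - fr (u%:R * x)| <= K%:R^-1 ->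
    exists2 q : nat, (0 < q <= K)%N & `|fr (q%:R * x)| <= K%:R^-1.
  move=> uv vK H; exists (v - u)%N; first by rewrite subn_gt0 uv (leq_trans (leq_subr _ _)).
  by apply: le_trans H; rewrite natrB 1?ltnW// mulrBl; exact: fr_sub.
case: (ltngtP i j) => h; last by move: ij; rewrite (ord_inj h) eqxx.
  by apply: (key i j h); [rewrite -ltnS|rewrite distrC].
by apply: (key j i h); [rewrite -ltnS|].
Qed.
End SpacedSums.

(** * Bounding T_j away from the major arcs *)

Section MajorArcs.
Variable R : realType.
Implicit Types (x eta th U : R).

Lemma sum_windows (F : nat -> R) (N q : nat) : (0 < q)%N -> (forall i, 0 <= F i) ->
  \sum_(i <- iota 0 N) F i <=
  \sum_(w <- iota 0 (N %/ q).+1) \sum_(t <- iota 0 q) F (w * q + t)%N.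
Proof.
move=> q0 F0.
have E c : \sum_(w <- iota 0 c) \sum_(t <- iota 0 q) F (w * q + t)%N =
    \sum_(i <- iota 0 (c * q)) F i.
  elim: c => [|c IH]; first by rewrite mul0n !big_nil.
  have -> : (c.+1 * q = c * q + q)%N by rewrite mulSn addnC.
  rewrite sum_iotaSr IH iotaD big_cat add0n; congr (_ + _).
  by rewrite -[in RHS](addn0 (c * q)%N) iotaDl big_map.
rewrite E; apply: ler_sum_sub; rewrite ?iota_uniq// => i; rewrite !mem_iota !add0n /=.
by move=> iN; apply: (leq_trans iN); rewrite ltnW// -ltn_divLR.
Qed.

Lemma spaced_kern_bound (M n : nat) (A : int) x eta th : 0 < th < 1 -> 0 < eta -> (0 < M)%N ->
  (forall d : nat, (0 < d < n)%N -> eta <= `|fr (d%:R * x)|) ->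
  \sum_(i <- iota 0 n) kern M ((A + i%:Z)%:~R * x) <=
  2 * (M%:R + M%:R `^ th * eta `^ (th - 1) * (n%:R `^ th / th)).
Proof.
move=> hth eta0 M0 sep; apply: le_trans (spaced_kern_sum M A eta0 sep) _.
by rewrite ler_pM2l//; exact: sum_min_le.
Qed.

(* If [d x] were closer to the integers than [q x], the nearest integers [a], [b] of [q x], [d x] would satisfy [|q b - d a| < 1], hence [q b = d a]. *)
Lemma first_approximation (N q d : nat) x : (0 < q)%N ->
  `|fr (q%:R * x)| <= (2 * N%:R)^-1 ->
  (forall e : nat, (0 < e < q)%N -> (2 * N%:R)^-1 < `|fr (e%:R * x)|) ->
  (0 < d < N)%N -> `|fr (q%:R * x)| <= `|fr (d%:R * x)|.
Proof.
move=> q0 hq qmin /andP[d0 dN].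
have [dq|qd] := ltnP d q.
  by apply: le_trans hq _; apply/ltW/qmin; rewrite d0 dq.
rewrite leNgt; apply/negP => lt.
have N0 : 0 < N%:R :> R by rewrite ltr0n (leq_ltn_trans _ dN).
have dr : 0 < d%:R :> R by rewrite ltr0n.
have qr : 0 < q%:R :> R by rewrite ltr0n.
have qdr : q%:R <= d%:R :> R by rewrite ler_nat.
have dNr : d%:R < N%:R :> R by rewrite ltr_nat.
pose a := Num.floor (q%:R * x + 2^-1); pose b := Num.floor (d%:R * x + 2^-1).
have fq : fr (q%:R * x) = q%:R * x - a%:~R by [].
have fd : fr (d%:R * x) = d%:R * x - b%:~R by [].
have E : ((q%:Z * b - d%:Z * a)%:~R : R) = d%:R * fr (q%:R * x) - q%:R * fr (d%:R * x).
  by rewrite fq fd intrB !intrM -!pmulrn; ring.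
have B0 := normr_ge0 (fr (q%:R * x)).
have hN : `|fr (q%:R * x)| * (2 * N%:R) <= 1.
  by rewrite -ler_pdivlMr ?mulr_gt0// mul1r.
have small : `|(q%:Z * b - d%:Z * a)%:~R : R| < 1.
  rewrite E; apply: le_lt_trans (ler_normB _ _) _.
  rewrite !normrM (gtr0_norm dr) (gtr0_norm qr).
  have h1 : q%:R * `|fr (d%:R * x)| < q%:R * `|fr (q%:R * x)| by rewrite ltr_pM2l.
  have h2 : q%:R * `|fr (q%:R * x)| <= d%:R * `|fr (q%:R * x)| by rewrite ler_wpM2r.
  have h3 : d%:R * `|fr (q%:R * x)| <= N%:R * `|fr (q%:R * x)| by rewrite ler_wpM2r// ltW.
  lra.
have z : q%:Z * b - d%:Z * a = 0.
  by move: small; rewrite -intr_norm (_ : 1 = 1%:~R)// ltr_int; move: (_ - _) => z; lia.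
have E2 : d%:R * fr (q%:R * x) = q%:R * fr (d%:R * x).
  by apply/eqP; rewrite -subr_eq0 -E z.
have : d%:R * `|fr (q%:R * x)| = q%:R * `|fr (d%:R * x)|.
  by rewrite -{1}(gtr0_norm dr) -normrM E2 normrM (gtr0_norm qr).
have h1 : q%:R * `|fr (d%:R * x)| < q%:R * `|fr (q%:R * x)| by rewrite ltr_pM2l.
have h2 : q%:R * `|fr (q%:R * x)| <= d%:R * `|fr (q%:R * x)| by rewrite ler_wpM2r.
lra.
Qed.

Lemma powR_mul_compl th (a b Z : R) : 0 < th < 1 -> 0 <= a <= Z -> 0 <= b <= Z ->
  a `^ th * b `^ (1 - th) <= Z.
Proof.
move=> /andP[t0 t1] /andP[a0 aZ] /andP[b0 bZ].
have Z0 : 0 <= Z := le_trans a0 aZ.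
have -> : Z = Z `^ th * Z `^ (1 - th) :> R.
  rewrite -powRD ?subrK; last by apply/implyP; lra.
  by rewrite (_ : th + (1 - th) = 1) ?powRr1//; lra.
by apply: ler_pM; rewrite ?powR_ge0// ge0_ler_powR ?nnegrE//; lra.
Qed.

(** Let [q] be the first good denominator at precision 1 / (2 N). If q > U, there are about N / q
    windows of length q, each costing about N q^th, in total N^2 q^(th - 1). If q <= U, the
    hypothesis bounds the distance of q x from below, and this distance separates all the
    multiples. *)
Lemma dyadic_T_bound th (C : nat) : 0 < th < 1 -> (0 < C)%N ->
  exists2 K : R, 0 <= K & forall (j : nat) U x, 0 < U ->
    (forall q : nat, (0 < q)%N -> q%:R <= U -> U / (4 ^ j)%:R < `|fr (q%:R * x)|) ->
    dyadic_T C j x <= K * (4 ^ j)%:R * U `^ (th - 1).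
Proof.
move=> hth C0; have /andP[th0 th1] := hth.
have Cr : 1 <= C%:R :> R by rewrite ler1n.
have ith : 1 <= th^-1 by rewrite invf_ge1// ltW.
(* A generous constant: the case q > U needs 96 and the other one 24. *)
pose K : R := 200 * C%:R ^+ 2 * th^-1.
have K0 : 0 <= K by rewrite /K; apply: mulr_ge0; [apply: mulr_ge0|lra]; rewrite ?exprn_ge0.
exists K => // j U x U0 Hx.
pose H : nat := (2 ^ j)%N; pose M := (4 * H)%N; pose N := (C * H + C * H)%N.
have H0 : (0 < H)%N by rewrite expn_gt0.
have Hr : 1 <= H%:R :> R by rewrite ler1n.
have H4 : (4 ^ j)%:R = H%:R ^+ 2 :> R by rewrite -natrX -expnM mulnC expnM.
have M0 : (0 < M)%N by rewrite muln_gt0.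
have N0 : (0 < N)%N by rewrite addn_gt0 muln_gt0 C0 H0.
have ME : M%:R = 4 * H%:R :> R by rewrite natrM.
have NE : N%:R = 2 * C%:R * H%:R :> R by rewrite natrD natrM; ring.
have Nr : 0 < N%:R :> R by rewrite ltr0n.
have TE : dyadic_T C j x = \sum_(i <- iota 0 N) kern M ((- (C * H)%N%:Z + i%:Z)%:~R * x).
  by apply: eq_bigr => i _; rewrite addrC.
pose P q := (0 < q)%N && (`|fr (q%:R * x)| <= (2 * N%:R)^-1).
have [q0 Pq0 q0N] : exists2 q, P q & (q <= 2 * N)%N.
  have [|q /andP[q0 qN] hq] := @dirichlet R (2 * N)%N x; first by rewrite muln_gt0.
  by exists q => //; rewrite /P q0 /=; rewrite natrM in hq.
have exP : exists q, P q by exists q0.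
case: (ex_minnP exP) => q /andP[q_gt0 hq] qmin.
have qN : (q <= 2 * N)%N := leq_trans (qmin _ Pq0) q0N.
have qmin' e : (0 < e < q)%N -> (2 * N%:R)^-1 < `|fr (e%:R * x)|.
  move=> /andP[e0 eq]; rewrite ltNge; apply/negP => h.
  by have := qmin e; rewrite /P e0 h => /(_ isT); rewrite leqNgt eq.
have qr : 1 <= q%:R :> R by rewrite ler1n.
have qr0 : 0 < q%:R :> R by rewrite ltr0n.
have th1' : th - 1 = - (1 - th) by lra.
have H2 : H%:R <= H%:R ^+ 2 :> R by rewrite expr2 ler_peMl//; lra.
have [Uq|qU] := ltrP U q%:R.
  (* Only multiples at distance less than [q] are known to be [1 / (2 N)]-separated: sum over windows of length [q]. *)
  have eta0 : 0 < (2 * N%:R)^-1 :> R by rewrite invr_gt0 mulr_gt0.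
  have win w : \sum_(t <- iota 0 q) kern M ((- (C * H)%N%:Z + (w * q + t)%N%:Z)%:~R * x) <=
      2 * (M%:R + M%:R `^ th * (2 * N%:R)^-1 `^ (th - 1) * (q%:R `^ th / th)).
    rewrite (eq_bigr (fun t => kern M ((- (C * H)%N%:Z + (w * q)%N%:Z + t%:Z)%:~R * x))).
      by apply: spaced_kern_bound => // d /qmin' /ltW.
    by move=> t _; rewrite PoszD addrA.
  rewrite TE; apply: le_trans (sum_windows N q_gt0 (fun i => kern_ge0 M _)) _.
  apply: le_trans (ler_sum _ (fun w _ => win w)) _.
  rewrite big_const_seq count_predT size_iota iter_addr_0 -[leLHS]mulr_natl.
  (* Since q <= 2 N, the additional incomplete window is absorbed. *)
  have cE : (N %/ q).+1%:R <= 3 * N%:R / q%:R :> R.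
    rewrite ler_pdivlMr// -natr1 mulrDl mul1r.
    have a1 : (N %/ q)%:R * q%:R <= N%:R :> R by rewrite -natrM ler_nat leq_trunc_div.
    have a2 : q%:R <= 2 * N%:R :> R by rewrite -natrM ler_nat.
    lra.
  have e1 : (2 * N%:R)^-1 `^ (th - 1) = (2 * N%:R) `^ (1 - th) :> R.
    by rewrite -powR_inv1 ?mulr_ge0// -powRrM; congr powR; lra.
  have pc : M%:R `^ th * (2 * N%:R) `^ (1 - th) <= 4 * C%:R * H%:R.
    apply: powR_mul_compl => //; rewrite ?ME ?NE; nra.
  have qth1 : 1 <= q%:R `^ th by rewrite -[leLHS](powRr0 q%:R) ler_powR// ltW.
  have qq : q%:R `^ th / q%:R <= U `^ (th - 1).
    have -> : q%:R `^ th / q%:R = q%:R `^ (th - 1).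
      by rewrite powRB ?(gt_eqF qr0) ?implybT// powRr1// ltW.
    by rewrite th1'; apply: powRN_le => //; [lra|exact: ltW].
  rewrite e1.
  have b1 : M%:R + M%:R `^ th * (2 * N%:R) `^ (1 - th) * (q%:R `^ th / th) <=
      8 * C%:R * H%:R * (q%:R `^ th / th).
    have i1 : 1 <= q%:R `^ th / th by rewrite -[leLHS]mulr1 ler_pM.
    have i2 : M%:R `^ th * (2 * N%:R) `^ (1 - th) * (q%:R `^ th / th) <= 4 * C%:R * H%:R * (q%:R `^ th / th).
      by apply: ler_wpM2r => //; lra.
    have i3 : M%:R <= 4 * C%:R * H%:R * (q%:R `^ th / th).
      rewrite ME; apply: (@le_trans _ _ (4 * C%:R * H%:R * 1)); first nra.
      by apply: ler_wpM2l => //; nra.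
    lra.
  apply: (@le_trans _ _ (3 * N%:R / q%:R * (2 * (8 * C%:R * H%:R * (q%:R `^ th / th))))).
    apply: ler_pM => //.
      by rewrite mulr_ge0// addr_ge0// mulr_ge0 ?mulr_ge0 ?powR_ge0 ?invr_ge0 ?(ltW th0).
    by rewrite ler_pM2l.
  have -> : 3 * N%:R / q%:R * (2 * (8 * C%:R * H%:R * (q%:R `^ th / th))) =
     96 * C%:R ^+ 2 * th^-1 * H%:R ^+ 2 * (q%:R `^ th / q%:R).
    by rewrite NE; field; rewrite !gt_eqF.
  have it0 : 0 <= th^-1 by lra.
  have H2' : 0 <= H%:R ^+ 2 :> R by exact: exprn_ge0.
  have C2' : 0 <= C%:R ^+ 2 :> R by exact: exprn_ge0.
  rewrite H4; apply: ler_pM; last exact: qq.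
  - by apply: mulr_ge0 => //; apply: mulr_ge0 => //; apply: mulr_ge0.
  - by apply: mulr_ge0; rewrite ?powR_ge0 ?invr_ge0.
  apply: ler_wpM2r => //; rewrite /K; apply: ler_wpM2r => //.
  by apply: ler_wpM2r => //; rewrite ler_nat.
(* Here all the multiples are separated by [|fr (q x)|]. *)
have be := Hx q q_gt0 qU; set beta := `|fr (q%:R * x)| in be hq.
have H20 : 0 < H%:R ^+ 2 :> R by rewrite exprn_gt0//; lra.
have beta0 : 0 < beta by apply: lt_trans be; rewrite divr_gt0// H4.
have sep d : (0 < d < N)%N -> beta <= `|fr (d%:R * x)| by exact: first_approximation.
rewrite TE; apply: le_trans (spaced_kern_bound _ hth beta0 M0 sep) _.
rewrite H4 in be *.
(* U / H^2 < beta <= 1 / (2 N), where N is at least 2 H. This inequality is what lets the term [M]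
   be absorbed below. *)
have UH : U <= H%:R.
  have h1 : beta * (2 * N%:R) <= 1 by rewrite -ler_pdivlMr ?mulr_gt0// mul1r.
  have h2 : U < beta * H%:R ^+ 2 by rewrite -ltr_pdivrMr.
  rewrite NE in h1.
  have h3 : beta * H%:R <= 1.
    apply: le_trans h1; apply: ler_wpM2l; first exact: ltW.
    nra.
  rewrite expr2 mulrA in h2.
  have h4 : beta * H%:R * H%:R <= 1 * H%:R by apply: ler_wpM2r => //; lra.
  lra.
have Ub : beta `^ (th - 1) <= U `^ (th - 1) * (H%:R ^+ 2) `^ (1 - th).
  have -> : U `^ (th - 1) * (H%:R ^+ 2) `^ (1 - th) = (U / H%:R ^+ 2) `^ (th - 1).
    rewrite powRM ?invr_ge0 ?ltW//; congr (_ * _).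
    by rewrite -powR_inv1 ?ltW// -powRrM; congr powR; lra.
  by rewrite th1'; apply: powRN_le; [lra|rewrite divr_gt0|exact: ltW].
have MN : M%:R `^ th * N%:R `^ th <= 8 * C%:R ^+ 2 * (H%:R ^+ 2) `^ th.
  rewrite -powRM//.
  have -> : M%:R * N%:R = 8 * C%:R * H%:R ^+ 2 :> R by rewrite ME NE; ring.
  rewrite powRM ?mulr_ge0 ?exprn_ge0//; apply: ler_wpM2r; first exact: powR_ge0.
  apply: le_trans (ler1_powR _ (ltW th1)) _; nra.
have pH : (H%:R ^+ 2) `^ th * (H%:R ^+ 2) `^ (1 - th) = H%:R ^+ 2 :> R.
  rewrite -powRD; last by rewrite (gt_eqF H20) implybT.
  by rewrite (_ : th + (1 - th) = 1) ?powRr1 ?ltW//; lra.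
have up0 : 0 <= U `^ (th - 1) by exact: powR_ge0.
have t1 : M%:R `^ th * beta `^ (th - 1) * (N%:R `^ th / th) <=
    8 * C%:R ^+ 2 * th^-1 * H%:R ^+ 2 * U `^ (th - 1).
  have -> : M%:R `^ th * beta `^ (th - 1) * (N%:R `^ th / th) =
    (M%:R `^ th * N%:R `^ th) * beta `^ (th - 1) * th^-1 by ring.
  have -> : 8 * C%:R ^+ 2 * th^-1 * H%:R ^+ 2 * U `^ (th - 1) =
     (8 * C%:R ^+ 2 * (H%:R ^+ 2) `^ th) * (U `^ (th - 1) * (H%:R ^+ 2) `^ (1 - th)) * th^-1.
    by rewrite -[in LHS]pH; ring.
  apply: ler_wpM2r; first lra.
  by apply: ler_pM => //; rewrite ?mulr_ge0 ?powR_ge0.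
have t2 : M%:R <= 4 * H%:R ^+ 2 * U `^ (th - 1).
  rewrite ME -mulrA; apply: ler_wpM2l => //.
  apply: (@le_trans _ _ (H%:R ^+ 2 * H%:R `^ (-1))).
    rewrite powR_inv1 ?expr2 ?mulfK// ?gt_eqF//; lra.
  apply: ler_wpM2l; first exact: ltW.
  apply: (@le_trans _ _ (H%:R `^ (th - 1))); first by apply: ler_powR => //; lra.
  by rewrite th1'; apply: powRN_le => //; lra.
have C2 : 1 <= C%:R ^+ 2 * th^-1 :> R by rewrite -[leLHS]mulr1 ler_pM// exprn_ege1.
have HU : 0 <= H%:R ^+ 2 * U `^ (th - 1) by rewrite mulr_ge0// ltW.
apply: (@le_trans _ _ (2 * (4 * (H%:R ^+ 2 * U `^ (th - 1)) + 8 * (C%:R ^+ 2 * th^-1) * (H%:R ^+ 2 * U `^ (th - 1))))).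
  by rewrite ler_pM2l//; apply: lerD; rewrite ?mulrA// in t1 t2 *.
rewrite /K -(mulrA _ (H%:R ^+ 2)) -(mulrA 200).
move: C2 HU; move: (C%:R ^+ 2 * th^-1) (H%:R ^+ 2 * _) => c h; nra.
Qed.
End MajorArcs.

(** * Dyadic summation and the exceptional set *)

Section DyadicSummation.
Variable R : realType.
Implicit Types (x U b tau : R).

Let four_gt1 b : 0 < b -> 1 < 4%:R `^ b :> R.
Proof.
by move=> b0; rewrite -[ltLHS](powRr0 4%:R) /powR pnatr_eq0 /= ltr_expR ltr_pM2r ?ln_gt0// ltr1n.
Qed.

Let pow4S (j : nat) b : (4 ^ j.+1)%:R `^ b = 4%:R `^ b * (4 ^ j)%:R `^ b :> R.
Proof. by rewrite expnS natrM powRM. Qed.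

Let pow4_gt0 (j : nat) : 0 < (4 ^ j)%:R :> R.
Proof. by rewrite ltr0n expn_gt0. Qed.

Lemma dyadic_sum_below b : 0 < b -> exists2 C : R, 0 <= C & forall tau (J : nat), 0 < tau ->
  \sum_(j <- iota 0 J) (if (4 ^ j)%:R <= tau then ((4 ^ j)%:R / tau) `^ b else 0) <= C.
Proof.
move=> b0; have w1 := four_gt1 b0; set w := 4%:R `^ b in w1.
exists (w / (w - 1)); first by rewrite divr_ge0//; lra.
move=> tau J tau0.
have tb : 0 < tau `^ b by rewrite powR_gt0.
(* A geometric sum is controlled by its next term; the minimum freezes the bound once 4^J has passed
   tau. *)
suff H : \sum_(j <- iota 0 J) (if (4 ^ j)%:R <= tau then (4 ^ j)%:R `^ b else 0) <=
    Num.min (4 ^ J)%:R (4 * tau) `^ b / (w - 1).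
  have -> : \sum_(j <- iota 0 J) (if (4 ^ j)%:R <= tau then ((4 ^ j)%:R / tau) `^ b else 0) =
    (\sum_(j <- iota 0 J) (if (4 ^ j)%:R <= tau then (4 ^ j)%:R `^ b else 0)) / tau `^ b.
    rewrite big_distrl /=; apply: eq_bigr => j _; case: ifP => _; last by rewrite mul0r.
    rewrite powRM ?invr_ge0 ?(ltW tau0)//; congr (_ * _).
    by rewrite -powR_inv1 ?(ltW tau0)// -powRrM mulN1r powRN.
  rewrite ler_pdivrMr//; apply: le_trans H _.
  rewrite mulrAC; apply: ler_wpM2r; first by rewrite invr_ge0; lra.
  rewrite /w -powRM ?(ltW tau0)//; apply: ge0_ler_powR; rewrite ?nnegrE ?(ltW b0)//.
  - by rewrite le_min mulr_ge0 ?(ltW tau0)// ltW.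
  - by rewrite mulr_ge0// ltW.
  - by rewrite ge_min lexx orbT.
elim: J => [|J IH].
  by rewrite big_nil divr_ge0 ?powR_ge0//; lra.
rewrite sum_iotaSr; case: ifP => h; last first.
  rewrite addr0; apply: le_trans IH _; apply: ler_wpM2r; first by rewrite invr_ge0; lra.
  apply: ge0_ler_powR; rewrite ?nnegrE ?(ltW b0)// ?le_min ?mulr_ge0 ?(ltW tau0) ?(ltW (pow4_gt0 _))//.
  by rewrite !ge_min lexx orbT andbT ler_nat leq_exp2l ?leqnSn.
have e1 : Num.min (4 ^ J)%:R (4 * tau) = (4 ^ J)%:R :> R by rewrite min_l//; lra.
have e2 : Num.min (4 ^ J.+1)%:R (4 * tau) = (4 ^ J.+1)%:R :> R.
  by rewrite min_l// expnS natrM ler_pM2l.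
rewrite e1 in IH; rewrite e2 pow4S -/w; apply: le_trans (lerD IH (lexx _)) _.
rewrite le_eqVlt; apply/orP; left; apply/eqP; field; lra.
Qed.

Lemma dyadic_sum_above b : 0 < b -> exists2 C : R, 0 <= C & forall tau (J : nat), 0 < tau ->
  \sum_(j <- iota 0 J) (if tau < (4 ^ j)%:R then ((4 ^ j)%:R / tau) `^ (- b) else 0) <= C.
Proof.
move=> b0; have w1 := four_gt1 b0; set w := 4%:R `^ b in w1.
have wE : 4%:R `^ (- b) = w^-1 :> R by rewrite powRN.
have w0 : 0 < 1 - w^-1 by rewrite subr_gt0 invf_lt1//; lra.
exists (1 - w^-1)^-1; first by rewrite invr_ge0 ltW.
move=> tau J tau0.
have tb : 0 < tau `^ (- b) by rewrite powR_gt0.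
(* Generalised over the starting level, since a decreasing geometric sum is controlled by its first
   term. *)
suff H i : \sum_(j <- iota i J) (if tau < (4 ^ j)%:R then (4 ^ j)%:R `^ (- b) else 0) <=
    Num.max (4 ^ i)%:R tau `^ (- b) / (1 - w^-1).
  have -> : \sum_(j <- iota 0 J) (if tau < (4 ^ j)%:R then ((4 ^ j)%:R / tau) `^ (- b) else 0) =
    (\sum_(j <- iota 0 J) (if tau < (4 ^ j)%:R then (4 ^ j)%:R `^ (- b) else 0)) / tau `^ (- b).
    rewrite big_distrl /=; apply: eq_bigr => j _; case: ifP => _; last by rewrite mul0r.
    rewrite powRM ?invr_ge0 ?(ltW tau0)//; congr (_ * _).
    by rewrite -powR_inv1 ?(ltW tau0)// -powRrM mulN1r [in LHS]powRN.
  rewrite ler_pdivrMr// mulrC; apply: le_trans (H 0%N) _.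
  apply: ler_wpM2r; first by rewrite invr_ge0 ltW.
  by apply: powRN_le; [exact: ltW| |rewrite le_max lexx orbT].
elim: J i => [|J IH] i; first by rewrite big_nil divr_ge0 ?powR_ge0 ?(ltW w0).
rewrite /= big_cons.
have m0 k : 0 < Num.max (4 ^ k)%:R tau by rewrite lt_max tau0 orbT.
case: ifP => h.
  apply: le_trans (lerD (lexx _) (IH i.+1)) _.
  have e1 : Num.max (4 ^ i)%:R tau = (4 ^ i)%:R :> R by rewrite max_l// ltW.
  have e2 : Num.max (4 ^ i.+1)%:R tau = (4 ^ i.+1)%:R :> R.
    rewrite max_l// (le_trans (ltW h))// ler_nat leq_exp2l//.
  rewrite e1 e2 pow4S wE.
  rewrite le_eqVlt; apply/orP; left; apply/eqP; field.
  by apply/andP; split; lra.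
rewrite add0r; apply: le_trans (IH i.+1) _; apply: ler_wpM2r; first by rewrite invr_ge0 ltW.
apply: powRN_le; [exact: ltW|exact: m0|].
by rewrite ge_max !le_max lexx orbT andbT ler_nat leq_exp2l ?leqnSn.
Qed.

(* [tau = alpha `^ (1 - s)^-1] is the scale at which the trivial bound equals [alpha]; below it no arc is removed, above it the arcs of level [(4 ^ j / tau) `^ rho]. *)
Lemma dyadic_good_bound (s rho : R) (C : nat) : 1 - s < rho -> rho < 1 -> 0 < 1 - s -> (0 < C)%N ->
  exists2 K : R, 0 <= K & forall (J : nat) tau x, 0 < tau ->
   (forall (j q : nat), (j < J)%N -> tau < (4 ^ j)%:R -> (0 < q)%N ->
      q%:R <= ((4 ^ j)%:R / tau) `^ rho ->
      ((4 ^ j)%:R / tau) `^ rho / (4 ^ j)%:R < `|fr (q%:R * x)|) ->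
   \sum_(j <- iota 0 J) ((4 ^ j)%:R `^ (- s)) * dyadic_T C j x <= K * tau `^ (1 - s).
Proof.
set sg := 1 - s => sr r1 sg0 C0.
have rho0 : 0 < rho by lra.
(* Makes [rho * kap] the midpoint of [sg] and [rho]: above [sg], so that the levels beyond tau
   decay, and with [kap] still below 1. *)
pose kap := (sg + rho) / (2 * rho).
have rk : rho * kap = (sg + rho) / 2 by rewrite /kap; field; lra.
have kap0 : 0 < kap by rewrite divr_gt0//; lra.
have kap1 : kap < 1 by rewrite ltr_pdivrMr; lra.
have hth : 0 < 1 - kap < 1 by apply/andP; split; lra.
have [K K0 HK] := @dyadic_T_bound R (1 - kap) C hth C0.
have [C1 C10 HC1] := @dyadic_sum_below sg sg0.
have dl0 : 0 < rho * kap - sg by rewrite rk; lra.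
have [C2 C20 HC2] := @dyadic_sum_above _ dl0.
have p2 : 0 <= (2^-1 : R) `^ (- kap) by exact: powR_ge0.
exists (K * (2^-1 `^ (- kap) * C1 + C2)).
  by rewrite mulr_ge0// addr_ge0// mulr_ge0.
move=> J tau x tau0 Hx.
have ts0 : 0 <= tau `^ sg := powR_ge0 _ _.
have e1 : 1 - kap - 1 = - kap by lra.
have pw j : (4 ^ j)%:R `^ (- s) * (4 ^ j)%:R = tau `^ sg * ((4 ^ j)%:R / tau) `^ sg.
  rewrite -powRM ?divr_ge0 ?(ltW tau0)// mulrCA divff ?gt_eqF// mulr1.
  rewrite -[X in _ * X]powRr1 -?powRD ?(gt_eqF (pow4_gt0 j)) ?implybT//.
  by congr powR; rewrite /sg; lra.
apply: (@le_trans _ _ (\sum_(j <- iota 0 J) (K * tau `^ sg * (2^-1 `^ (- kap) *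
    (if (4 ^ j)%:R <= tau then ((4 ^ j)%:R / tau) `^ sg else 0) +
    (if tau < (4 ^ j)%:R then ((4 ^ j)%:R / tau) `^ (- (rho * kap - sg)) else 0))))); last first.
  rewrite -big_distrr /= big_split /= -big_distrr /= -mulrA (mulrC (tau `^ sg)) mulrA.
  apply: ler_wpM2r => //; apply: ler_wpM2l => //; apply: lerD; last exact: HC2.
  by apply: ler_wpM2l => //; exact: HC1.
rewrite big_seq [leRHS]big_seq; apply: ler_sum => j; rewrite mem_iota add0n => /= jJ.
have sp0 : 0 <= (4 ^ j)%:R `^ (- s) :> R := powR_ge0 _ _.
case: (leP (4 ^ j)%:R tau) => h.
  rewrite addr0.
  (* With U = 1/2 the arc condition is void, because every q is at least 1; this is the trivial
     bound. *)
  have T1 : dyadic_T C j x <= K * (4 ^ j)%:R * 2^-1 `^ (- kap).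
    rewrite -e1; apply: HK => // q q0 q2.
    have : 1 <= q%:R :> R by rewrite ler1n.
    lra.
  apply: le_trans (ler_wpM2l sp0 T1) _.
  rewrite le_eqVlt; apply/orP; left; apply/eqP.
  transitivity (K * 2^-1 `^ (- kap) * ((4 ^ j)%:R `^ (- s) * (4 ^ j)%:R)); first by ring.
  by rewrite pw; ring.
rewrite mulr0 add0r.
have y0 : 0 < (4 ^ j)%:R / tau by rewrite divr_gt0.
have T1 : dyadic_T C j x <= K * (4 ^ j)%:R * (((4 ^ j)%:R / tau) `^ rho) `^ (- kap).
  rewrite -e1; apply: HK => [|q q0 q2]; first exact: powR_gt0.
  exact: Hx.
apply: le_trans (ler_wpM2l sp0 T1) _.
rewrite le_eqVlt; apply/orP; left; apply/eqP.
transitivity (K * (((4 ^ j)%:R / tau) `^ rho) `^ (- kap) * ((4 ^ j)%:R `^ (- s) * (4 ^ j)%:R)); first by ring.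
have -> : (((4 ^ j)%:R / tau) `^ rho) `^ (- kap) = (((4 ^ j)%:R / tau) `^ (rho * kap))^-1.
  by rewrite -powRrM mulrN powRN.
by rewrite pw opprB (@powRB _ _ sg (rho * kap)) ?(gt_eqF y0) ?implybT//; ring.
Qed.
End DyadicSummation.

(** * Measure of the exceptional set *)

Section Arcs.
Variable R : realType.
Implicit Types (x U eta : R) (A : set R).
Local Notation mu := (@lebesgue_measure R).
Local Notation I01 := (`[0%R, 1%R]%classic : set R).

Lemma measure_interval_cover A (s : seq (R * R)) : measurable A ->
  (forall p, p \in s -> 0 <= p.2) ->
  A `<=` [set x | exists2 p, p \in s & `|x - p.1| <= p.2] ->
  (mu A <= (\sum_(p <- s) 2 * p.2)%:E)%E.
Proof.
move=> mA s0 sub.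
pose itv (p : R * R) : set R := `[(p.1 - p.2)%R, (p.1 + p.2)%R]%classic.
pose cov (t : seq (R * R)) : set R := foldr (fun p B => itv p `|` B) set0 t.
have mcov t : measurable (cov t).
  elim: t => [|p t IH] /=; first exact: measurable0.
  by apply: measurableU => //; exact: measurable_itv.
have covP t x : (exists2 p, p \in t & `|x - p.1| <= p.2) -> cov t x.
  elim: t => [[p]//|p t IH [p']]; rewrite inE => /orP[/eqP->|pt] H.
    by left; rewrite /itv /= in_itv /=; move: H; rewrite ler_norml => /andP[? ?]; apply/andP; split; lra.
  by right; apply: IH; exists p'.
apply: (@le_trans _ _ (mu (cov s))).
  apply: le_measure; rewrite ?inE//.
    exact: mcov.
  by move=> x Ax; apply: covP; exact: sub.
elim: s s0 {sub} => [|p s IH] s0; first by rewrite /= measure0 big_nil.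
rewrite /= big_cons EFinD.
apply: (@le_trans _ _ (mu (itv p) + mu (cov s))%E).
  by apply: measureU2; [exact: measurable_itv|exact: mcov].
apply: leeD; last by apply: IH => p' p's; apply: s0; rewrite inE p's orbT.
have p0 : 0 <= p.2 by apply: s0; rewrite inE eqxx.
rewrite /itv lebesgue_measure_itv /= lte_fin; case: ifP => _; last by rewrite lee_fin mulr_ge0.
by rewrite -EFinB lee_fin; lra.
Qed.

(** The numerators run from -1 to q + 1, the possible nearest integers to q x for x in [0, 1] at
    distance at most 1. *)
Definition arcs (q : nat) eta : seq (R * R) :=
  [seq ((a%:R - 1) / q%:R, eta / q%:R) | a <- iota 0 (q + 3)].

Lemma arcs_cover (q : nat) eta x : (0 < q)%N -> 0 <= x <= 1 -> eta <= 1 ->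
  `|fr (q%:R * x)| <= eta -> exists2 p, p \in arcs q eta & `|x - p.1| <= p.2.
Proof.
move=> q0 /andP[x0 x1] e1; rewrite /fr; set a := Num.floor _ => h.
have qr : 0 < q%:R :> R by rewrite ltr0n.
have qx0 : 0 <= q%:R * x by rewrite mulr_ge0// ltW.
have qx1 : q%:R * x <= q%:R by rewrite -[leRHS]mulr1 ler_wpM2l// ltW.
have /andP[h1 h2] : - eta <= q%:R * x - a%:~R <= eta by rewrite -ler_norml.
have a1 : -1 <= a.
  by rewrite -(ler_int R) intrN; lra.
have a2 : a <= q%:Z + 1.
  by rewrite -(ler_int R) intrD -pmulrn; lra.
exists (a%:~R / q%:R, eta / q%:R) => /=.
  apply/mapP; exists (absz (a + 1)).
    by rewrite mem_iota; lia.
  congr (_ / _, _).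
  have -> : (absz (a + 1))%:R = (a + 1)%:~R :> R by rewrite pmulrn gez0_abs//; lia.
  by rewrite intrD addrK.
rewrite -(ler_pM2r qr) divfK ?gt_eqF// -[X in _ * X](gtr0_norm qr) -normrM mulrBl divfK ?gt_eqF//.
by rewrite (mulrC x).
Qed.

Lemma arcs_length (q : nat) eta : (0 < q)%N -> 0 <= eta ->
  \sum_(p <- arcs q eta) 2 * p.2 <= 8 * eta.
Proof.
move=> q0 e0; have qr : 0 < q%:R :> R by rewrite ltr0n.
rewrite /arcs big_map /= big_const_seq count_predT size_iota iter_addr_0 -[leLHS]mulr_natr /=.
have -> : 8 * eta = 2 * (eta / q%:R) * (4 * q%:R) by field; rewrite gt_eqF.
apply: ler_wpM2l; first by rewrite mulr_ge0// divr_ge0// ltW.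
by rewrite -natrM ler_nat; lia.
Qed.

Lemma weak_type_of_dyadic (S : nat -> R -> R) (K s : R) (C : nat) :
  2^-1 < s -> s < 1 -> 0 <= K -> (0 < C)%N ->
  (forall J, measurable_fun I01 (S J)) ->
  (forall J x, S J x <= K * (1 + \sum_(j <- iota 0 J) ((4 ^ j)%:R `^ (- s)) * dyadic_T C j x)) ->
  exists2 c : R, 0 <= c & forall (J : nat) (alpha : R), 0 < alpha ->
    (mu [set x | I01 x /\ (alpha < S J x)%R] <= (c * alpha `^ (- (1 - s)^-1))%:E)%E.
Proof.
move=> s2 s1 K0 C0 mS HS; set sg := 1 - s.
have sg0 : 0 < sg by rewrite /sg; lra.
have sgh : sg < 2^-1 by rewrite /sg; lra.
(* The midpoint of 1 - s and 1/2. *)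
pose rho := (sg + 2^-1) / 2.
have [K1 K10 HK1] := @dyadic_good_bound R s rho C ltac:(rewrite -/sg /rho; lra) ltac:(rewrite /rho; lra) sg0 C0.
have b0 : 0 < 1 - 2 * rho by rewrite /rho; lra.
have [C2 C20 HC2] := @dyadic_sum_above R _ b0.
(* Off the arcs the sum is at most K (1 + K1) a; the added 1 makes this smaller than the threshold
   K' a. The scaling is undone at the end. *)
pose K' := K * (1 + K1) + 1.
have K'0 : 0 < K' by rewrite ltr_wpDl// mulr_ge0// addr_ge0.
have mset J a : measurable [set x | I01 x /\ a < S J x].
  have := mS J (measurable_itv _) _ (measurable_itv `]a, +oo[).
  rewrite (_ : I01 `&` _ = [set x | I01 x /\ a < S J x])//.
  by apply/seteqP; split => x /=; rewrite !in_itv /= andbT.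
have claim J a : 0 < a -> (mu [set x | I01 x /\ (K' * a < S J x)%R] <= ((1 + 8 * C2) * a `^ (- sg^-1))%:E)%E.
  move=> a0; pose tau := a `^ sg^-1.
  have tau0 : 0 < tau by rewrite powR_gt0.
  have tE : tau `^ sg = a by rewrite -powRrM mulVf ?gt_eqF// powRr1// ltW.
  have tN : a `^ (- sg^-1) = tau^-1 by rewrite powRN.
  (* For tau < 1 the claimed bound exceeds the measure of the whole interval. *)
  have [t1|t1] := ltP tau 1.
    apply: (@le_trans _ _ (mu I01)).
      apply: le_measure; rewrite ?inE; [exact: mset|exact: measurable_itv|by move=> x []].
    rewrite lebesgue_measure_itv /= lte_fin ltr01 -EFinB subr0 lee_fin tN.
    rewrite -[leLHS]mulr1; apply: ler_pM => //; first by rewrite lerDl mulr_ge0.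
    by rewrite invf_ge1// ltW.
  (* Absorbs the constant term of the bound on [S J], which comes from the unit square. *)
  have a1 : 1 <= a by rewrite -tE -[leLHS](powRr0 tau) ler_powR// ltW.
  pose y (j : nat) := (4 ^ j)%:R / tau.
  pose eta j := y j `^ rho / (4 ^ j)%:R.
  have p4 (j : nat) : 0 < (4 ^ j)%:R :> R by rewrite ltr0n expn_gt0.
  have y0 j : 0 < y j by rewrite divr_gt0.
  have eta0 j : 0 <= eta j by rewrite divr_ge0 ?powR_ge0// ltW.
  pose big := [seq j <- iota 0 J | tau < (4 ^ j)%:R].
  pose cov := flatten [seq flatten [seq arcs q (eta j) | q <- iota 1 (Num.truncn (y j `^ rho))] | j <- big].
  have covge p : p \in cov -> 0 <= p.2.
    move=> /flatten_mapP[j _ /flatten_mapP[q _ /mapP[i _ ->]]] /=.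
    by rewrite divr_ge0.
  apply: le_trans (measure_interval_cover (s := cov) _ covge _) _; first exact: mset.
    move=> x [I01x Sx].
    have x01 : 0 <= x <= 1 by move: I01x; rewrite /= in_itv.
    apply: contrapT => bad.
    have good (j q : nat) : (j < J)%N -> tau < (4 ^ j)%:R -> (0 < q)%N ->
       q%:R <= ((4 ^ j)%:R / tau) `^ rho ->
       ((4 ^ j)%:R / tau) `^ rho / (4 ^ j)%:R < `|fr (q%:R * x)|.
      move=> jJ tj q0 qU; rewrite ltNge; apply/negP => h; apply: bad.
      have e1 : eta j <= 1.
        rewrite ler_pdivrMr// mul1r; apply: (@le_trans _ _ (y j)).
          apply: ler1_powR; last by rewrite /rho; lra.
          by rewrite ler_pdivlMr// mul1r ltW.
        by rewrite ler_pdivrMr// ler_peMr// ltW.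
      have [p pin hp] := arcs_cover q0 x01 e1 h.
      exists p => //; apply/flatten_mapP; exists j.
        by rewrite mem_filter tj mem_iota.
      apply/flatten_mapP; exists q => //.
      by rewrite mem_iota q0 add1n ltnS truncn_ge_nat// powR_ge0.
    have := HK1 J tau x tau0 good; rewrite -/sg tE => HT.
    have := HS J x; rewrite leNgt => /negP; apply; apply: le_lt_trans Sx.
    apply: (@le_trans _ _ (K * (a + K1 * a))).
      by apply: ler_wpM2l => //; apply: lerD.
    by rewrite (_ : K' * a = K * (a + K1 * a) + a); [rewrite lerDl ltW|rewrite /K'; ring].
  rewrite lee_fin /cov big_flatten /= big_map.
  (* With U_j = (y j)^rho, at most U_j denominators cost 8 U_j / 4^j each, and U_j^2 / 4^j is (y
     j)^(2 rho - 1) / tau. *)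
  apply: (@le_trans _ _ (\sum_(j <- big) 8 / tau * y j `^ (- (1 - 2 * rho)))).
    apply: ler_sum => j _; rewrite big_flatten /= big_map.
    apply: (@le_trans _ _ (\sum_(q <- iota 1 (Num.truncn (y j `^ rho))) 8 * eta j)).
      rewrite big_seq [leRHS]big_seq; apply: ler_sum => q; rewrite mem_iota => /andP[q0 _].
      exact: arcs_length.
    rewrite big_const_seq count_predT size_iota iter_addr_0 -[leLHS]mulr_natr.
    apply: (@le_trans _ _ (8 * eta j * y j `^ rho)).
      apply: ler_wpM2l; first by rewrite mulr_ge0.
      by have /andP[] := truncn_itv (powR_ge0 (y j) rho).
    rewrite le_eqVlt; apply/orP; left; apply/eqP.
    have -> : y j `^ (- (1 - 2 * rho)) = y j `^ rho * y j `^ rho / y j.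
      rewrite -powRD ?(gt_eqF (y0 j)) ?implybT// -[X in _ / X]powRr1 ?(ltW (y0 j))//.
      rewrite -powRB ?(gt_eqF (y0 j)) ?implybT//; congr powR; lra.
    have yt : (4 ^ j)%:R = y j * tau by rewrite divfK// gt_eqF.
    rewrite /eta yt; move: (y j `^ rho) (y j) (y0 j) => Y z z0.
    by field; rewrite !gt_eqF.
  rewrite -big_distrr /= tN /big big_filter.
  have HC := HC2 tau J tau0; rewrite -big_mkcond /= in HC.
  apply: (@le_trans _ _ (8 / tau * C2)).
    by apply: ler_wpM2l => //; rewrite divr_ge0// ltW.
  rewrite (_ : (1 + 8 * C2) / tau = tau^-1 + 8 / tau * C2); last by ring.
  by rewrite lerDr invr_ge0 ltW.
exists ((1 + 8 * C2) * K'^-1 `^ (- sg^-1)).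
  by rewrite mulr_ge0 ?powR_ge0// addr_ge0// mulr_ge0.
move=> J a a0.
have := claim J (a / K') (divr_gt0 a0 K'0).
have -> : K' * (a / K') = a by rewrite mulrC divfK// gt_eqF.
have -> // : (1 + 8 * C2) * (a / K') `^ (- sg^-1) =
  (1 + 8 * C2) * K'^-1 `^ (- sg^-1) * a `^ (- sg^-1).
by rewrite powRM ?invr_ge0 ?(ltW a0) ?(ltW K'0)//; ring.
Qed.
End Arcs.

(** * Square means *)

Section Parseval.
Variable R : realType.
Implicit Types (x : R) (c : nat -> R).
Local Notation mu := (@lebesgue_measure R).
Local Notation I01 := (`[0%R, 1%R]%classic : set R).

Lemma continuous_cosM (w : R) : continuous (fun x => cos (w * x)).
Proof.
move=> x; apply: (@continuous_comp R R R (fun x => w * x) cos); last exact: continuous_cos.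
exact: mulrl_continuous.
Qed.

Lemma continuous_sinM (w : R) : continuous (fun x => sin (w * x)).
Proof.
move=> x; apply: (@continuous_comp R R R (fun x => w * x) sin); last exact: continuous_sin.
exact: mulrl_continuous.
Qed.

Lemma integral_cos_int (k : int) :
  (\int[mu]_(x in I01) (cos (2 * pi * k%:~R * x))%:E = (k == 0)%:R%:E)%E.
Proof.
have [->|k0] := eqVneq k 0.
  under eq_integral do rewrite mulr0 mul0r cos0.
  by rewrite integral_cst//= mul1e lebesgue_measure_itv /= lte_fin ltr01 -EFinB subr0.
pose w : R := 2 * pi * k%:~R.
have pi0 : pi != 0 :> R by rewrite gt_eqF ?pi_gt0.
have w0 : w != 0 by rewrite /w mulf_neq0 ?intr_eq0// mulf_neq0.
pose F (x : R) := sin (w * x) / w.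
have dF x : is_derive x 1 F (cos (w * x)).
  have -> : F = (w^-1 *: (fun y => sin (w * y))) by apply/funext => y; rewrite /F mulrC.
  have -> : cos (w * x) = w^-1 *: (cos (w * x) * w) by rewrite /GRing.scale /= mulrCA mulVf// mulr1.
  apply: is_deriveZ; apply: (@is_derive1_comp _ sin (fun y => w * y)).
  have -> : (fun y : R => w * y) = (w *: (@id R)) by apply/funext.
  by rewrite -[X in is_derive _ _ _ X]mulr1; exact: is_deriveZ.
have cF : continuous F.
  by move=> x; apply: differentiable_continuous; apply/derivable1_diffP; exact: (@ex_derive _ _ _ _ _ _ _ (dF x)).
rewrite (@continuous_FTC2 R (fun x => cos (w * x)) F 0 1 ltr01); first last.
- by move=> x _; rewrite derive1E; exact: (@derive_val _ _ _ _ _ _ _ (dF x)).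
- split.
  + by move=> x _; exact: (@ex_derive _ _ _ _ _ _ _ (dF x)).
  + by apply: cvg_at_right_filter; exact: cF.
  + by apply: cvg_at_left_filter; exact: cF.
- by apply: continuous_subspaceT; exact: continuous_cosM.
rewrite /F mulr0 mulr1 sin0 mul0r -EFinB subr0.
suff -> : sin w = 0 by rewrite mul0r.
have := expi_int R k; rewrite /expi -/w => /eqP; rewrite eq_complex /= => /andP[_ /eqP].
by [].
Qed.

(** For the coefficients [ideal_coef D s] these are [mpartial_re] and [mpartial_im] by definition,
    and [tsq] is the squared modulus of the partial sum. *)
Definition tcos c (N : nat) x := \sum_(1 <= n < N.+1) c n * cos (2 * pi * x * n%:R).
Definition tsin c (N : nat) x := \sum_(1 <= n < N.+1) - (c n * sin (2 * pi * x * n%:R)).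
Definition tsq c N x := tcos c N x ^+ 2 + tsin c N x ^+ 2.

Lemma tsqE c N x : tsq c N x = \sum_(1 <= n < N.+1) \sum_(1 <= m < N.+1)
  c n * c m * cos (2 * pi * (n%:Z - m%:Z)%:~R * x).
Proof.
rewrite /tsq /tcos /tsin sumrN sqrrN !expr2 !big_distrl -big_split /=.
apply: eq_bigr => n _; rewrite !big_distrr -big_split /=; apply: eq_bigr => m _.
have -> : 2 * pi * (n%:Z - m%:Z)%:~R * x = 2 * pi * x * n%:R - 2 * pi * x * m%:R.
  by rewrite intrB -!pmulrn; ring.
by rewrite cosB; ring.
Qed.

Lemma measurable_tcos (D : set R) c N : measurable_fun D (tcos c N).
Proof.
apply: (@measurable_funS _ _ _ _ setT) => //.
apply: measurable_sum => n; apply: measurable_funM; first exact: measurable_cst.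
under eq_fun do rewrite mulrAC.
by apply: continuous_measurable_fun; exact: continuous_cosM.
Qed.

Lemma measurable_tsin (D : set R) c N : measurable_fun D (tsin c N).
Proof.
apply: (@measurable_funS _ _ _ _ setT) => //.
apply: measurable_sum => n; apply: measurable_funN.
apply: measurable_funM; first exact: measurable_cst.
under eq_fun do rewrite mulrAC.
by apply: continuous_measurable_fun; exact: continuous_sinM.
Qed.

Lemma measurable_tsq (D : set R) c N : measurable_fun D (tsq c N).
Proof.
apply: measurable_funD; apply: measurable_funX; [exact: measurable_tcos|exact: measurable_tsin].
Qed.

Lemma tsq_ge0 c N x : 0 <= tsq c N x.
Proof. by rewrite addr_ge0 ?sqr_ge0. Qed.

Lemma tsq_bounded c N : exists B : R, forall x, Num.sqrt (tsq c N x) <= B.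
Proof.
pose A := \sum_(1 <= n < N.+1) `|c n|.
have h1 x : `|tcos c N x| <= A.
  apply: le_trans (ler_norm_sum _ _ _) _; apply: ler_sum => n _.
  by rewrite normrM ler_piMr// cos_max.
have h2 x : `|tsin c N x| <= A.
  apply: le_trans (ler_norm_sum _ _ _) _; apply: ler_sum => n _.
  by rewrite normrN normrM ler_piMr// sin_max.
exists (A + A) => x.
have A0 : 0 <= A := le_trans (normr_ge0 _) (h1 x).
rewrite -(@ler_pXn2r _ 2)// ?nnegrE ?sqrtr_ge0 ?addr_ge0// sqr_sqrtr ?tsq_ge0//.
rewrite /tsq -(real_normK (num_real (tcos c N x))) -(real_normK (num_real (tsin c N x))).
have le2 (p q : R) : 0 <= p -> 0 <= q -> p <= A -> q <= A -> p ^+ 2 + q ^+ 2 <= (A + A) ^+ 2.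
  by move=> *; nra.
exact: le2.
Qed.

Lemma integrable_cosM (w : R) : mu.-integrable I01 (EFin \o (fun x => cos (w * x))).
Proof.
apply: (@continuous_compact_integrable R (fun x => cos (w * x))).
  exact: segment_compact.
by apply: continuous_subspaceT; exact: continuous_cosM.
Qed.

Lemma parseval c N :
  (\int[mu]_(x in I01) (tsq c N x)%:E = (\sum_(1 <= n < N.+1) c n ^+ 2)%:E)%E.
Proof.
have E x : (tsq c N x)%:E = (\sum_(1 <= n < N.+1) \sum_(1 <= m < N.+1)
    (c n * c m * cos (2 * pi * (n%:Z - m%:Z)%:~R * x))%:E)%E.
  by rewrite tsqE -sumEFin; apply: eq_bigr => n _; rewrite -sumEFin.
under eq_integral do rewrite E.
have it n m : mu.-integrable I01 (fun x => (c n * c m * cos (2 * pi * (n%:Z - m%:Z)%:~R * x))%:E).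
  have -> : (fun x => (c n * c m * cos (2 * pi * (n%:Z - m%:Z)%:~R * x))%:E) =
    (fun x => (c n * c m)%:E * (EFin \o (fun x => cos (2 * pi * (n%:Z - m%:Z)%:~R * x))) x)%E.
    by apply/funext => x; rewrite /= -EFinM.
  apply: integrableZl; last exact: integrable_cosM.
  exact: measurable_itv.
rewrite integral_sum//; last first.
  by move=> n; apply: integrable_sum => // m; exact: it.
rewrite -sumEFin; apply: eq_big_nat => n /andP[n1 nN].
rewrite integral_sum//.
rewrite (eq_bigr (fun m => (c n * c m * (n == m)%:R)%:E)); last first.
  move=> m _; under eq_integral do rewrite EFinM.
  rewrite integralZl//; last exact: integrable_cosM.
  by rewrite integral_cos_int subr_eq0 eqz_nat -EFinM.
rewrite sumEFin; congr EFin.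
rewrite (bigD1_seq n) /= ?mem_index_iota ?n1 ?iota_uniq// eqxx mulr1 -expr2.
by rewrite big1 ?addr0// => m /negbTE; rewrite eq_sym => ->; rewrite mulr0.
Qed.
End Parseval.

(** * Lattice truncations as trigonometric sums *)

Section TruncatedSums.
Variable R : realType.
Implicit Types (x s : R) (c : nat -> R).
Local Notation mu := (@lebesgue_measure R).
Local Notation I01 := (`[0%R, 1%R]%classic : set R).

Lemma Re_sum I (r : seq I) (F : I -> R[i]) :
  complex.Re (\sum_(i <- r) F i) = \sum_(i <- r) complex.Re (F i).
Proof. by elim/big_rec2: _ => // i a b _ <-; case: (F i) => ? ?; case: b. Qed.

Lemma Im_sum I (r : seq I) (F : I -> R[i]) :
  complex.Im (\sum_(i <- r) F i) = \sum_(i <- r) complex.Im (F i).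
Proof. by elim/big_rec2: _ => // i a b _ <-; case: (F i) => ? ?; case: b. Qed.

(** The opposite sign of the exponent is a complex conjugation, which the modulus does not see. *)
Lemma cabs_trig c N x :
  cabs (\sum_(1 <= n < N.+1) (c n)%:C%C * expi (n%:R * x)) = Num.sqrt (tsq c N x).
Proof.
rewrite cabs_sqrt Re_sum Im_sum /tsq /tcos /tsin sumrN sqrrN.
congr (Num.sqrt (_ ^+ 2 + _ ^+ 2)); apply: eq_bigr => n _ /=.
  by rewrite mul0r subr0 mulrA (mulrAC _ n%:R).
by rewrite mul0r addr0 mulrA (mulrAC _ n%:R).
Qed.

Definition rep_count (T : seq (int * int * int)) (J n : nat) : nat :=
  (\sum_(Q <- T) count (fun v => bqf Q v == n%:Z) (zbox (2 ^ J)))%N.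

(** [Y] bounds all values of the forms on the square, so grouping the points by value loses nothing.
    The origin has value 0, outside the range of n, but its term vanishes. *)
Lemma forms_square_trig (T : seq (int * int * int)) s (J : nat) :
  (forall Q, Q \in T -> posdef Q) -> 0 < s ->
  exists Y : nat, forall N x, (Y <= N)%N ->
   \sum_(Q <- T) square_sum (2 ^ J) (form_term Q s x) =
   \sum_(1 <= n < N.+1) ((rep_count T J n)%:R * n%:R `^ (- s))%:C%C * expi (n%:R * x).
Proof.
move=> pT s0.
exists (\sum_(Q <- T) \sum_(v <- zbox (2 ^ J)) absz (bqf Q v))%N => N x YN.
pose g (n : nat) : R[i] := (n%:R `^ (- s))%:C%C * expi (n%:R * x).
have term Q v : Q \in T -> v \in zbox (2 ^ J) ->
    form_term Q s x v.1 v.2 = \sum_(1 <= n < N.+1) (bqf Q v == n%:Z)%:R * g n.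
  move=> QT vz.
  have vY : (absz (bqf Q v) <= N)%N.
    apply: leq_trans YN; rewrite (big_rem Q QT) /= (big_rem v vz) /= -addnA.
    exact: leq_addr.
  have [v0|v0] := eqVneq v 0.
    have Q0 : bqf Q v = 0 by rewrite v0 /bqf /=; ring.
    rewrite /form_term /qpow -surjective_pairing Q0 powR0 ?oppr_eq0 ?gt_eqF// mul0r.
    by rewrite big_nat big1// => n /andP[n1 _]; case: n n1 => // n _; rewrite mul0r.
  have Qv := bqf_gt0 (pT _ QT) v0.
  rewrite /form_term /qpow -surjective_pairing.
  move: vY Qv; case: (bqf Q v) => // k kN k0.
  rewrite (bigD1_seq k) /= ?mem_index_iota ?iota_uniq//; last by rewrite ltnS kN andbT -ltz_nat.
  rewrite eqxx mul1r big1 ?addr0// => m /negbTE; rewrite eqz_nat eq_sym => ->.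
  by rewrite mul0r.
transitivity (\sum_(Q <- T) \sum_(v <- zbox (2 ^ J)) \sum_(1 <= n < N.+1) (bqf Q v == n%:Z)%:R * g n).
  rewrite big_seq [RHS]big_seq; apply: eq_bigr => Q QT.
  rewrite square_sum_zbox big_seq [RHS]big_seq; apply: eq_bigr => v vz.
  exact: term.
under eq_bigr do rewrite exchange_big /=.
rewrite exchange_big /=; apply: eq_bigr => n _.
under eq_bigr do rewrite -big_distrl /=.
rewrite -big_distrl /= rmorphM /= -mulrA; congr (_ * _).
rewrite /rep_count natr_sum rmorph_sum /=; apply: eq_bigr => Q _.
rewrite -sum1_count natr_sum rmorph_sum /= [RHS]big_mkcond /=; apply: eq_bigr => v _.
by case: ifP => // _; rewrite rmorph1.
Qed.

Lemma set_lt_measurable (D : set R) (f : R -> R) a :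
  measurable D -> measurable_fun D f -> measurable [set x | D x /\ a < f x].
Proof.
move=> mD mf; have := mf mD _ (measurable_itv `]a, +oo[).
rewrite (_ : D `&` _ = [set x | D x /\ a < f x])//.
by apply/seteqP; split => x /=; rewrite !in_itv /= andbT.
Qed.

(* Dyadic layer cake; [r > 2] makes the weak type bound square integrable, and Parseval turns it into a bound on the coefficients. *)
Lemma weak_type_l2 (c0 r : R) : 2 < r -> 0 <= c0 -> exists B : R, forall c N,
  (forall a, 0 < a -> (mu [set x | I01 x /\ (a < Num.sqrt (tsq c N x))%R] <= (c0 * a `^ (- r))%:E)%E) ->
  \sum_(1 <= n < N.+1) c n ^+ 2 <= B.
Proof.
(* The ratio of the layer sum: a layer of height 4^j has measure O(2^(-r j)). It is below 1 because
   r > 2. *)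
move=> r2 c00; pose q : R := 4 * 2 `^ (- r).
have q0 : 0 <= q by rewrite mulr_ge0// powR_ge0.
have q1 : q < 1.
  rewrite /q powRN -ltr_pdivlMr ?invr_gt0 ?powR_gt0// mul1r invrK.
  have -> : 4 = 2 `^ 2%:R :> R by rewrite powR_mulrn// -natrX.
  by rewrite /powR pnatr_eq0 /= ltr_expR ltr_pM2r// ln_gt0// ltr1n.
exists (1 + 4 * c0 / (1 - q)) => c N Hw.
have [B0 HB] := tsq_bounded c N.
have [k hk] : exists k : nat, B0 <= 2 ^+ k.
  exists (Num.truncn B0).+1; apply: le_trans (ltW (truncnS_gt _)) _.
  by rewrite -natrX ler_nat ltnW// ltn_expl.
(* Layer j + 1 is the set where [tsq] exceeds 4^j, with weight 4^(j + 1); at each point the highest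
   layer reached already dominates [tsq]. *)
pose A (i : nat) : set R := if i is j.+1 then [set x | I01 x /\ 4 ^+ j < tsq c N x] else I01.
pose w (i : nat) : R := if i is j.+1 then 4 ^+ j.+1 else 1.
have mA i : measurable (A i).
  case: i => [|i]; first exact: measurable_itv.
  by apply: set_lt_measurable; [exact: measurable_itv|exact: measurable_tsq].
have w0 i : 0 <= w i by case: i => [|i] /=; rewrite ?exprn_ge0.
have pt x : I01 x -> tsq c N x <= \sum_(i <- iota 0 k.+1) w i * \1_(A i) x.
  move=> Ix; rewrite /= big_cons /= mul1r indicE mem_set//=.
  have -> : iota 1 k = map (addn 1) (iota 0 k) by rewrite -iotaDl.
  rewrite big_map.
  have key m : tsq c N x <= 4 ^+ m ->
      tsq c N x <= 1 + \sum_(i <- iota 0 m) w (1 + i)%N * \1_(A (1 + i)%N) x.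
    elim: m => [|m IH]; first by rewrite big_nil addr0 expr0.
    move=> h; rewrite sum_iotaSr.
    have ge0 : 0 <= w (1 + m)%N * \1_(A (1 + m)%N) x by rewrite mulr_ge0.
    have [h'|h'] := leP (tsq c N x) (4 ^+ m).
      by apply: le_trans (IH h') _; rewrite lerD2l lerDl.
    have S0 : 0 <= \sum_(i <- iota 0 m) w (1 + i)%N * \1_(A (1 + i)%N) x.
      by apply: sumr_ge0 => i _; rewrite mulr_ge0.
    rewrite [X in _ <= _ + (_ + X)](_ : _ = 4 ^+ m.+1); first by lra.
    by rewrite indicE mem_set//= mulr1.
  apply: key.
  have s0 : 0 <= Num.sqrt (tsq c N x) by exact: sqrtr_ge0.
  have sk : Num.sqrt (tsq c N x) <= 2 ^+ k := le_trans (HB x) hk.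
  rewrite -(sqr_sqrtr (tsq_ge0 c N x)) (_ : 4 ^+ k = (2 ^+ k) ^+ 2).
    by rewrite lerXn2r ?nnegrE ?exprn_ge0.
  by rewrite exprAC (_ : 2 ^+ 2 = 4 :> R)// -natrX.
have H : (\int[mu]_(x in I01) (tsq c N x)%:E <=
    \int[mu]_(x in I01) (\sum_(i <- iota 0 k.+1) ((w i)%:E * (\1_(A i) x)%:E)))%E.
  apply: ge0_le_integral.
  - exact: measurable_itv.
  - by move=> x _; rewrite lee_fin tsq_ge0.
  - by apply/measurable_EFinP; exact: measurable_tsq.
  - apply: emeasurable_sum => i; apply: measurable_funeM.
    by apply/measurable_EFinP; apply: measurable_indic; exact: mA.
  - move=> x Ix; under eq_bigr do rewrite -EFinM.
    by rewrite sumEFin lee_fin; exact: pt.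
rewrite -lee_fin -parseval; apply: (le_trans H).
have E i : (\int[mu]_(x in I01) ((w i)%:E * (\1_(A i) x)%:E) = (w i)%:E * mu (A i `&` I01))%E.
  rewrite ge0_integralZl_EFin.
  - rewrite integral_indic; [by []|exact: measurable_itv|exact: mA].
  - exact: measurable_itv.
  - by move=> x _; rewrite lee_fin.
  - by apply/measurable_EFinP; apply: measurable_indic; exact: mA.
  - exact: w0.
rewrite ge0_integral_sum.
- rewrite (eq_bigr _ (fun i _ => E i)).
  apply: (@le_trans _ _ (\sum_(i <- iota 0 k.+1) (if i is j.+1 then 4 * c0 * q ^+ j else 1)%:E)%E).
    apply: lee_sum => -[|i] _.
      rewrite mul1e setIid lebesgue_measure_itv /= lte_fin ltr01.
      by rewrite -EFinB subr0.
    have p2 : 0 < 2 ^+ i :> R by rewrite exprn_gt0.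
    have Hi := Hw _ p2.
    have -> : A i.+1 `&` I01 = [set x | I01 x /\ (2 ^+ i < Num.sqrt (tsq c N x))%R].
      have sq x : (4 ^+ i < tsq c N x) = (2 ^+ i < Num.sqrt (tsq c N x)).
        rewrite -[RHS](@ltr_pXn2r _ 2)// ?nnegrE ?sqrtr_ge0 ?exprn_ge0//.
        by rewrite sqr_sqrtr ?tsq_ge0// exprAC (_ : 2 ^+ 2 = 4 :> R)// -natrX.
      by apply/seteqP; split => x /=; rewrite sq; [move=> [[]]|move=> []].
    apply: le_trans (lee_wpmul2l _ Hi) _; first by rewrite lee_fin; exact: w0.
    rewrite -EFinM lee_fin /w /q exprS exprMn.
    have -> : (2 ^+ i) `^ (- r) = (2 `^ (- r)) ^+ i :> R.
      by rewrite -(powR_mulrn i (powR_ge0 _ _)) -(powR_mulrn i (ler0n R 2)) -!powRrM mulrC.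
    by rewrite le_eqVlt; apply/orP; left; apply/eqP; ring.
  rewrite sumEFin lee_fin /= big_cons lerD2l.
  have -> : iota 1 k = map (addn 1) (iota 0 k) by rewrite -iotaDl.
  rewrite big_map /= -big_distrr /=.
  apply: ler_wpM2l; first by rewrite mulr_ge0.
  have -> : \sum_(i <- iota 0 k) q ^+ i = (1 - q ^+ k) / (1 - q).
    elim: (k) => [|n IH]; first by rewrite big_nil expr0 subrr mul0r.
    rewrite sum_iotaSr IH exprSr; field; lra.
  rewrite ler_pdivrMr ?subr_gt0// mulVf ?gerBl ?exprn_ge0// gt_eqF// subr_gt0//.
- exact: measurable_itv.
- move=> i; apply: measurable_funeM.
  by apply/measurable_EFinP; apply: measurable_indic; exact: mA.
- by move=> i x _; rewrite mule_ge0 ?lee_fin.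
Qed.
End TruncatedSums.

(** * Riesz-Fischer *)

Section RieszFischer.
Variable R : realType.
Implicit Types (x : R) (c : nat -> R).
Local Notation mu := (@lebesgue_measure R).
Local Notation I01 := (`[0%R, 1%R]%classic : set R).

Lemma cvg_of_geometric_steps (u : nat -> R) (H : R) : 0 <= H ->
  (forall k, 2 ^+ k * (u k.+1 - u k) ^+ 2 <= H) -> cvgn u.
Proof.
move=> H0 hu.
pose z : R := Num.sqrt 2^-1.
have z0 : 0 <= z by exact: sqrtr_ge0.
have z2 : z ^+ 2 = 2^-1 by rewrite sqr_sqrtr.
have z1 : `|z| < 1.
  rewrite ger0_norm// -(@ltr_pXn2r _ 2)// ?nnegrE// z2 expr1n; lra.
have step k : `|telescope u k| <= Num.sqrt H * z ^+ k.
  rewrite -(@ler_pXn2r _ 2)// ?nnegrE ?mulr_ge0 ?sqrtr_ge0 ?exprn_ge0//.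
  rewrite real_normK ?num_real// exprMn sqr_sqrtr// exprAC z2 exprVn.
  by rewrite ler_pdivlMr ?exprn_gt0// mulrC; exact: hu.
have cs : cvgn (series (telescope u)).
  apply: (@normed_cvg R R); apply: series_le_cvg step _ => [k|k|].
  - exact: normr_ge0.
  - by rewrite mulr_ge0 ?sqrtr_ge0 ?exprn_ge0.
  - exact: is_cvg_geometric_series.
have -> : u = (fun n => u 0%N + series (telescope u) n).
  by apply/funext => n; exact: eq_sum_telescope.
by apply: is_cvgD => //; exact: is_cvg_cst.
Qed.

(** The series of the 2^k (f_(k+1) - f_k)^2 has integral at most the sum of the 4^(-k), so it is
    finite almost everywhere; where it is finite the steps decay geometrically. *)
Lemma L2_ae_limit (f : nat -> R -> R) : (forall k, measurable_fun I01 (f k)) ->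
  (forall k, (\int[mu]_(x in I01) ((f k.+1 x - f k x) ^+ 2)%:E <= (8^-1 ^+ k)%:E)%E) ->
  exists2 g : R -> R, measurable_fun I01 g &
    {ae mu, forall x, I01 x -> (f k x) @[k --> \oo] --> g x}.
Proof.
move=> mf hf.
pose d k (x : R) : \bar R := (2 ^+ k * (f k.+1 x - f k x) ^+ 2)%:E.
have d0 k x : (0 <= d k x)%E by rewrite lee_fin mulr_ge0 ?sqr_ge0 ?exprn_ge0.
have mdf k : measurable_fun I01 (fun x => (f k.+1 x - f k x) ^+ 2).
  by apply: measurable_funX; apply: measurable_funB.
have md k : measurable_fun I01 (d k).
  apply/measurable_EFinP; apply: measurable_funM => //; exact: measurable_cst.
pose h x : \bar R := (\sum_(0 <= k <oo) d k x)%E.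
have h0 x : (0 <= h x)%E by apply: nneseries_ge0 => k _ _; exact: d0.
have intd k : (\int[mu]_(x in I01) d k x <= (4^-1 ^+ k)%:E)%E.
  have -> : (\int[mu]_(x in I01) d k x = (2 ^+ k)%:E * \int[mu]_(x in I01) ((f k.+1 x - f k x) ^+ 2)%:E)%E.
    rewrite -ge0_integralZl_EFin ?exprn_ge0//.
    - by move=> x _; rewrite lee_fin sqr_ge0.
    - apply/measurable_EFinP; exact: mdf.
  apply: le_trans (lee_wpmul2l _ (hf k)) _; first by rewrite lee_fin exprn_ge0.
  rewrite -EFinM lee_fin -exprMn (_ : 2 * 8^-1 = 4^-1)//; lra.
have inth : (\int[mu]_(x in I01) h x <= 2%:E)%E.
  rewrite /h integral_nneseries//; apply: lime_le.
    by apply: is_cvg_nneseries => k _ _; apply: integral_ge0.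
  apply: nearW => n; apply: (@le_trans _ _ (\sum_(0 <= k < n) (4^-1 ^+ k)%:E)%E).
    by apply: lee_sum => k _; exact: intd.
  rewrite sumEFin lee_fin.
  have -> : \sum_(0 <= k < n) 4^-1 ^+ k = (4 - 4 * 4^-1 ^+ n) / 3 :> R.
    elim: n => [|n IH]; first by rewrite big_geq// expr0; lra.
    rewrite big_nat_recr//= IH exprS; lra.
  have : 0 <= 4^-1 ^+ n :> R by rewrite exprn_ge0// invr_ge0.
  lra.
have mh : measurable_fun I01 h.
  apply: (@ge0_emeasurable_sum _ _ _ _ d xpredT) => [k x _ _|k _]; [exact: d0|exact: md].
have ih : mu.-integrable I01 h.
  apply/integrableP; split=> //.
  under eq_integral do rewrite gee0_abs//.
  by apply: le_lt_trans inth _; exact: ltry.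
have aeh : {ae mu, forall x, I01 x -> h x \is a fin_num}.
  by apply: integrable_ae ih; exact: measurable_itv.
have conv x : I01 x -> h x \is a fin_num -> (f k x) @[k --> \oo] --> limn (fun k => f k x).
  move=> Ix hx.
  apply: (@cvg_of_geometric_steps (fun k => f k x) (fine (h x))).
    by apply: fine_ge0.
  move=> k; rewrite -lee_fin fineK//.
  apply: le_trans (@nneseries_lim_ge R (fun k => d k x) xpredT 0 k.+1 _); last first.
    by move=> n _ _; exact: d0.
  rewrite big_nat_recr//= leeDr//.
  by apply: sume_ge0 => i _; exact: d0.
(* The upper limit is measurable on the whole interval and agrees with the limit wherever the
   sequence converges. *)
exists (fun x => fine (limn_esup (fun k => (f k x)%:E))).
  apply: (@measurableT_comp _ _ _ _ _ _ (@fine R)).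
    exact: fine_measurable.
  by apply: measurable_fun_limn_esup => k; apply/measurable_EFinP.
move: aeh; apply: filterS; first exact: (ae_filter_ringOfSetsType mu).
move=> x hx Ix.
have cx := conv x Ix (hx Ix).
have ex : (f k x)%:E @[k --> \oo] --> (limn (fun k => f k x))%:E.
  by apply: cvg_EFin => //; exact: nearW.
have [_ ->] := cvg_limn_einf_sup ex.
exact: cx.
Qed.

Definition restr c (M n : nat) : R := if (M < n)%N then c n else 0.

Lemma sum_restr (V : nmodType) (M N : nat) (F : nat -> V) : (M <= N)%N ->
  \sum_(1 <= n < N.+1) (if (M < n)%N then F n else 0) = \sum_(M.+1 <= n < N.+1) F n.
Proof.
move=> MN; rewrite (big_cat_nat (n := M.+1))//= big_nat big1 ?add0r; last first.
  by move=> n /andP[_ nM]; rewrite ltnNge -ltnS nM.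
rewrite big_nat [RHS]big_nat; apply: eq_bigr => n /andP[Mn _].
by rewrite Mn.
Qed.

Lemma tcos_sub c (M N : nat) x : (M <= N)%N ->
  tcos c N x - tcos c M x = tcos (restr c M) N x.
Proof.
move=> MN; rewrite /tcos [in LHS](big_cat_nat (n := M.+1))//= [LHS]addrC addKr.
rewrite -sum_restr//; apply: eq_bigr => n _; rewrite /restr; case: ifP => // _.
by rewrite mul0r.
Qed.

Lemma tsin_sub c (M N : nat) x : (M <= N)%N ->
  tsin c N x - tsin c M x = tsin (restr c M) N x.
Proof.
move=> MN; rewrite /tsin [in LHS](big_cat_nat (n := M.+1))//= [LHS]addrC addKr.
rewrite -sum_restr//; apply: eq_bigr => n _; rewrite /restr; case: ifP => // _.
by rewrite mul0r oppr0.
Qed.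

Lemma integral_tail c (M N : nat) : (M <= N)%N ->
  (\int[mu]_(x in I01) ((tcos c N x - tcos c M x) ^+ 2 + (tsin c N x - tsin c M x) ^+ 2)%:E
    = (\sum_(M.+1 <= n < N.+1) c n ^+ 2)%:E)%E.
Proof.
move=> MN; rewrite -sum_restr//.
rewrite (eq_bigr (fun n => restr c M n ^+ 2)); last first.
  by move=> n _; rewrite /restr; case: ifP => // _; rewrite expr0n.
by rewrite -parseval; apply: eq_integral => x _; rewrite tcos_sub// tsin_sub.
Qed.

Lemma square_summable_tail c (B : R) : (forall N, \sum_(1 <= n < N.+1) c n ^+ 2 <= B) ->
  exists2 t : nat -> R, t @ \oo --> 0 &
    forall M N, \sum_(M.+1 <= n < N.+1) c n ^+ 2 <= t M.
Proof.
move=> HB; pose u N := \sum_(1 <= n < N.+1) c n ^+ 2.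
have mono : nondecreasing_seq u.
  move=> M N MN; rewrite /u [leRHS](big_cat_nat (n := M.+1))//= lerDl.
  by apply: sumr_ge0 => n _; exact: sqr_ge0.
have cu : cvgn u.
  by apply: nondecreasing_is_cvgn => //; exists B => _ [N _ <-]; exact: HB.
have ub N : u N <= limn u by exact: nondecreasing_cvgn_le.
exists (fun M => limn u - u M).
  rewrite -[X in _ --> X](subrr (limn u)); apply: cvgB; [exact: cvg_cst|exact: cu].
move=> M N; have [NM|MN] := leqP N M.
  by rewrite big_geq// subr_ge0.
have E : u N = u M + \sum_(M.+1 <= n < N.+1) c n ^+ 2.
  by rewrite /u (big_cat_nat (n := M.+1))//= ltnW.
by have := ub N; rewrite E lerBrDl.
Qed.

Lemma small_tail (t : nat -> R) (e : R) : t @ \oo --> 0 -> 0 < e -> exists M : nat, t M <= e.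
Proof.
move=> /cvgrPdist_le/(_ e) H /H[M _ HM]; exists M.
have := HM M (leqnn _); rewrite /= sub0r normrN; exact: le_trans (ler_norm _).
Qed.

(** A sparse subsequence converges almost everywhere. Fatou's lemma along it bounds the distance of
    every partial sum to the limit by the tail of the squares, so the full sequence converges in the
    mean. *)
Lemma riesz_fischer c (B : R) : (forall N, \sum_(1 <= n < N.+1) c n ^+ 2 <= B) ->
  exists f g : R -> R, [/\ measurable_fun I01 f, measurable_fun I01 g &
   (fun N => \int[mu]_(x in I01) ((tcos c N x - f x) ^+ 2 + (tsin c N x - g x) ^+ 2)%:E)%E
     @ \oo --> 0%E].
Proof.
move=> HB; have [t t0 tail] := square_summable_tail HB.
have /choice[K HK] : forall k : nat, exists M : nat,
    forall N, \sum_(M.+1 <= n < N.+1) c n ^+ 2 <= 8^-1 ^+ k.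
  move=> k; have [|M HM] := @small_tail t (8^-1 ^+ k) t0; first by rewrite exprn_gt0// invr_gt0.
  by exists M => N; apply: le_trans (tail M N) HM.
(* A nondecreasing choice with both [K k] and [k] below [L k]. *)
pose L k := (k + \sum_(i <- iota 0 k.+1) K i)%N.
have LK k : (K k <= L k)%N.
  by rewrite /L iotaSr -cats1 big_cat big_seq1 addnA leq_addl.
have LS k : (L k <= L k.+1)%N.
  rewrite /L; apply: leq_add => //; rewrite (iotaSr 0 k.+1) -cats1 big_cat /=; exact: leq_addr.
have Lk k : (k <= L k)%N by exact: leq_addr.
have tailL k N : \sum_((L k).+1 <= n < N.+1) c n ^+ 2 <= 8^-1 ^+ k.
  apply: le_trans (HK k N); have [NL|LN] := leqP N (L k).
    by rewrite big_geq// sumr_ge0// => n _; exact: sqr_ge0.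
  rewrite [leRHS](big_cat_nat (n := (L k).+1)) ?ltnS ?LK 1?ltnW//= lerDr.
  by apply: sumr_ge0 => n _; exact: sqr_ge0.
have step k : (\int[mu]_(x in I01) ((tcos c (L k.+1) x - tcos c (L k) x) ^+ 2 +
    (tsin c (L k.+1) x - tsin c (L k) x) ^+ 2)%:E <= (8^-1 ^+ k)%:E)%E.
  by rewrite integral_tail// lee_fin; exact: tailL.
have mc N : measurable_fun I01 (tcos c N) by exact: measurable_tcos.
have ms N : measurable_fun I01 (tsin c N) by exact: measurable_tsin.
have mcd N M : measurable_fun I01 (fun x => (tcos c N x - tcos c M x) ^+ 2).
  by apply: measurable_funX; apply: measurable_funB.
have msd N M : measurable_fun I01 (fun x => (tsin c N x - tsin c M x) ^+ 2).
  by apply: measurable_funX; apply: measurable_funB.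
have [f mf cf] : exists2 f : R -> R, measurable_fun I01 f &
    {ae mu, forall x, I01 x -> (tcos c (L k) x) @[k --> \oo] --> f x}.
  apply: L2_ae_limit => // k; apply: le_trans (step k).
  apply: ge0_le_integral.
  - exact: measurable_itv.
  - by move=> x _; rewrite lee_fin sqr_ge0.
  - by apply/measurable_EFinP; exact: mcd.
  - by apply/measurable_EFinP; apply: measurable_funD; [exact: mcd|exact: msd].
  - by move=> x _; rewrite lee_fin lerDl sqr_ge0.
have [g mg cg] : exists2 g : R -> R, measurable_fun I01 g &
    {ae mu, forall x, I01 x -> (tsin c (L k) x) @[k --> \oo] --> g x}.
  apply: L2_ae_limit => // k; apply: le_trans (step k).
  apply: ge0_le_integral.
  - exact: measurable_itv.
  - by move=> x _; rewrite lee_fin sqr_ge0.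
  - by apply/measurable_EFinP; exact: msd.
  - by apply/measurable_EFinP; apply: measurable_funD; [exact: mcd|exact: msd].
  - by move=> x _; rewrite lee_fin lerDr sqr_ge0.
exists f, g; split=> //.
pose D N (x : R) := (tcos c N x - f x) ^+ 2 + (tsin c N x - g x) ^+ 2.
have mD N : measurable_fun I01 (D N).
  by apply: measurable_funD; apply: measurable_funX; apply: measurable_funB.
(* The shift by [N] ensures L (k + N) >= N, so that [integral_tail] applies for every [k]. *)
pose G N k (x : R) := (tcos c (L (k + N)%N) x - tcos c N x) ^+ 2 + (tsin c (L (k + N)%N) x - tsin c N x) ^+ 2.
have mG N k : measurable_fun I01 (G N k).
  by apply: measurable_funD; [exact: mcd|exact: msd].
have bound N : (\int[mu]_(x in I01) (D N x)%:E <= (t N)%:E)%E.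
  apply: (@le_trans _ _ (\int[mu]_(x in I01) limn_einf (fun k => (G N k x)%:E))%E).
    apply: ae_ge0_le_integral.
    - exact: measurable_itv.
    - by move=> x _; rewrite lee_fin addr_ge0 ?sqr_ge0.
    - by apply/measurable_EFinP; exact: mD.
    - move=> x _; rewrite limn_einf_lim; apply: lime_ge; first exact: is_cvg_einfs.
      by apply: nearW => n; apply: le_ereal_inf_tmp => _ [k _ <-]; rewrite lee_fin addr_ge0 ?sqr_ge0.
    - under eq_fun do rewrite /limn_einf.
      apply: measurableT_comp => //; apply: measurable_fun_limn_esup => k.
      by apply: measurableT_comp => //; apply/measurable_EFinP; exact: mG.
    move: cf cg; apply: filterS2; first exact: (ae_filter_ringOfSetsType mu).
    move=> x cfx cgx Ix.
    have lim : (fun k => (G N k x)%:E) @ \oo --> (D N x)%:E.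
      apply: cvg_EFin; first exact: nearW.
      have c1 : (fun k => tcos c (L (k + N)%N) x) @ \oo --> f x.
        by rewrite (cvg_shiftn N (fun k => tcos c (L k) x)); exact: cfx.
      have c2 : (fun k => tsin c (L (k + N)%N) x) @ \oo --> g x.
        by rewrite (cvg_shiftn N (fun k => tsin c (L k) x)); exact: cgx.
      have -> : D N x = (f x - tcos c N x) * (f x - tcos c N x) + (g x - tsin c N x) * (g x - tsin c N x).
        by rewrite /D; ring.
      rewrite (_ : fine \o _ = (fun k =>
        (tcos c (L (k + N)%N) x - tcos c N x) * (tcos c (L (k + N)%N) x - tcos c N x) +
        (tsin c (L (k + N)%N) x - tsin c N x) * (tsin c (L (k + N)%N) x - tsin c N x))).
        have d1 : (fun k => tcos c (L (k + N)%N) x - tcos c N x) @ \oo --> f x - tcos c N x.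
          by apply: cvgB => //; exact: cvg_cst.
        have d2 : (fun k => tsin c (L (k + N)%N) x - tsin c N x) @ \oo --> g x - tsin c N x.
          by apply: cvgB => //; exact: cvg_cst.
        by apply: cvgD; apply: cvgM.
      by apply/funext => k; rewrite /= /G !expr2.
    by have [-> _] := cvg_limn_einf_sup lim.
  apply: (@le_trans _ _ (limn_einf (fun k => \int[mu]_(x in I01) (G N k x)%:E))%E).
    apply: fatou.
    - exact: measurable_itv.
    - by move=> k; apply/measurable_EFinP; exact: mG.
    - by move=> k x _; rewrite lee_fin addr_ge0 ?sqr_ge0.
  rewrite limn_einf_lim; apply: lime_le; first exact: is_cvg_einfs.
  apply: nearW => n; apply: ge_ereal_inf; exists (\int[mu]_(x in I01) (G N n x)%:E)%E.
    by exists n => /=.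
  rewrite integral_tail ?lee_fin//.
  exact: leq_trans (leq_addl n N) (Lk _).
apply: (@squeeze_cvge _ _ _ _ (fun=> 0%E) _ (fun N => (t N)%:E)).
- apply: nearW => N; rewrite bound andbT; apply: integral_ge0 => x _.
  by rewrite lee_fin addr_ge0 ?sqr_ge0.
- exact: cvg_cst.
- by apply: cvg_EFin => //; exact: nearW.
Qed.
End RieszFischer.

(** * Passage to the limit *)

Section WeakLimit.
Variable R : realType.
Implicit Types (x : R) (c : nat -> R).
Local Notation mu := (@lebesgue_measure R).
Local Notation I01 := (`[0%R, 1%R]%classic : set R).

Lemma tsq_scale (k : R) c N x : tsq (fun n => k * c n) N x = k ^+ 2 * tsq c N x.
Proof.
have -> : tsq (fun n => k * c n) N x = (k * tcos c N x) ^+ 2 + (k * tsin c N x) ^+ 2.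
  rewrite /tsq /tcos /tsin !big_distrr /=; congr (_ ^+ 2 + _ ^+ 2).
    by apply: eq_bigr => n _; rewrite mulrA.
  by apply: eq_bigr => n _; rewrite mulrN mulrA.
by rewrite /tsq; ring.
Qed.

Lemma measurable_sqrt (D : set R) (f : R -> R) : measurable_fun D f ->
  measurable_fun D (fun x => Num.sqrt (f x)).
Proof.
move=> mf; apply: (@measurableT_comp _ _ _ _ _ _ (@Num.sqrt R)) => //.
by apply: continuous_measurable_fun; exact: sqrt_continuous.
Qed.

Lemma chebyshev_sqrt (f : R -> R) (b : R) : 0 < b -> measurable_fun I01 f ->
  (forall x, 0 <= f x) ->
  ((b ^+ 2)%:E * mu [set x | I01 x /\ (b < Num.sqrt (f x))%R] <= \int[mu]_(x in I01) (f x)%:E)%E.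
Proof.
move=> b0 mf f0; set E := [set x | _].
have mE : measurable E.
  by apply: set_lt_measurable; [exact: measurable_itv|exact: measurable_sqrt].
have EI : E `&` I01 = E by apply/seteqP; split => x [].
have <- : (\int[mu]_(x in I01) ((b ^+ 2)%:E * (\1_E x)%:E) = (b ^+ 2)%:E * mu E)%E.
  rewrite ge0_integralZl_EFin.
  - by rewrite integral_indic; [rewrite EI|exact: measurable_itv|exact: mE].
  - exact: measurable_itv.
  - by move=> x _; rewrite lee_fin.
  - by apply/measurable_EFinP; apply: measurable_indic; exact: mE.
  - exact: sqr_ge0.
apply: ge0_le_integral.
- exact: measurable_itv.
- by move=> x _; rewrite mule_ge0// lee_fin// sqr_ge0.
- by apply: measurable_funeM; apply/measurable_EFinP; apply: measurable_indic; exact: mE.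
- by apply/measurable_EFinP.
move=> x Ix; rewrite -EFinM lee_fin indicE; case: (boolP (x \in E)) => [|_]; last by rewrite mulr0.
rewrite inE /E /= => -[_ h]; rewrite mulr1 -(sqr_sqrtr (f0 x)).
by apply: lerXn2r; rewrite ?nnegrE ?sqrtr_ge0 ?ltW.
Qed.

Lemma sqrt_triangle (a1 a2 b1 b2 : R) :
  Num.sqrt ((a1 + b1) ^+ 2 + (a2 + b2) ^+ 2) <=
  Num.sqrt (a1 ^+ 2 + a2 ^+ 2) + Num.sqrt (b1 ^+ 2 + b2 ^+ 2).
Proof. by have := cabsD (a1 +i* a2)%C (b1 +i* b2)%C; rewrite !cabs_sqrt. Qed.

(** The limit is the truncation [b J], plus the sum with coefficients a - b J, plus the error of the
    partial sum; at a point of the set one of them exceeds alpha / 3. The last two are small in the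
    mean square, the middle one because its coefficients vanish up to [X] and are at most [a]
    beyond. *)
Lemma weak_type_limit (a : nat -> R) (b : nat -> nat -> R) (Y : nat -> nat) (c0 r B : R) (mre mim : R -> R) :
  (forall N, \sum_(1 <= n < N.+1) a n ^+ 2 <= B) ->
  (forall J n, (0 < n)%N -> 0 <= b J n <= a n) ->
  (forall X, exists J, forall n, (0 < n <= X)%N -> b J n = a n) ->
  (forall J N alpha, (Y J <= N)%N -> 0 < alpha ->
    (mu [set x | I01 x /\ (alpha < Num.sqrt (tsq (b J) N x))%R] <= (c0 * alpha `^ (- r))%:E)%E) ->
  measurable_fun I01 mre -> measurable_fun I01 mim ->
  (fun N => \int[mu]_(x in I01) ((tcos a N x - mre x) ^+ 2 + (tsin a N x - mim x) ^+ 2)%:E)%E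
     @ \oo --> 0%E ->
  forall alpha, 0 < alpha ->
    (mu [set x | I01 x /\ (alpha < Num.sqrt (mre x ^+ 2 + mim x ^+ 2))%R]
       <= (c0 * (alpha / 3) `^ (- r))%:E)%E.
Proof.
move=> HB hb hJ weak mmre mmim lim alpha al0.
have be0 : 0 < alpha / 3 by rewrite divr_gt0.
set be := alpha / 3 in be0 *.
have be2 : 0 < be ^+ 2 by rewrite exprn_gt0.
have [t t0 tail] := square_summable_tail HB.
apply/lee_addgt0Pr => e e0.
(* Chebyshev's inequality at height [be] turns the mean square bound [dl] into measure e / 2. *)
pose dl := be ^+ 2 * (e / 2).
have dl0 : 0 < dl by rewrite mulr_gt0// divr_gt0.
have [X HX] := small_tail t0 dl0.
have [J HJ] := hJ X.
have [N0 HN0] : exists N0, forall N, (N0 <= N)%N ->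
    (\int[mu]_(x in I01) ((tcos a N x - mre x) ^+ 2 + (tsin a N x - mim x) ^+ 2)%:E <= dl%:E)%E.
  have : \forall N \near \oo, (\int[mu]_(x in I01) ((tcos a N x - mre x) ^+ 2 + (tsin a N x - mim x) ^+ 2)%:E < dl%:E)%E.
    by apply: (lim [set y | (y < dl%:E)%E]); apply: open_ereal_lt'; rewrite lte_fin.
  by move=> [N0 _ H]; exists N0 => N hN; apply/ltW/H.
pose N := maxn N0 (maxn X (Y J)).
have N1 : (N0 <= N)%N by exact: leq_maxl.
have N2 : (X <= N)%N by rewrite /N !leq_max leqnn orbT.
have N3 : (Y J <= N)%N by rewrite /N !leq_max leqnn !orbT.
pose d n := a n - b J n.
have dcos x : tcos a N x = tcos (b J) N x + tcos d N x.
  by rewrite /tcos -big_split /=; apply: eq_bigr => n _; rewrite /d; ring.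
have dsin x : tsin a N x = tsin (b J) N x + tsin d N x.
  by rewrite /tsin -big_split /=; apply: eq_bigr => n _; rewrite /d; ring.
have dsum : \sum_(1 <= n < N.+1) d n ^+ 2 <= dl.
  apply: le_trans HX; apply: le_trans (tail X N).
  rewrite (big_cat_nat (n := X.+1))//= big_nat big1 ?add0r; last first.
    by move=> n /andP[n1 nX]; rewrite /d HJ ?subrr ?expr0n// n1 -ltnS.
  rewrite big_nat [leRHS]big_nat; apply: ler_sum => n /andP[nX nN].
  have n0 : (0 < n)%N by exact: leq_ltn_trans nX.
  have /andP[b0 ba] := hb J n n0.
  by apply: lerXn2r; rewrite ?nnegrE /d; lra.
pose E1 := [set x | I01 x /\ (be < Num.sqrt (tsq (b J) N x))%R].
pose E2 := [set x | I01 x /\ (be < Num.sqrt (tsq d N x))%R].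
pose F x := (tcos a N x - mre x) ^+ 2 + (tsin a N x - mim x) ^+ 2.
pose E3 := [set x | I01 x /\ (be < Num.sqrt (F x))%R].
have mF : measurable_fun I01 F.
  by apply: measurable_funD; apply: measurable_funX; apply: measurable_funB => //;
    [exact: measurable_tcos|exact: measurable_tsin].
have m1 : measurable E1.
  by apply: set_lt_measurable; [exact: measurable_itv|apply: measurable_sqrt; exact: measurable_tsq].
have m2 : measurable E2.
  by apply: set_lt_measurable; [exact: measurable_itv|apply: measurable_sqrt; exact: measurable_tsq].
have m3 : measurable E3.
  by apply: set_lt_measurable; [exact: measurable_itv|exact: measurable_sqrt].
set E := [set x | _].
have mE : measurable E.
  apply: set_lt_measurable; first exact: measurable_itv.
  by apply: measurable_sqrt; apply: measurable_funD; apply: measurable_funX.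
have sub : E `<=` E1 `|` (E2 `|` E3).
  move=> x [Ix h]; apply: contrapT => /not_orP[n1 /not_orP[n2 n3]].
  have h1 : Num.sqrt (tsq (b J) N x) <= be by rewrite leNgt; apply/negP => ?; apply: n1.
  have h2 : Num.sqrt (tsq d N x) <= be by rewrite leNgt; apply/negP => ?; apply: n2.
  have h3 : Num.sqrt (F x) <= be by rewrite leNgt; apply/negP => ?; apply: n3.
  have t1 := sqrt_triangle (tcos (b J) N x + tcos d N x) (tsin (b J) N x + tsin d N x)
    (mre x - tcos a N x) (mim x - tsin a N x).
  have t2 := sqrt_triangle (tcos (b J) N x) (tsin (b J) N x) (tcos d N x) (tsin d N x).
  rewrite -dcos -dsin !subrKC in t1 t2.
  have FE : F x = (mre x - tcos a N x) ^+ 2 + (mim x - tsin a N x) ^+ 2 by rewrite /F; ring.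
  rewrite FE in h3; rewrite /tsq in h1 h2.
  move: h; rewrite ltNge => /negP; apply.
  apply: le_trans t1 _; rewrite /be in h1 h2 h3; lra.
have small (G : R -> R) : measurable_fun I01 G -> (forall x, 0 <= G x) ->
    (\int[mu]_(x in I01) (G x)%:E <= dl%:E)%E ->
    (mu [set x | I01 x /\ (be < Num.sqrt (G x))%R] <= (e / 2)%:E)%E.
  move=> mG G0 hG; rewrite -(@lee_pmul2l _ (be ^+ 2)%:E)//.
  by apply: le_trans (chebyshev_sqrt be0 mG G0) _; rewrite -EFinM.
apply: (@le_trans _ _ (mu (E1 `|` (E2 `|` E3)))).
  by apply: le_measure; rewrite ?inE//; apply: measurableU => //; apply: measurableU.
apply: (@le_trans _ _ (mu E1 + mu (E2 `|` E3))%E).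
  by apply: measureU2 => //; apply: measurableU.
apply: leeD; first exact: weak.
apply: (@le_trans _ _ (mu E2 + mu E3)%E); first exact: measureU2.
rewrite (_ : e = e / 2 + e / 2); last lra.
rewrite EFinD; apply: leeD; apply: small.
- exact: measurable_tsq.
- exact: tsq_ge0.
- by rewrite parseval lee_fin.
- exact: mF.
- by move=> x; rewrite addr_ge0 ?sqr_ge0.
- exact: HN0.
Qed.
End WeakLimit.

(** * The ideal series *)

Section IdealSeries.
Variable R : realType.
Local Notation mu := (@lebesgue_measure R).
Local Notation I01 := (`[0%R, 1%R]%classic : set R).

Definition ideal_coef (D : int) (s : R) (n : nat) : R := (ideal_count D n)%:R * n%:R `^ (- s).

(** [b J] counts only the representations inside the square of half side 2^J. The sum is the same
    for all N >= Y J, so the weak bound need only be proved at N = Y J, with a constant independent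
    of [J]. *)
Lemma ideal_truncations (D : int) (s : R) :
  D < 0 -> fundamental_disc D -> 2^-1 < s -> s < 1 ->
  exists (b : nat -> nat -> R) (Y : nat -> nat) (c0 : R), [/\ 0 <= c0,
    (forall J n, (0 < n)%N -> 0 <= b J n <= ideal_coef D s n),
    (forall X, exists J, forall n, (0 < n <= X)%N -> b J n = ideal_coef D s n) &
    (forall J N alpha, (Y J <= N)%N -> 0 < alpha ->
      (mu [set x | I01 x /\ (alpha < Num.sqrt (tsq (b J) N x))%R]
        <= (c0 * alpha `^ (- (1 - s)^-1))%:E)%E)].
Proof.
move=> D0 fD s1 s2; have s0 : 0 < s by lra.
have [W [T [W0 pT cnt]]] := ideal_count_zbox D0 fD.
have W0R : 0 < W%:R :> R by rewrite ltr0n.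
pose b J n : R := W%:R^-1 * ((rep_count T J n)%:R * n%:R `^ (- s)).
have [Y HY] := choice (fun J => @forms_square_trig R T s J pT s0).
have tsqE J N x : (Y J <= N)%N ->
    Num.sqrt (tsq (b J) N x) = W%:R^-1 * cabs (\sum_(Q <- T) square_sum (2 ^ J) (form_term Q s x)).
  move=> YN; rewrite /b tsq_scale sqrtrM ?sqr_ge0// sqrtr_sqr ger0_norm ?invr_ge0 ?ler0n//.
  by rewrite -cabs_trig (HY J _ _ YN).
have sb : 0 < s <= 1 by rewrite s0 ltW.
have [K [C [K0 C0 HK]]] := forms_square_bound pT sb.
have [c0 c00 Hc0] : exists2 c, 0 <= c & forall J alpha, 0 < alpha ->
    (mu [set x | I01 x /\ (alpha < Num.sqrt (tsq (b J) (Y J) x))%R]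
      <= (c * alpha `^ (- (1 - s)^-1))%:E)%E.
  apply: (@weak_type_of_dyadic _ (fun J x => Num.sqrt (tsq (b J) (Y J) x)) (W%:R^-1 * K) s C) => //.
  - by rewrite mulr_ge0// invr_ge0 ler0n.
  - by move=> J; apply: measurable_sqrt; exact: measurable_tsq.
  - by move=> J x; rewrite tsqE// -mulrA ler_pM2l ?invr_gt0//; exact: HK.
exists b, Y, c0; split=> //.
- move=> J n n0; have [le_cnt _] := cnt n n0.
  have p0 : 0 <= n%:R `^ (- s) by exact: powR_ge0.
  rewrite /b /ideal_coef !mulr_ge0 ?invr_ge0 ?ler0n//= mulrA ler_wpM2r// ler_pdivrMl//.
  by rewrite -natrM ler_nat; exact: le_cnt.
- move=> X.
  (* For n <= X the half side must exceed 4 (Q.1.1 + Q.2) n, which is at most m X; 2^(m X + 1)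
     does. *)
  pose m := (\sum_(Q <- T) absz (4 * (Q.1.1 + Q.2))%R)%N.
  exists (m * X).+1 => n /andP[n0 nX]; have [_ eq_cnt] := cnt n n0.
  rewrite /b /ideal_coef /rep_count eq_cnt.
    by rewrite natrM mulrA mulKf// gt_eqF.
  move=> Q QT.
  have mX : (absz (4 * (Q.1.1 + Q.2))%R * n <= m * X)%N.
    by apply: leq_mul => //; rewrite /m (big_rem Q QT) /=; exact: leq_addr.
  have lt2 : (m * X < 2 ^ (m * X).+1)%N by apply: ltnW; exact: ltn_expl.
  apply: (@le_lt_trans _ _ ((absz (4 * (Q.1.1 + Q.2)))%:Z * n%:Z)).
    by apply: ler_wpM2r => //; rewrite abszE ler_norm.
  by rewrite -PoszM ltz_nat; exact: leq_ltn_trans lt2.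
- move=> J N alpha YN al0; apply: le_trans (Hc0 J _ al0).
  suff -> : [set x | I01 x /\ (alpha < Num.sqrt (tsq (b J) N x))%R] =
      [set x | I01 x /\ (alpha < Num.sqrt (tsq (b J) (Y J) x))%R] by [].
  by apply/seteqP; split=> x /=; rewrite !tsqE.
Qed.

(** The bound of [weak_type_l2] depends only on the weak type constant, which is common to all
    truncations, and every initial segment of the coefficients is an initial segment of some
    truncation. *)
Lemma ideal_coef_square_sum (D : int) (s : R) :
  D < 0 -> fundamental_disc D -> 2^-1 < s -> s < 1 ->
  exists B : R, forall N, \sum_(1 <= n < N.+1) ideal_coef D s n ^+ 2 <= B.
Proof.
move=> D0 fD s1 s2; have [b [Y [c0 [c00 hb hJ weak]]]] := ideal_truncations D0 fD s1 s2.
have r2 : 2 < (1 - s)^-1 by rewrite -[2]invrK ltf_pV2 ?posrE; lra.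
have [B HB] := weak_type_l2 r2 c00; exists B => X.
have [J HJ] := hJ X.
pose N := maxn X (Y J).
have XN : (X.+1 <= N.+1)%N by rewrite ltnS leq_maxl.
apply: le_trans (HB (b J) N (fun al al0 => weak J N al (leq_maxr _ _) al0)).
rewrite [leRHS](big_cat_nat (n := X.+1))//=; apply: ler_wpDr.
  by apply: sumr_ge0 => n _; exact: sqr_ge0.
by rewrite big_nat [leRHS]big_nat; apply: ler_sum => n /andP[n1 nX]; rewrite HJ// n1 -ltnS.
Qed.
End IdealSeries.

Theorem theorem5 (R : realType) (D : int) (s : R) :
  D < 0 -> fundamental_disc D -> 2^-1 < s -> s < 1 ->
  (exists mre mim : R -> R, is_L2_limit D s mre mim) /\
  (forall mre mim : R -> R, is_L2_limit D s mre mim ->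
     exists c : R, forall alpha : R, 0 < alpha ->
       (@lebesgue_measure R
          [set x | x \in (`[0%R, 1%R]%classic : set R) /\ (alpha < Num.sqrt (mre x ^+ 2 + mim x ^+ 2))%R]
        <= (c * alpha `^ (- (1 - s)^-1))%:E)%E).
Proof.
move=> D0 fD s1 s2; have [B HB] := ideal_coef_square_sum D0 fD s1 s2; split.
  have [f [g [mf mg lim]]] := riesz_fischer HB.
  by exists f, g.
move=> mre mim [mmre [mmim lim]].
have [b [Y [c0 [c00 hb hJ weak]]]] := ideal_truncations D0 fD s1 s2.
exists (c0 * 3^-1 `^ (- (1 - s)^-1)) => alpha al0.
under eq_set do rewrite inE.
have := weak_type_limit HB hb hJ weak mmre mmim lim al0.
by rewrite powRM ?(ltW al0)// [X in c0 * X]mulrC mulrA.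
Qed.
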